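(* Let $\mathbb P=\{p_n\}_{n\ge1}$ be a sequence of integers and $\mathbb D=\{D_n\}_{n\ge1}$ a sequence of subsets of $\mathbb Z$ such that: for every $n\ge1$, $D_n-D_n\subset\{0,\pm1,\pm2,\dots,\pm(|p_n|-1)\}$ and $\#D_n\in\{2,3\}$; and the set $\bigcup_{n\ge1}D_n$ is bounded. Write $D_n=\{a_n,b_n\}$ if $\#D_n=2$ and $D_n=\{a_n,b_n,c_n\}$ if $\#D_n=3$. Then the Moran-type measure $\mu_{\mathbb P,\mathbb D}$ is a spectral measure if and only if $\left\{\frac{b_n-a_n}{d_n},\frac{c_n-a_n}{d_n}\right\}\equiv\{-1,1\}\pmod 3$ for every $n$ with $q_n=3$, and for any two distinct positive integers $m,n$ one has (i) $k_m\ne k_n$ when $q_m=q_n$; (ii) either $k_m\ge\nu_{q_m}(L_n)$ or $k_n\ge\nu_{q_n}(L_m)$ when $q_m\ne q_n$.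
   Context: A Borel probability measure $\mu$ on $\mathbb R$ is spectral if there is a countable set $\Lambda\subset\mathbb R$ such that $\{e^{2\pi i\lambda x}:\lambda\in\Lambda\}$ is an orthonormal basis of $L^2(\mu)$. For a finite nonempty set $A$, $\delta_A:=\frac1{\#A}\sum_{a\in A}\delta_a$, with $\delta_a$ the Dirac measure at $a$. The measure $\mu_{\mathbb P,\mathbb D}$ is the weak limit, as $n\to\infty$, of $\delta_{p_1^{-1}D_1}\ast\delta_{p_1^{-1}p_2^{-1}D_2}\ast\cdots\ast\delta_{p_1^{-1}\cdots p_n^{-1}D_n}$ (which exists under the hypotheses). For a prime $m$ and a nonzero integer $n$, $\nu_m(n)$ is the largest $k\ge0$ with $m^k\mid n$; for a nonzero rational $a/b$, $\nu_m(a/b)=\nu_m(a)-\nu_m(b)$. For $n\ge1$: $q_n:=\#D_n$; $d_n:=\gcd(D_n-a_n)$ (greatest common divisor of the elements of $D_n-a_n$, independent of the choice of $a_n\in D_n$); $k_n:=\nu_{q_n}\!\left(\frac{p_1p_2\cdots p_n}{d_nq_n}\right)$; and $L_n$ is the rational number defined by $\frac{p_1p_2\cdots p_n}{d_nq_n}=q_n^{k_n}L_n$ (so $\nu_{q_n}(L_n)=0$). The congruence of two-element sets modulo 3 means equality of the sets of residues modulo 3. *)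

(* Defs.v *)
From HB Require Import structures.
From mathcomp Require Export all_boot all_order all_algebra finmap.
From mathcomp Require Export all_classical all_reals all_analysis.
From mathcomp Require Export measurable_realfun.
From mathcomp.real_closed Require Export complex.
Set Implicit Arguments.
Unset Strict Implicit.
Unset Printing Implicit Defensive.
Import Order.TTheory GRing.Theory Num.Theory.
Import numFieldNormedType.Exports.

Local Open Scope classical_set_scope.
Local Open Scope ring_scope.

Section Spectral.
Context {R : realType}.
Implicit Types (mu : probability R R) (f g : R -> R[i]).

Definition cintegral mu f : R[i] :=
  Complex (\int[mu]_x complex.Re (f x)) (\int[mu]_x complex.Im (f x)).

Definition L2norm mu f : \bar R :=
  Lnorm mu 2%:E (fun x => (Normc.normc (f x))%:E).

Definition in_L2 mu f : Prop :=
  [/\ measurable_fun [set: R] (fun x => complex.Re (f x)),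
      measurable_fun [set: R] (fun x => complex.Im (f x)) &
      (L2norm mu f < +oo)%E].

Definition L2inner mu f g : R[i] := cintegral mu (fun x => f x * (g x)^*%C).

(* A family [e] indexed by [Lam] is an orthonormal basis of [L^2(mu)]: it is
   orthonormal and its finite linear combinations are dense. *)
Definition orthonormal_basis mu (I : choiceType) (Lam : set I)
    (e : I -> R -> R[i]) : Prop :=
  [/\ forall i, Lam i -> in_L2 mu (e i),
      forall i j, Lam i -> Lam j -> L2inner mu (e i) (e j) = (i == j)%:R &
      forall f, in_L2 mu f -> forall eps : R, 0 < eps ->
        exists (s : {fset I}) (c : I -> R[i]),
          (forall i, i \in s -> Lam i) /\
          (L2norm mu (fun x => f x - \sum_(i <- s) c i * e i x)%R
             < eps%:E)%E].

(* [fourier_exp l x] is $e^{2\pi i l x}$. *)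
Definition fourier_exp (l x : R) : R[i] :=
  Complex (cos (2 * pi * l * x)) (sin (2 * pi * l * x)).

Definition spectral mu : Prop :=
  exists Lam : set R, countable Lam /\ orthonormal_basis mu Lam fourier_exp.

End Spectral.

Section Convolution.
Context {R : realType}.

Definition addpair (xy : R * R) : R := xy.1 + xy.2.

Let measurable_addpair : measurable_fun setT addpair.
Proof.
by apply: measurable_funD; [exact: measurable_fst | exact: measurable_snd].
Qed.

HB.instance Definition _ :=
  isMeasurableFun.Build _ _ _ _ addpair measurable_addpair.

Definition convolution (mu nu : probability R R) : probability R R :=
  distribution (mu \x nu)%E addpair.

(* The measure $\delta_A$: the sum of the Dirac masses at the points of [A],
   normalized; [delta_fsetE] gives the formula.  The value $\delta_0$ for
   [A = fset0] is junk. *)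
Definition delta_fset (A : {fset R}) : probability R R :=
  mnormalize (msum (fun k => \d_(nth 0 (A : seq R) k)) #|` A|) \d_(0 : R).

Lemma delta_fsetE (A : {fset R}) (B : set R) : A != fset0 ->
  delta_fset A B = ((#|` A|%:R^-1)%:E * \sum_(a <- A) \d_a B)%E.
Proof.
move=> A0.
have H C : msum (fun k => \d_(nth 0 (A : seq R) k)) #|` A| C
    = (\sum_(a <- A) \d_a C)%E.
  by rewrite /msum [RHS](big_nth 0) big_mkord.
have HT : (\sum_(a <- A) \d_a [set: R] = #|` A|%:R%:E :> \bar R)%E.
  under eq_bigr do rewrite diracT.
  by rewrite sumEFin big_const_seq count_predT iter_addr_0.
rewrite /delta_fset /= /mnormalize /= !H HT /=.
have -> : (#|` A|%:R%:E == 0 :> \bar R)%E = false.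
  by rewrite eqe pnatr_eq0 cardfs_eq0 (negbTE A0).
by rewrite /= H muleC.
Qed.

Definition weak_limit (mu_ : nat -> probability R R) (mu : probability R R)
    : Prop :=
  forall f : R -> R, continuous f -> (exists M : R, forall x, `|f x| <= M) ->
    (fun n => \int[mu_ n]_x f x) @ \oo --> (\int[mu]_x f x : R).

End Convolution.

(* Sequences are indexed by [n >= 1]; the terms of index 0 are never used. *)

Definition pprod (p : nat -> int) (n : nat) : int := \prod_(1 <= i < n.+1) p i.

Section Moran.
Context (R : realType).

Fixpoint moran_conv (p : nat -> int) (D : nat -> {fset int}) (n : nat) :
    probability R R :=
  if n is m.+1 then
    convolution (moran_conv p D m)
      (delta_fset [fset ((pprod p n)%:~R)^-1 * x%:~R | x in D n]%fset)
  else \d_(0 : R).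

Definition is_moran_measure (p : nat -> int) (D : nat -> {fset int})
    (mu : probability R R) : Prop :=
  weak_limit (moran_conv p D) mu.

End Moran.

(* Meant for [m] prime and [x != 0]. *)
Definition nu (m : nat) (x : rat) : int :=
  (logn m `|numq x|%N)%:Z - (logn m `|denq x|%N)%:Z.

Definition qn (D : nat -> {fset int}) (n : nat) : nat := #|` D n|.

Definition dn (D : nat -> {fset int}) (a : nat -> int) (n : nat) : nat :=
  \big[gcdn/0%N]_(x <- D n) `|x - a n|%N.

Definition moran_ratio (p : nat -> int) (D : nat -> {fset int})
    (a : nat -> int) (n : nat) : rat :=
  (pprod p n)%:~R / ((dn D a n)%:R * (qn D n)%:R).

Definition kn (p : nat -> int) (D : nat -> {fset int}) (a : nat -> int)
    (n : nat) : int :=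
  nu (qn D n) (moran_ratio p D a n).

Definition Ln (p : nat -> int) (D : nat -> {fset int}) (a : nat -> int)
    (n : nat) : rat :=
  moran_ratio p D a n / (qn D n)%:R ^ kn p D a n.

Definition residues (m : int) (A : {fset int}) : {fset int} :=
  [fset (x %% m)%Z | x in A]%fset.

(* Main.v *)
Require Import Defs.
From mathcomp Require Import all_boot all_order all_algebra finmap.
From mathcomp Require Import all_classical all_reals all_analysis.
From mathcomp Require Import ring lra zify.
Set Implicit Arguments.
Unset Strict Implicit.
Unset Printing Implicit Defensive.
Import Order.TTheory GRing.Theory Num.Theory.
Import numFieldNormedType.Exports.

Local Open Scope classical_set_scope.
Local Open Scope ring_scope.

(** Write [Q n] for the product of the first [n] moduli.  The [n]-th factor of the
convolution (counting from 0) is the uniform measure on the [q n] points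
[digits n / Q n.+1], where [q n] is 2 or 3.  With [d n] the gcd of the digit
differences, its Fourier transform has the period [period n = Q n.+1 / d n] up to
a phase.  It vanishes exactly at the multiples [z * period n / q n] with [z]
prime to [q n], except that for [q n = 3] the residue condition must hold,
otherwise it has no zero at all ([factor_zero]).  So the theorem is a statement
about the arithmetic of the periods.  Let [scale_val t n] be the [t]-adic
valuation of [period n] and let [arrow m n] mean
[scale_val (q n) m < scale_val (q n) n].  The numbers [k_n] and [L_n] only encode
these valuations, and (i) and (ii) together say that any two distinct indices
are joined by an arrow, in one direction or the other ([arrow_conditions]).

Sufficiency.  An arrow from [m] to [n] says that factor [n] has zeros inside
the period lattice of factor [m] ([multiplier]), so that frequencies separated
by factor [n] may be added without affecting factor [m].  Arrows in both classes
give every finite set of indices a least element ([arrow_min]), and induction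
then yields, for every finite set of factors, a full orthogonal set of
frequencies lying in prescribed lattices ([orthogonal_block]).  To get a single
increasing sequence of such sets, split the indices below [T] into early ones,
which point to everything that is not early, and late ones, whose number is
bounded independently of [T] ([early_arrow], [late_size], [early_ev]).  At stage
[T] the frequencies form an orthogonal basis for the early factors ([step]);
they can be shifted inside the lattices of the early factors to make the late
factors bounded below ([late_shift]), and reduced modulo [Q T], after which the
factors beyond [T] are bounded below by a product of cosines ([tail_bound]).
Hence the limit transform is comparable with the one of the early factors on
these frequencies ([stage_lower]), and Parseval's identity at each finite stage
passes to the limit ([complete]).  Every exponential is therefore in the closed
span of the spectrum, and the exponentials are total in [L^2] ([approx_L2]).

Necessity.  Let [Lam] be a spectrum.  Two of its elements differ by a zero of
some factor ([muhat_zero]).  Let [S] be a set of one or two indices, and [U] a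
finite list of reals such that the exponential sum over [U] vanishes at every
zero of a factor in [S].  Replacing the factors in [S] by the uniform measure on
a translate of [U] keeps the exponentials of [Lam] orthonormal, so the norm of a
trigonometric polynomial with frequencies in [Lam] does not change either.
Keeping only the contribution of the point 0 of [U] gives an inequality for these
polynomials, hence by density for all continuous functions.  It fails for a
function concentrated near the leftmost point of the factors in [S] as soon as
[U] gives 0 more mass than the factors in [S] give to that point
([not_spectral]).  If the residue condition fails at [n], then [U] can be the
single point 0.  If no arrow joins [m] and [n], then their periods are multiples
of a common real number by integers prime to [q m] and to [q n] respectively
([common_scale]), and [U] can be the convolution of two short symmetric kernels
([comb], [necessity]). *)

(** * Valuations of the periods and the order between factors *)

Section Order.
Variables (q d : nat -> nat) (p Q : nat -> int) (C : nat).
Hypothesis hq : forall n, q n = 2%N \/ q n = 3%N.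
Hypothesis hd : forall n, (0 < d n <= C)%N.
Hypothesis hQ0 : forall n, Q n != 0.
Hypothesis hQS : forall n, Q n.+1 = Q n * p n.

(** The [t]-adic valuation of the period [Q n.+1 / d n]. *)
Definition scale_val (t n : nat) : int := (logn t `|Q n.+1|%N)%:Z - (logn t (d n))%:Z.

(** By [multiplier], this makes the transform of factor [n] vanish at some points
    of the period lattice of factor [m]. *)
Definition arrow m n := scale_val (q n) m < scale_val (q n) n.

Hypothesis harr : forall m n, m <> n -> arrow m n \/ arrow n m.

Lemma Q_dvd m n : (m <= n)%N -> (`|Q m| %| `|Q n|)%N.
Proof.
elim: n => [|n IH]; first by rewrite leqn0 => /eqP ->.
rewrite leq_eqVlt => /orP[/eqP -> //|]; rewrite ltnS => /IH h.
by rewrite hQS abszM dvdn_mulr.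
Qed.

Lemma logn_Q_le t m n : (m <= n)%N -> (logn t `|Q m| <= logn t `|Q n|)%N.
Proof. by move=> h; apply: dvdn_leq_log; [rewrite absz_gt0 hQ0|exact: Q_dvd]. Qed.

Lemma logn_d_le t n : (logn t (d n) <= C)%N.
Proof.
have /andP[h0 h1] := hd n.
by apply: leq_trans h1; apply: ltnW; exact: ltn_logl.
Qed.

Lemma scale_val_ge t m n : (m <= n)%N -> (logn t `|Q m|)%:Z - C%:Z <= scale_val t n.
Proof.
move=> h; rewrite /scale_val; have := logn_Q_le t (leq_trans h (leqnSn n)).
by have := logn_d_le t n; lia.
Qed.

Lemma scale_val_le t m n : (n < m)%N -> scale_val t n <= (logn t `|Q m|)%:Z.
Proof.
by move=> h; rewrite /scale_val; have := logn_Q_le t h; lia.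
Qed.

Lemma scale_val_inj m n : q m = q n -> scale_val (q m) m = scale_val (q n) n -> m = n.
Proof.
move=> e1 e2; have [//|/eqP h] := eqVneq m n.
by have := harr h; rewrite /arrow e1 in e2 *; rewrite e2 ltxx; case.
Qed.

(** Two indices with the same [q] and the same valuation are not joined by an
    arrow.  Hence [q] together with the valuation identifies the index, and there
    are two values of [q] and [K + 1] valuations to choose from. *)
Lemma size_scale_val_window (lo : nat -> int) (K : nat) (s : seq nat) : uniq s ->
  (forall x, x \in s -> lo (q x) <= scale_val (q x) x <= lo (q x) + K%:Z) ->
  (size s <= 2 * K.+1)%N.
Proof.
move=> us hs.
pose g x := (q x, `|scale_val (q x) x - lo (q x)|%N).
rewrite -(size_map g).
apply: (@leq_trans (size [seq (t, k) | t <- [:: 2; 3]%N, k <- iota 0 K.+1])); last first.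
  by rewrite size_allpairs size_iota.
apply: uniq_leq_size.
  rewrite map_inj_in_uniq // => x y xs ys [e1 e2].
  apply: scale_val_inj => //.
  have := hs _ xs; have := hs _ ys; rewrite e1 in e2 *; lia.
move=> _ /mapP[x xs ->]; apply/allpairsP; exists (g x).
have := hs _ xs; split => //; last by rewrite [(g x).2]/= mem_iota; lia.
by rewrite /=; case: (hq x) => ->.
Qed.

(** The valuations are at least [- C], so only finitely many indices can stay
    below a given bound. *)
Lemma scale_val_large (w : int) : exists B, forall x, (B <= x)%N -> w < scale_val (q x) x.
Proof.
apply/not_existsP => H.
have H1 B : exists2 x, (B <= x)%N & scale_val (q x) x <= w.
  have := H B => /existsNP[x /not_implyP[h1 /negP]]; rewrite -leNgt => h2.
  by exists x.
have H2 k : exists s : seq nat, [/\ uniq s, size s = k &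
    forall x, x \in s -> scale_val (q x) x <= w].
  elim: k => [|k [s [us ss hs]]]; first by exists [::].
  have [x hx1 hx2] := H1 (\max_(i <- s) i).+1.
  exists (x :: s); split => /=; rewrite ?ss ?us ?andbT //.
    apply/negP => xs; have := @leq_bigmax_seq _ s xpredT id x xs isT.
    by move=> /leq_ltn_trans /(_ hx1); rewrite ltnn.
  by move=> y; rewrite inE => /orP[/eqP -> //|/hs].
have [s [us ss hs]] := H2 (2 * (`|w| + C).+1).+1.
have : (size s <= 2 * (`|w| + C).+1)%N.
  apply: (@size_scale_val_window (fun=> - C%:Z)) => // x /hs h.
  by have := @scale_val_ge (q x) 0 x (leq0n _); lia.
by rewrite ss ltnn.
Qed.

Lemma argmin_seq (T : eqType) (f : T -> int) (s : seq T) : s != [::] ->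
  exists2 x, x \in s & forall y, y \in s -> f x <= f y.
Proof.
elim: s => // x [|y s] IH _.
  by exists x; rewrite ?inE // => h; rewrite inE => /eqP ->.
have [//|g gG hg] := IH.
have [h|h] := leP (f x) (f g).
  exists x; first by rewrite inE eqxx.
  by move=> z; rewrite inE => /orP[/eqP -> //|/hg]; exact: le_trans.
exists g; first by rewrite inE gG orbT.
by move=> z; rewrite inE => /orP[/eqP ->|/hg //]; exact: ltW.
Qed.

(** In each class (the indices with [q] equal to 2, and those with [q] equal to 3)
    take the index of least valuation; it points to the rest of its class.  One of
    these two points to the other, hence to everything the other points to. *)
Lemma arrow_min (G : seq nat) : G != [::] ->
  exists2 g, g \in G & forall h, h \in G -> h <> g -> arrow g h.
Proof.
move=> G0.
have aux s s' g : (forall h, q h = s \/ q h = s') -> g \in G -> q g = s ->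
    (forall h, h \in G -> q h = s -> scale_val s g <= scale_val s h) ->
    (forall h, h \in G -> q h = s' ->
       exists m, [/\ q m = s', scale_val s' m <= scale_val s' h & arrow g m]) ->
    exists2 g, g \in G & forall h, h \in G -> h <> g -> arrow g h.
  move=> hs gG qg hmin hmin'; exists g => // h hG hg.
  have [e|e] := hs h.
    rewrite /arrow e lt_neqAle hmin // andbT; apply/eqP => e2.
    by apply: hg; apply/esym/scale_val_inj; rewrite ?qg ?e.
  have [m [qm h1 h2]] := hmin' _ hG e.
  by move: h2; rewrite /arrow e qm => /lt_le_trans; exact.
have argq t : has (fun h => q h == t) G -> exists g, [/\ g \in G, q g = t &
    forall h, h \in G -> q h = t -> scale_val t g <= scale_val t h].
  rewrite has_filter => /(argmin_seq (scale_val t))[g].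
  rewrite mem_filter => /andP[/eqP qg gG] hg; exists g; split => // h hG qh.
  by apply: hg; rewrite mem_filter qh eqxx.
have [h2|h2] := boolP (has (fun h => q h == 2%N) G); last first.
  have [h3|h3] := boolP (has (fun h => q h == 3%N) G); last first.
    clear aux argq; case: G G0 h2 h3 => // x G _ /=.
    by case: (hq x) => ->; rewrite /= ?orbT.
  have [g [gG qg hg]] := argq _ h3.
  apply: (aux 3%N 2%N g) => //; first by move=> h; case: (hq h); tauto.
  by move=> h hG qh; case/hasP: h2; exists h => //; apply/eqP.
have [g [gG qg hg]] := argq _ h2.
have [h3|h3] := boolP (has (fun h => q h == 3%N) G); last first.
  apply: (aux 2%N 3%N g) => //.
  by move=> h hG qh; case/hasP: h3; exists h => //; apply/eqP.
have [g' [gG' qg' hg']] := argq _ h3.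
have [|h|h] := @harr g g'.
- by move=> e; move: qg; rewrite e qg'.
- apply: (aux 2%N 3%N g) => // h1 hG qh; exists g'; split => //; exact: hg'.
- apply: (aux 3%N 2%N g') => //; first by move=> h1; case: (hq h1); tauto.
  by move=> h1 hG qh; exists g; split => //; exact: hg.
Qed.

Lemma not_arrow m n : ~ arrow m n -> scale_val (q n) n <= scale_val (q n) m.
Proof. by move/negP; rewrite -leNgt. Qed.

(** The requirement bears on every [y] of the class of [j] that is not above
    [j], and not only on [j]: being early is then inherited downwards in a class,
    which [early_arrow] relies on. *)
Definition early T j := (j < T)%N /\
  forall y, q y = q j -> scale_val (q j) y <= scale_val (q j) j ->
  forall x, (T <= x)%N -> arrow y x.

Lemma early_mono T T' j : (T <= T')%N -> early T j -> early T' j.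
Proof.
move=> h [h1 h2]; split; first exact: leq_trans h.
by move=> y e1 e2 x hx; apply: h2 e1 e2 _ _; exact: leq_trans hx.
Qed.

(** Suppose that [i] is not early because some [y] below it in its class has no
    arrow to some [x] beyond [T].  If [n] had no arrow to [i], then [i], hence
    [y], would be low compared with [n]; as [n] points to [x], and [x] to [y], the
    valuations of [n], [x] and [y] would go around a cycle. *)
Lemma early_arrow T n i : early T n -> ~ early T i -> arrow n i.
Proof.
move=> [nT hn] hi; have [iT|iT] := leqP T i; first exact: hn.
have [y [qy vy [x [xT yx]]]] : exists y, [/\ q y = q i, scale_val (q i) y <= scale_val (q i) i &
    exists x, (T <= x)%N /\ ~ arrow y x].
  apply: contrapT => H; apply: hi; split => // y qy vy x xT.
  by apply: contrapT => yx; apply: H; exists y; split => //; exists x.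
apply: contrapT => ni.
(* The cycle: [n] points to [x], [x] points to [y], and [y] points to [n]. *)
have nx : arrow n x by apply: hn.
have ni0 : n <> i.
  move=> e; apply: yx; subst i; exact: hn.
have ini : arrow i n by have [|] := harr ni0.
have vin := not_arrow ni.
have [e|e] := eqVneq (q n) (q i).
  by apply: yx; apply: hn => //; [rewrite e|rewrite e; exact: le_trans vin].
have ny : ~ arrow n y.
  by rewrite /arrow qy => h; have := lt_le_trans h (le_trans vy vin); rewrite ltxx.
have yT : (y < T)%N.
  by rewrite ltnNge; apply/negP => h; apply: ny; exact: hn.
have xy : arrow x y.
  have hne : y <> x by move=> e1; lia.
  by have [|] := harr hne.
have vxy := not_arrow yx.
have n0y : n <> y by move=> e1; rewrite e1 qy eqxx in e.
have yn : arrow y n by have [|] := harr n0y.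
have vny := not_arrow ny.
move: nx xy yn; rewrite /arrow.
have [ex|ex] : q x = q y \/ q x = q n.
  by move: e; rewrite -qy; case: (hq x) (hq y) (hq n) => [->|->] [->|->] [->|->] //; tauto.
- by rewrite ex in vxy *; lia.
- by rewrite ex in vxy *; lia.
Qed.

(** A late index [j] is kept late by some [x] beyond [T] which is, or points to, an
    index of the class of [j] not above [j]; this puts the valuation of [j] between the
    one of [Q T] and the one of [Q T] minus [C]. *)
Lemma late_size T (s : seq nat) : uniq s -> (forall j, j \in s -> (j < T)%N /\ ~ early T j) ->
  (size s <= 2 * C.+1)%N.
Proof.
move=> us hs.
apply: (@size_scale_val_window (fun t => (logn t `|Q T|)%:Z - C%:Z)) => // j /hs[jT hj].
have [y [qy vy [x [xT yx]]]] : exists y, [/\ q y = q j, scale_val (q j) y <= scale_val (q j) j &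
    exists x, (T <= x)%N /\ ~ arrow y x].
  apply: contrapT => H; apply: hj; split => // y qy vy x xT.
  by apply: contrapT => yx; apply: H; exists y; split => //; exists x.
have h1 := @scale_val_le (q j) _ _ jT.
have h2 : (logn (q j) `|Q T|)%:Z - C%:Z <= scale_val (q j) x by exact: scale_val_ge.
have [e|/eqP e] := eqVneq x y; first by subst y; lia.
have [//|] := harr e; last by [].
rewrite /arrow qy => h; lia.
Qed.

Lemma early_ev J : exists T0, forall T j, (T0 <= T)%N -> (j < J)%N -> early T j.
Proof.
have H j : exists T0, forall T, (T0 <= T)%N -> early T j.
  have [B1 hB1] := scale_val_large (scale_val (q j) j).
  have [B2 hB2] := scale_val_large (logn 2 `|Q B1| + logn 3 `|Q B1|)%N%:Z.
  exists (maxn j.+1 B2) => T; rewrite geq_max => /andP[h1 h2]; split => // y qy vy x xT.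
  have yB : (y < B1)%N.
    by rewrite ltnNge; apply/negP => /hB1; rewrite qy; lia.
  have := hB2 _ (leq_trans h2 xT); rewrite /arrow.
  have := @scale_val_le (q x) _ _ yB; case: (hq x) => ->; lia.
elim: J => [|J [T1 IH]]; first by exists 0%N.
have [T2 h2] := H J; exists (maxn T1 T2) => T j; rewrite geq_max => /andP[h1 h3].
by rewrite ltnS leq_eqVlt => /orP[/eqP ->|]; [exact: h2|exact: IH].
Qed.

End Order.

(** * Lattices of periods and orthogonal sets of frequencies *)

Section PairwiseAllpairs.
Lemma uniq_pairwise_neq (T : eqType) (r : rel T) (s : seq T) : uniq s ->
  {in s &, forall x y, x != y -> r x y} -> pairwise r s.
Proof.
rewrite uniq_pairwise => us hr; apply: (sub_in_pairwise _ (allss s)) us.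
by move=> x y xs ys /= /(hr _ _ xs ys).
Qed.

(** This is how orthogonality of a sum of two sets of frequencies is checked:
    inside each translate, and between two translates. *)
Lemma pairwise_allpairs (S T : eqType) (U : eqType) (f : S -> T -> U) (r : rel U)
    (s : seq S) (t : seq T) :
  {in s, forall x, pairwise (fun y y' => r (f x y) (f x y')) t} ->
  pairwise (fun x x' => `[< {in t &, forall y y', r (f x y) (f x' y')} >]) s ->
  pairwise r [seq f x y | x <- s, y <- t].
Proof.
elim: s => //= x s IH hs /andP[/allP hx hp]; rewrite pairwise_cat.
apply/and3P; split; last first.
- by apply: IH hp => z zs; apply: hs; rewrite inE zs orbT.
- by rewrite pairwise_map; apply: hs; rewrite inE eqxx.
apply/allrelP => _ _ /mapP[y yt ->] /allpairsP[[z y'] [zs yt' ->]] /=.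
by have /asboolP := hx _ zs; apply.
Qed.
End PairwiseAllpairs.

Section Lattice.
Variables (R : realType) (q d : nat -> nat) (p Q : nat -> int) (C : nat).
Hypothesis hq : forall n, q n = 2%N \/ q n = 3%N.
Hypothesis hd : forall n, (0 < d n <= C)%N.
Hypothesis hQ0 : forall n, Q n != 0.
Hypothesis hQS : forall n, Q n.+1 = Q n * p n.
Hypothesis harr : forall m n, m <> n -> arrow q d Q m n \/ arrow q d Q n m.

Definition period n : R := (Q n.+1)%:~R / (d n)%:R.
Definition lattice n (x : R) := exists z : int, x = z%:~R * period n.
(** The zeros of the transform of factor [n], see [factor_zero]. *)
Definition zset n (x : R) := exists z : int,
  ~~ ((q n)%:Z %| z)%Z /\ x = z%:~R * (period n / (q n)%:R).
Definition zsetS (S : seq nat) x := exists2 n, n \in S & zset n x.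

Lemma q_prime n : prime (q n). Proof. by case: (hq n) => ->. Qed.
Lemma q_gt0 n : (0 < q n)%N. Proof. by case: (hq n) => ->. Qed.
Lemma qR_neq0 n : (q n)%:R != 0 :> R. Proof. by rewrite pnatr_eq0 -lt0n q_gt0. Qed.
Lemma dR_neq0 n : (d n)%:R != 0 :> R.
Proof. by rewrite pnatr_eq0 -lt0n; case/andP: (hd n). Qed.

Lemma lattice0 n : lattice n 0. Proof. by exists 0; rewrite mul0r. Qed.
Lemma latticeD n x y : lattice n x -> lattice n y -> lattice n (x + y).
Proof. by move=> [z ->] [t ->]; exists (z + t); rewrite rmorphD /= mulrDl. Qed.
Lemma latticeN n x : lattice n x -> lattice n (- x).
Proof. by move=> [z ->]; exists (- z); rewrite rmorphN mulNr. Qed.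
Lemma latticeB n x y : lattice n x -> lattice n y -> lattice n (x - y).
Proof. by move=> hx hy; apply: latticeD => //; exact: latticeN. Qed.

Lemma zsetN n x : zset n x -> zset n (- x).
Proof. by move=> [z [h ->]]; exists (- z); rewrite rpredN h rmorphN mulNr. Qed.

Lemma zset_latticeD n x y : zset n x -> lattice n y -> zset n (x + y).
Proof.
move=> [z [h ->]] [t ->]; exists (z + t * (q n)%:Z); split.
  by rewrite rpredDr // dvdz_mull.
rewrite rmorphD rmorphM /= mulrDl; congr (_ + _).
by rewrite -mulrA; congr (_ * _); rewrite mulrCA mulfV ?mulr1 // qR_neq0.
Qed.

Lemma Q_lattice n T (z : int) : (n < T)%N -> lattice n (z%:~R * (Q T)%:~R).
Proof.
move=> /(Q_dvd hQS) h.
have /dvdzP[k ->] : (Q n.+1 %| Q T)%Z by rewrite /dvdz.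
exists (z * k * (d n)%:Z); rewrite /period !rmorphM /=.
by field; exact: dR_neq0.
Qed.

Lemma zsetSN S x : zsetS S x -> zsetS S (- x).
Proof. by move=> [n nS /zsetN h]; exists n. Qed.

Lemma zsetS_latticeD S x y : zsetS S x -> (forall n, n \in S -> lattice n y) -> zsetS S (x + y).
Proof. by move=> [n nS hx] hy; exists n => //; apply: zset_latticeD => //; exact: hy. Qed.

Lemma zsetS_sub (S S' : seq nat) x : {subset S <= S'} -> zsetS S x -> zsetS S' x.
Proof. by move=> h [n /h]; exists n. Qed.

(** The smallest positive zero [period g / q g] of factor [g] becomes a multiple
    of [period j] after multiplication by an integer; the arrow says that no power
    of [q g] is needed in that integer. *)
Lemma multiplier j g : arrow q d Q j g ->
  exists u : nat, coprime (q g) u /\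
    (d g * q g * `|Q j.+1| %| d j * `|Q g.+1| * u)%N.
Proof.
move=> jg; set X := (d g * q g * _)%N; set Y := (d j * _)%N.
have d0 n : (0 < d n)%N by case/andP: (hd n).
have Q0 n : (0 < `|Q n|)%N by rewrite absz_gt0.
have X0 : (0 < X)%N by rewrite !muln_gt0 d0 q_gt0 Q0.
have Y0 : (0 < Y)%N by rewrite !muln_gt0 d0 Q0.
exists (X`_(q g)^')%N; split.
  by rewrite prime_coprime ?q_prime // -p'natE ?q_prime ?part_pnat.
rewrite -{1}(partnC (q g) X0) dvdn_mul // p_part pfactor_dvdn ?q_prime //.
rewrite /X /Y !lognM ?muln_gt0 ?d0 ?q_gt0 ?Q0 // [logn _ (q g)]logn_prime ?q_prime // eqxx.
by move: jg; rewrite /arrow /scale_val; lia.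
Qed.

Lemma multipliers (g : nat) (H : seq nat) : (forall j, j \in H -> arrow q d Q j g) ->
  exists u : nat, coprime (q g) u /\
    forall j, j \in H -> lattice j (u%:R * (period g / (q g)%:R)).
Proof.
elim: H => [|j H IH] hH.
  by exists 1%N; rewrite coprimen1.
have [|u [cu hu]] := IH; first by move=> k kH; apply: hH; rewrite inE kH orbT.
have [|u' [cu' hu']] := @multiplier j g; first by apply: hH; rewrite inE eqxx.
exists (u * u')%N; rewrite coprimeMr cu cu'; split => // k.
rewrite inE => /orP[/eqP ->|kH]; last first.
  have [z hz] := hu k kH; exists (z * u'%:Z).
  by rewrite natrM rmorphM /= -[LHS]mulrA [u'%:R * _]mulrC mulrA hz; ring.
have /dvdzP[k' hk'] : ((d g * q g)%:Z * Q j.+1 %| (d j)%:Z * Q g.+1 * u'%:Z)%Z.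
  by move: hu'; rewrite dvdzE !abszM.
exists (u%:Z * k').
have hk : (d j)%:R * (Q g.+1)%:~R * u'%:R = k'%:~R * ((d g)%:R * (q g)%:R * (Q j.+1)%:~R) :> R.
  move: hk'; rewrite PoszM => /(congr1 (fun z : int => z%:~R : R)).
  by rewrite !rmorphM /=.
rewrite natrM rmorphM /= /period.
have -> : u%:R * u'%:R * ((Q g.+1)%:~R / (d g)%:R / (q g)%:R) =
  u%:R * ((d j)%:R * (Q g.+1)%:~R * u'%:R) / ((d j)%:R * (d g)%:R * (q g)%:R) :> R.
  by field; rewrite !dR_neq0 qR_neq0.
by rewrite hk; field; rewrite !dR_neq0 qR_neq0.
Qed.

(** Pairwise orthogonality of the exponentials with frequencies in [L] for
    the convolution of the factors in [S]. *)
Definition orthog S (L : seq R) := pairwise (fun x y => `[< zsetS S (x - y) >]) L.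

(** Remove an arrow-least [g] from [G].  The induction hypothesis applies to the
    other elements with [g] added to [H], and the resulting frequencies, which are
    in the lattice of [g], are translated by [q g] multiples of a zero of [g]
    lying in the lattices of [H]. *)
Lemma orthogonal_block (G H : seq nat) : uniq G ->
  (forall g h, g \in G -> h \in H -> arrow q d Q h g) ->
  exists B : seq R, let L := 0 :: B in
   [/\ size L = \prod_(g <- G) q g, orthog G L &
    forall x j, x \in L -> j \in H -> lattice j x].
Proof.
have [n] := ubnP (size G); elim: n => // n IH in G H * => sG uG hGH.
have [G0|G0] := eqVneq G [::].
  subst G; exists [::]; split => //; first by rewrite big_nil.
  by move=> x j; rewrite inE => /eqP -> _; exact: lattice0.
have [g gG hg] := arrow_min hq harr G0.
have pG := perm_to_rem gG.
have [| | |B [sB oB lB]] := IH (rem g G) (g :: H).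
- by rewrite size_rem //; case: (G) G0 sG.
- exact: rem_uniq.
- move=> k h; rewrite mem_rem_uniq // inE => /andP[/= kg kG].
  move=> /orP[/eqP ->|hH]; last exact: hGH.
  by apply: hg => //; apply/eqP.
have [|u [cu hu]] := @multipliers g H; first by move=> j; exact: hGH.
set l := u%:R * (period g / (q g)%:R) in hu.
set B1 := [seq e%:R * l | e <- iota 1 (q g).-1].
have eB1 : 0 :: B1 = [seq e%:R * l | e <- iota 0 (q g)].
  by rewrite -[in RHS](prednK (q_gt0 g)) /= mul0r.
set L := [seq x + y | x <- 0 :: B1, y <- 0 :: B].
exists (behead L).
have -> : 0 :: behead L = L by rewrite /L /= addr0.
split.
- by rewrite size_allpairs eB1 size_map size_iota sB (perm_big _ pG) big_cons.
- apply: pairwise_allpairs.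
    move=> x _; apply: sub_pairwise oB => y y' /asboolP h; apply/asboolP.
    have -> : x + y - (x + y') = y - y' by ring.
    by apply: zsetS_sub h => i; exact: mem_rem.
  rewrite eB1 pairwise_map; apply: uniq_pairwise_neq; first exact: iota_uniq.
  move=> e e'; rewrite !mem_iota /= !add0n => he he' ne.
  apply/asboolP => y y' yB yB'; apply/asboolP; exists g => //.
  have -> : e%:R * l + y - (e'%:R * l + y') = (e%:R - e'%:R) * l + (y - y').
    by ring.
  apply: zset_latticeD; last first.
    by apply: latticeB; apply: lB => //; rewrite inE eqxx.
  exists ((e%:Z - e'%:Z) * u%:Z); split; last first.
    by rewrite /l rmorphM rmorphB /=; ring.
  rewrite Gauss_dvdzl; last exact: cu.
  by move/eqP: ne; move: he he'; case: (hq g) => ->; clear; lia.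
- move=> x j /allpairsP[[y z] [yB zB ->]] jH /=; apply: latticeD; last first.
    by apply: lB => //; rewrite inE jH orbT.
  move: yB => /=; rewrite eB1 => /mapP[e _ ->].
  have [k ->] := hu j jH; exists (e%:Z * k).
  by rewrite rmorphM /= mulrA.
Qed.

End Lattice.

(** * Exponential sums over finite lists *)

Section Fourier.
Variable R : realType.
Implicit Types (x y t : R) (z u v : R[i]) (X L : seq R).

Definition e2pi t : R[i] := Complex (cos (2 * pi * t)) (sin (2 * pi * t)).
Notation nrm := (@Normc.normc R).
Definition nsq z : R := complex.Re z ^+ 2 + complex.Im z ^+ 2.

Lemma fourier_expE t x : fourier_exp t x = e2pi (t * x).
Proof. by rewrite /fourier_exp /e2pi !mulrA. Qed.

Lemma nsq_ge0 z : 0 <= nsq z. Proof. by rewrite addr_ge0 ?sqr_ge0. Qed.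

Lemma nrm_sqr z : nrm z ^+ 2 = nsq z.
Proof. by case: z => a b; rewrite /= sqr_sqrtr // addr_ge0 ?sqr_ge0. Qed.

Lemma nrm_ge0 z : 0 <= nrm z. Proof. by case: z => a b; exact: sqrtr_ge0. Qed.

Lemma nsqM z u : nsq (z * u) = nsq z * nsq u.
Proof. by rewrite -!nrm_sqr Normc.normcM exprMn. Qed.

Lemma nsqE z : (nsq z)%:C%C = z * (z^*)%C.
Proof. by case: z => a b; rewrite /nsq /=; apply/eqP; rewrite eq_complex /=; apply/andP; split; apply/eqP; ring. Qed.

Lemma e2piD t x : e2pi (t + x) = e2pi t * e2pi x.
Proof.
apply/eqP; rewrite eq_complex /= mulrDr cosD sinD; apply/andP; split => //.
by rewrite addrC.
Qed.

Lemma e2pi0 : e2pi 0 = 1.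
Proof. by rewrite /e2pi mulr0 cos0 sin0. Qed.

Lemma e2piNr t : e2pi (- t) = ((e2pi t)^*)%C.
Proof. by rewrite /e2pi mulrN cosN sinN. Qed.

Lemma nsq_e2pi t : nsq (e2pi t) = 1.
Proof. by rewrite /nsq /= cos2Dsin2. Qed.

Lemma nrm_e2pi t : nrm (e2pi t) = 1.
Proof. by rewrite /= cos2Dsin2 sqrtr1. Qed.

Lemma e2pi_mulN t : e2pi t * e2pi (- t) = 1. Proof. by rewrite -e2piD subrr e2pi0. Qed.

Lemma e2pi_nat n : e2pi n%:R = 1.
Proof.
elim: n => [|n IH]; first exact: e2pi0.
rewrite -natr1 e2piD IH mul1r /e2pi mulr1.
by rewrite mulr_natl cos2pi sin2pi.
Qed.

Lemma e2pi_int (m : int) : e2pi m%:~R = 1.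
Proof.
case: m => n; first exact: e2pi_nat.
have := e2pi_mulN n.+1%:R; rewrite e2pi_nat mul1r => <-.
by congr e2pi; rewrite NegzE rmorphN.
Qed.

Lemma e2pi_eq1 t : e2pi t = 1 -> exists m : int, t = m%:~R.
Proof.
move=> h; exists (Num.floor t).
have h1 : e2pi (t - (Num.floor t)%:~R) = 1.
  by rewrite e2piD h -rmorphN e2pi_int mulr1.
apply/eqP; rewrite -subr_eq0; set f := t - _ in h1 *.
have f0 : 0 <= f by rewrite /f subr_ge0 Num.Theory.floor_le.
have f1 : f < 1 by rewrite /f ltrBlDl -(intrD _ _ 1) floorD1_gt.
rewrite eq_le f0 andbT leNgt; apply/negP => fp.
have s0 : 0 < sin (pi * f).
  by apply: sin_gt0_pi; rewrite mulr_gt0 ?pi_gt0 //= gtr_pMr ?pi_gt0.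
have := congr1 (@complex.Re R) h1; rewrite /=.
have -> : 2 * pi * f = pi * f + pi * f by ring.
rewrite cosD => h2.
have := cos2Dsin2 (pi * f); nra.
Qed.

Definition fsum X t : R[i] := \sum_(x <- X) e2pi (t * x).
Definition favg X t : R[i] := fsum X t / (size X)%:R.

Lemma fsumN X t : fsum X (- t) = ((fsum X t)^*)%C.
Proof. by rewrite /fsum rmorph_sum; apply: eq_bigr => x _; rewrite mulNr e2piNr. Qed.

Lemma fsum0 X : fsum X 0 = (size X)%:R.
Proof.
rewrite /fsum (eq_bigr (fun=> 1)) => [|i _]; last by rewrite mul0r e2pi0.
by rewrite big_const_seq count_predT iter_addr_0.
Qed.

Definition sumset X L := [seq x + y | x <- X, y <- L].

Lemma fsum_sumset X L t : fsum (sumset X L) t = fsum X t * fsum L t.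
Proof.
rewrite /fsum big_allpairs_dep /= mulr_suml; apply: eq_bigr => x _.
by rewrite mulr_sumr; apply: eq_bigr => y _; rewrite mulrDr e2piD.
Qed.

Lemma favg_sumset X L t : favg (sumset X L) t = favg X t * favg L t.
Proof. by rewrite /favg fsum_sumset size_allpairs natrM invfM mulrACA. Qed.

Lemma natC_neq0 n : (0 < n)%N -> n%:R != 0 :> R[i].
Proof. by rewrite pnatr_eq0 lt0n. Qed.

(** The matrix of the values [e2pi (l * x)], with [l] in [L] and [x] in [X], is
    square and has orthogonal rows; a left inverse being a right inverse, its
    columns are orthogonal too.  This is Parseval's identity for an arbitrary
    exponential. *)
Lemma unitary X L t : size L = size X -> (0 < size X)%N ->
  (forall i j, (i < size X)%N -> (j < size X)%N -> i <> j -> fsum X (L`_i - L`_j) = 0) ->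
  \sum_(l <- L) nsq (favg X (t + l)) = 1.
Proof.
move=> sL X0 hL; set n := size X in sL X0 hL *.
have sumX (F : R -> R[i]) : \sum_(x <- X) F x = \sum_(k < n) F X`_k.
  by rewrite (big_nth 0) big_mkord.
pose A : 'M[R[i]]_n := \matrix_(i, k) e2pi (L`_i * X`_k).
pose B : 'M[R[i]]_n := \matrix_(k, j) (e2pi (- (L`_j * X`_k)) / n%:R).
have AB : A *m B = 1%:M.
  apply/matrixP => i j; rewrite !mxE.
  under eq_bigr do rewrite !mxE mulrA -e2piD -mulrBl.
  rewrite -mulr_suml -(sumX (fun x => e2pi ((L`_i - L`_j) * x))) -/(fsum _ _).
  have [->|/eqP ij] := eqVneq i j.
    by rewrite subrr fsum0 mulfV ?natC_neq0.
  by rewrite hL // ?mul0r // => e; apply: ij; exact: val_inj.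
have BA (k l : 'I_n) : \sum_(j < n) e2pi (L`_j * (X`_l - X`_k)) = (k == l)%:R * n%:R.
  have := mulmx1C AB => /matrixP/(_ k l); rewrite !mxE => <-.
  rewrite mulr_suml; apply: eq_bigr => j _; rewrite !mxE mulrBr addrC e2piD.
  by rewrite mulrAC divfK ?natC_neq0.
have key : \sum_(l <- L) (nsq (fsum X (t + l)))%:C%C = (n%:R * n%:R) :> R[i].
  transitivity (\sum_(k < n) \sum_(l < n) e2pi (t * (X`_l - X`_k)) *
      \sum_(j < n) e2pi (L`_j * (X`_l - X`_k))).
    rewrite (big_nth 0) big_mkord sL.
    under [RHS]eq_bigr do under eq_bigr do rewrite mulr_sumr.
    under [RHS]eq_bigr do rewrite exchange_big.
    rewrite [RHS]exchange_big; apply: eq_bigr => j _ /=.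
    rewrite nsqE -fsumN /fsum !sumX mulrC mulr_suml; apply: eq_bigr => k _.
    rewrite mulr_sumr; apply: eq_bigr => l _; rewrite -!e2piD; congr e2pi; ring.
  under eq_bigr do under eq_bigr do rewrite BA.
  transitivity (\sum_(k < n) (n%:R : R[i])); last first.
    by rewrite sumr_const card_ord mulr_natr.
  apply: eq_bigr => k _; rewrite (bigD1 k) //= eqxx mul1r subrr mulr0 e2pi0 mul1r.
  rewrite big1 ?addr0 // => l /negPf lk; rewrite eq_sym lk mul0r mulr0 //.
apply: complexI; rewrite rmorph_sum /=.
transitivity (\sum_(l <- L) (nsq (fsum X (t + l)))%:C%C * ((n%:R * n%:R)^-1 : R[i])).
  apply: eq_bigr => l _; rewrite !nsqE /favg rmorphM /= -/n.
  have -> : ((n%:R^-1 : R[i])^*)%C = n%:R^-1 by rewrite fmorphV rmorph_nat.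
  by rewrite mulrACA -invfM.
by rewrite -mulr_suml key mulfV // mulf_neq0 ?natC_neq0.
Qed.

Lemma nrmD u v : nrm (u + v) <= nrm u + nrm v. Proof. exact: le_normcD. Qed.
Lemma nrmN u : nrm (- u) = nrm u. Proof. exact: normcN. Qed.

Lemma nrm_sum (I : Type) (r : seq I) (F : I -> R[i]) :
  nrm (\sum_(i <- r) F i) <= \sum_(i <- r) nrm (F i).
Proof.
elim: r => [|i r IH]; first by rewrite !big_nil Normc.normc0.
by rewrite !big_cons (le_trans (nrmD _ _)) // lerD2l.
Qed.

Lemma nrm_prod (I : Type) (r : seq I) (F : I -> R[i]) :
  nrm (\prod_(i <- r) F i) = \prod_(i <- r) nrm (F i).
Proof.
elim: r => [|i r IH]; first by rewrite !big_nil Normc.normc1.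
by rewrite !big_cons Normc.normcM IH.
Qed.

Lemma nrm_real x : nrm (x%:C)%C = `|x|.
Proof. by rewrite /= expr0n /= addr0 sqrtr_sqr. Qed.

Lemma nrm_nat n : nrm n%:R = n%:R.
Proof. by rewrite -(rmorph_nat (real_complex R)) nrm_real normr_nat. Qed.

Lemma nrm_favg_le1 X t : nrm (favg X t) <= 1.
Proof.
have [X0|X0] := posnP (size X).
  by rewrite /favg X0 invr0 mulr0 Normc.normc0 ler01.
rewrite /favg Normc.normcM Normc.normcV nrm_nat ler_pdivrMr ?ltr0n // mul1r.
apply: le_trans (nrm_sum _ _) _; under eq_bigr do rewrite nrm_e2pi.
by rewrite big_const_seq count_predT iter_addr_0.
Qed.

Lemma nrm_prod_le1 (I : Type) (r : seq I) (F : I -> R[i]) :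
  (forall i, nrm (F i) <= 1) -> nrm (\prod_(i <- r) F i) <= 1.
Proof.
move=> hF; rewrite nrm_prod; elim: r => [|i r IH]; first by rewrite big_nil.
by rewrite big_cons mulr_ile1 ?nrm_ge0 ?prodr_ge0 // => j _; exact: nrm_ge0.
Qed.

(** Telescoping: change the factors one at a time. *)
Lemma nrm_prodB (I : Type) (r : seq I) (F G : I -> R[i]) :
  (forall i, nrm (F i) <= 1) -> (forall i, nrm (G i) <= 1) ->
  nrm (\prod_(i <- r) F i - \prod_(i <- r) G i) <= \sum_(i <- r) nrm (F i - G i).
Proof.
move=> hF hG; elim: r => [|i r IH]; first by rewrite !big_nil subrr Normc.normc0.
rewrite !big_cons.
have -> : F i * (\prod_(j <- r) F j) - G i * (\prod_(j <- r) G j) =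
   (F i - G i) * (\prod_(j <- r) F j) + G i * (\prod_(j <- r) F j - \prod_(j <- r) G j).
  by ring.
apply: le_trans (nrmD _ _) _; rewrite !Normc.normcM lerD //.
  by rewrite ler_piMr ?nrm_ge0 ?nrm_prod_le1.
by apply: le_trans IH; rewrite ler_piMl ?nrm_ge0.
Qed.

Lemma sin_le_norm x : `|sin x| <= `|x|.
Proof.
have H (y : R) : 0 <= y -> `|sin y| <= y.
  rewrite le_eqVlt => /orP[/eqP <-|y0]; first by rewrite sin0 normr0.
  have [|c] := @MVT R sin cos 0 y y0.
  - by apply: continuous_subspaceT => c; exact: continuous_sin.
  rewrite sin0 !subr0 => _ ->; rewrite normrM (gtr0_norm y0) ler_piMl ?(ltW y0) //.
  by rewrite ler_norml cos_le1 cos_geN1.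
have [/H|/ltW h] := leP 0 x; first by move/le_trans; apply; exact: ler_norm.
have := H (- x); rewrite sinN normrN oppr_ge0 => /(_ h) h1.
by apply: le_trans h1 _; rewrite -normrN ler_norm.
Qed.

Lemma e2pi_lip x y : nrm (e2pi x - e2pi y) <= 2 * pi * `|x - y|.
Proof.
have pi0 := pi_ge0 R.
have e : nsq (e2pi x - e2pi y) = (2 * sin (pi * (x - y))) ^+ 2.
  have -> : nsq (e2pi x - e2pi y) = nsq (e2pi (x - y) - 1).
    by rewrite -[LHS]mulr1 -(nsq_e2pi (- y)) -nsqM mulrBl -!e2piD subrr e2pi0.
  rewrite /nsq /=; set t := x - y.
  have -> : 2 * pi * t = pi * t + pi * t by ring.
  rewrite cosD sinD oppr0 addr0; have := cos2Dsin2 (pi * t).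
  set c := cos _; set s := sin _ => h.
  have -> : c * c = 1 - s * s by rewrite -h; ring.
  have -> : 1 - s * s - s * s - 1 = - 2 * (s * s) by ring.
  have -> : (s * c + c * s) ^+ 2 = 4 * (s * s) * c ^+ 2 by ring.
  have -> : c ^+ 2 = 1 - s ^+ 2 by rewrite -h; ring.
  by ring.
rewrite -(@ler_pXn2r _ 2) // ?nnegrE ?nrm_ge0 ?mulr_ge0 //.
rewrite nrm_sqr e -[leLHS]real_normK ?num_real // ler_pXn2r // ?nnegrE ?mulr_ge0 //.
rewrite normrM ger0_norm // -mulrA ler_pM2l //.
by apply: le_trans (sin_le_norm _) _; rewrite normrM (ger0_norm pi0).
Qed.

Lemma favg_lip X (M x y : R) : 0 <= M -> (forall a, a \in X -> `|a| <= M) ->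
  nrm (favg X x - favg X y) <= 2 * pi * M * `|x - y|.
Proof.
move=> M0 hM; have pi0 := pi_ge0 R.
have B0 : 0 <= 2 * pi * M * `|x - y| by rewrite !mulr_ge0.
have [X0|X0] := posnP (size X).
  by rewrite /favg X0 invr0 !mulr0 subrr Normc.normc0.
rewrite /favg -mulrBl Normc.normcM Normc.normcV nrm_nat ler_pdivrMr ?ltr0n //.
rewrite /fsum -sumrB; apply: le_trans (nrm_sum _ _) _.
apply: (@le_trans _ _ (\sum_(a <- X) (2 * pi * M * `|x - y|))); last first.
  by rewrite big_const_seq count_predT iter_addr_0 mulr_natr.
rewrite !big_seq; apply: ler_sum => a /hM aM.
apply: le_trans (e2pi_lip _ _) _; rewrite -mulrBl normrM mulrCA mulrC.
by rewrite -!mulrA; do 2 (rewrite ler_wpM2l //); rewrite ler_wpM2r.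
Qed.

Lemma favg0 X : (0 < size X)%N -> favg X 0 = 1.
Proof. by move=> X0; rewrite /favg fsum0 mulfV ?natC_neq0. Qed.

Lemma nrm_Re z : complex.Re z <= nrm z.
Proof.
case: z => a b /=; apply: le_trans (ler_norm _) _.
by rewrite -sqrtr_sqr ler_wsqrtr // lerDl sqr_ge0.
Qed.

Lemma ReD u v : complex.Re (u + v) = complex.Re u + complex.Re v.
Proof. by case: u v => [a b] [c e]. Qed.

Lemma Re_sum (I : Type) (r : seq I) (F : I -> R[i]) :
  complex.Re (\sum_(i <- r) F i) = \sum_(i <- r) complex.Re (F i).
Proof.
elim: r => [|i r IH]; first by rewrite !big_nil.
by rewrite !big_cons ReD IH.
Qed.

(** After multiplication by [e2pi (- (x * m))] every term of the sum has its
    argument within [pi * r * `|x|] of 0, so its real part is at least this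
    cosine. *)
Lemma favg_cos X (m r x : R) : (0 < size X)%N -> 0 <= r ->
  (forall a, a \in X -> `|a - m| <= r / 2) -> r * `|x| <= 1 / 2 ->
  cos (pi * (r * `|x|)) <= nrm (favg X x).
Proof.
move=> X0 r0 hX rx; have pi0 := pi_gt0 R.
rewrite /favg Normc.normcM Normc.normcV nrm_nat ler_pdivlMr ?ltr0n //.
have -> : nrm (fsum X x) = nrm (e2pi (- (x * m)) * fsum X x).
  by rewrite Normc.normcM nrm_e2pi mul1r.
apply: le_trans (nrm_Re _); rewrite /fsum mulr_sumr Re_sum.
apply: (@le_trans _ _ (\sum_(a <- X) cos (pi * (r * `|x|)))).
  by rewrite big_const_seq count_predT iter_addr_0 mulr_natr.
rewrite !big_seq; apply: ler_sum => a /hX ha; rewrite -e2piD /=.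
have -> : 2 * pi * (- (x * m) + x * a) = pi * (2 * (x * (a - m))) by ring.
rewrite -(cos_norm (pi * (2 * _))) normrM (gtr0_norm pi0).
have h1 : `|2 * (x * (a - m))| <= r * `|x|.
  rewrite normrM normr_nat normrM; have := normr_ge0 x; nra.
have h2 := normr_ge0 (2 * (x * (a - m))).
rewrite leNgt; apply/negP => h.
have : pi * (r * `|x|) < pi * `|2 * (x * (a - m))|.
  rewrite -ltr_cos // in_itv /= mulr_ge0 ?(ltW pi0) ?mulr_ge0 //= ger_pMr //.
  - by lra.
  - by lra.
by rewrite ltr_pM2l // ltNge h1.
Qed.

(** Viete's product: [2 ^ n * sin (th / 2 ^ n)] times the cosines collapses by
    repeated use of the duplication formula for the sine. *)
Lemma prod_cos_half (th : R) n : 0 < th < pi / 2 ->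
  sin (2 * th) / (2 * th) <= \prod_(i < n) cos (th / 2 ^+ i).
Proof.
move=> /andP[t0 tp]; have pi0 := pi_gt0 R.
have tel : (\prod_(i < n) cos (th / 2 ^+ i)) * (2 ^+ n * sin (2 * th / 2 ^+ n)) = sin (2 * th).
  elim: n => [|n IH]; first by rewrite big_ord0 expr0 divr1 !mul1r.
  rewrite big_ord_recr /= -[RHS]IH.
  have p2 : (2 : R) ^+ n != 0 by rewrite expf_neq0.
  have -> : 2 * th / 2 ^+ n.+1 = th / 2 ^+ n by rewrite exprS; field.
  have -> : 2 * th / 2 ^+ n = (th / 2 ^+ n) *+ 2 by rewrite mulr2n; ring.
  by rewrite sin_mulr2n exprS mulr2n; ring.
have P0 : 0 <= \prod_(i < n) cos (th / 2 ^+ i).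
  apply: prodr_ge0 => i _; apply: cos_ge0_pihalf.
  have h1 : 1 <= (2 : R) ^+ i by rewrite exprn_ege1 // ler1n.
  have h2 : 0 < (2 : R) ^+ i by rewrite exprn_gt0.
  have h3 : 0 <= th / 2 ^+ i by rewrite divr_ge0 ?ltW.
  have h4 : th / 2 ^+ i <= th by rewrite ler_pdivrMr // ler_peMr // ltW.
  by apply/andP; split; lra.
rewrite ler_pdivrMr ?mulr_gt0 // -tel ler_wpM2l //.
have h2 : 0 < (2 : R) ^+ n by rewrite exprn_gt0.
rewrite mulrC -ler_pdivlMr //.
apply: le_trans (ler_norm _) _; apply: le_trans (sin_le_norm _) _.
by rewrite ger0_norm // divr_ge0 ?ltW // mulr_gt0.
Qed.

End Fourier.

(** * Zeros of the transform of one factor *)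

Section FactorZeros.
Variables (R : realType) (q d : nat -> nat) (p Q : nat -> int) (C : nat).
Hypothesis hq : forall n, q n = 2%N \/ q n = 3%N.
Hypothesis hd : forall n, (0 < d n <= C)%N.
Hypothesis hQ0 : forall n, Q n != 0.
Hypothesis hQS : forall n, Q n.+1 = Q n * p n.
Variables (a be ga : nat -> int).
Hypothesis hbe : forall n, q n = 2%N -> be n = 1 \/ be n = -1.
Hypothesis hga : forall n, q n = 3%N -> coprimez (be n) (ga n).

(** The digits are written as [a + d * {0, be, ga}], with [be] and [ga] coprime;
    there is no third digit when [q n] is 2. *)
Definition digits n : seq int :=
  [:: a n, a n + (d n)%:Z * be n &
    if q n == 2%N then [::] else [:: a n + (d n)%:Z * ga n]].

Definition factor n : seq R := [seq x%:~R / (Q n.+1)%:~R | x <- digits n].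

(** One of [be], [ga] is congruent to 1 and the other to -1 modulo 3. *)
Definition resid n := q n = 3%N -> ~~ (3 %| be n)%Z /\ (3 %| be n + ga n)%Z.

Lemma size_factor n : size (factor n) = q n.
Proof. by rewrite /factor size_map /=; case: (hq n) => ->. Qed.

Lemma factor_gt0 n : (0 < size (factor n))%N.
Proof. by rewrite size_factor; case: (hq n) => ->. Qed.

Let t n (x : R) := x / period R d Q n.

Lemma QR_neq0 n : (Q n)%:~R != 0 :> R. Proof. by rewrite intr_eq0. Qed.
Let dR n : (d n)%:R != 0 :> R. Proof. exact: dR_neq0 hd n. Qed.

Lemma period_neq0 n : period R d Q n != 0.
Proof. by rewrite /period mulf_neq0 ?invr_eq0 ?QR_neq0. Qed.

Lemma tE n x (b : int) : x * ((a n + (d n)%:Z * b)%:~R / (Q n.+1)%:~R) =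
  x * ((a n)%:~R / (Q n.+1)%:~R) + b%:~R * t n x.
Proof.
rewrite rmorphD rmorphM /= /t /period.
by field; rewrite !QR_neq0 !dR.
Qed.

Lemma zsetE n x : zset q d Q n x <->
  exists z : int, ~~ ((q n)%:Z %| z)%Z /\ t n x = z%:~R / (q n)%:R.
Proof.
have h1 := period_neq0 n; have h2 := qR_neq0 R hq n.
split=> -[z [hz e]]; exists z; split => //.
  by rewrite e /t; field; rewrite h1 h2.
have -> : x = t n x * period R d Q n by rewrite /t divfK.
by rewrite e; field.
Qed.

Lemma fsum_factor n x : fsum (factor n) x = e2pi (x * ((a n)%:~R / (Q n.+1)%:~R)) *
  (1 + e2pi ((be n)%:~R * t n x) + (if q n == 2%N then 0 else e2pi ((ga n)%:~R * t n x))).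
Proof.
rewrite /fsum /factor /digits big_map !big_cons !mulrDr mulr1 tE e2piD addrA.
by case: ifP => _; rewrite ?big_nil ?big_cons ?big_nil ?mulr0 ?addr0 // tE e2piD.
Qed.

Lemma e2pi_neq0 (y : R) : e2pi y != 0.
Proof.
apply/eqP => h; have := nsq_e2pi y; rewrite h /nsq /= expr0n addr0 => /eqP.
by rewrite eq_sym oner_eq0.
Qed.

Lemma e2pi_natM (y : R) k : e2pi (k%:R * y) = e2pi y ^+ k.
Proof.
elim: k => [|k IH]; first by rewrite mul0r e2pi0.
by rewrite -natr1 mulrDl mul1r e2piD IH exprSr.
Qed.

Lemma factor_eq0 n x : (favg (factor n) x == 0) =
  (1 + e2pi ((be n)%:~R * t n x) + (if q n == 2%N then 0 else e2pi ((ga n)%:~R * t n x)) == 0).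
Proof.
rewrite /favg mulf_eq0 invr_eq0 (negPf (natC_neq0 _ (factor_gt0 n))) orbF.
by rewrite fsum_factor mulf_eq0 (negPf (e2pi_neq0 _)).
Qed.

Lemma e2pi_int_dvd (m : int) k : (0 < k)%N -> e2pi (m%:~R / k%:R : R) = 1 -> (k%:Z %| m)%Z.
Proof.
move=> k0 /e2pi_eq1[l hl]; have kR : k%:R != 0 :> R by rewrite pnatr_eq0 -lt0n.
apply/dvdzP; exists l; apply/eqP; rewrite -(eqr_int R) rmorphM /= -hl.
by rewrite divfK.
Qed.

Lemma e2pi_half : e2pi (2^-1 : R) = -1.
Proof.
have e : 2 * pi * 2^-1 = pi :> R by field.
by rewrite /e2pi e cospi sinpi; apply/eqP; rewrite eq_complex /= oppr0 !eqxx.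
Qed.

(** For two digits, [1 + u = 0] says that [u] is [-1].  For three digits, three
    unit complex numbers add up to 0 only if they are, up to a common phase, the
    three cube roots of unity: [1 + u + v = 0] and its conjugate give [u * v = 1]
    and [u ^+ 3 = 1].  As [be] and [ga] are coprime, [x] itself is then a third of
    a multiple of the period, and [u * v = 1] with [u != 1] is the residue
    condition. *)
Lemma factor_zero n x : favg (factor n) x = 0 <-> resid n /\ zset q d Q n x.
Proof.
have e1 := factor_eq0 n x; rewrite zsetE; set T := t n x in e1 *.
have -> : favg (factor n) x = 0 <-> favg (factor n) x == 0 by split=> /eqP.
rewrite {}e1 /resid; case: (hq n) => qn; rewrite qn /= ?addr0.
  have hb : e2pi ((be n)%:~R * T) = -1 <-> e2pi T = -1.
    have [->|->] := hbe qn; first by rewrite mul1r.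
    rewrite rmorphN mulNr mul1r e2piNr; split => [h|->].
      by rewrite -[e2pi T]conjcK h rmorphN rmorph1.
    by rewrite rmorphN rmorph1.
  split=> [|[_ [z [hz ez]]]].
    rewrite addrC addr_eq0 => /eqP/hb h; split => //.
    have := e2pi_natM T 2; rewrite h -signr_odd /= expr0 => /e2pi_eq1[m hm].
    exists m; split; last by rewrite -hm mulrC mulKf.
    apply/negP => /dvdzP[k hk].
    have : e2pi T = 1.
      by rewrite -(e2pi_int R k); congr e2pi; apply: (mulfI (_ : 2 != 0 :> R)) => //; rewrite hm hk rmorphM /= mulrC.
    rewrite h => /eqP; rewrite -subr_eq0 -opprD oppr_eq0 -(natrD _ 1 1).
    by rewrite pnatr_eq0.
  rewrite addrC addr_eq0; apply/eqP/hb; rewrite ez.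
  have /dvdzP[k hk] : (2 %| z - 1)%Z by move: hz; lia.
  have -> : z%:~R / 2 = k%:~R + 2^-1 :> R.
    have -> : z = k * 2 + 1 by rewrite -hk; lia.
    by rewrite rmorphD rmorphM /=; field.
  by rewrite e2piD e2pi_int mul1r e2pi_half.
set u := e2pi _; set v := e2pi _.
have uN : u * e2pi (- ((be n)%:~R * T)) = 1 by rewrite e2pi_mulN.
have vN : v * e2pi (- ((ga n)%:~R * T)) = 1 by rewrite e2pi_mulN.
split.
  move=> /eqP h1.
  have h2 : 1 + e2pi (- ((be n)%:~R * T)) + e2pi (- ((ga n)%:~R * T)) = 0.
    transitivity ((1 + u + v)^*)%C; last by rewrite h1 rmorph0.
    by rewrite !e2piNr !rmorphD rmorph1.
  set u' := e2pi _ in uN h2; set v' := e2pi _ in vN h2.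
  have uv : u * v = 1.
    have : u * v * (1 + u' + v') = 0 by rewrite h2 mulr0.
    have -> : u * v * (1 + u' + v') = u * v + v * (u * u') + u * (v * v') by ring.
    rewrite uN vN !mulr1 => h3.
    have : u * v - 1 = 0 by rewrite -[RHS]subr0 -{1}h3 -h1; ring.
    by move/eqP; rewrite subr_eq0 => /eqP.
  have u3 : u ^+ 3 = 1.
    apply/eqP; rewrite -subr_eq0.
    have -> : u ^+ 3 - 1 = (u - 1) * (u * (1 + u + v) + (1 - u * v)) by ring.
    by rewrite h1 uv subrr mulr0 addr0 mulr0.
  have v3 : v ^+ 3 = 1.
    by rewrite -[LHS]mul1r -[X in X * _]u3 -exprMn uv expr1n.
  have [m1 hm1] : exists m : int, 3 * ((be n)%:~R * T) = m%:~R.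
    by apply: e2pi_eq1; rewrite (e2pi_natM _ 3).
  have [m2 hm2] : exists m : int, 3 * ((ga n)%:~R * T) = m%:~R.
    by apply: e2pi_eq1; rewrite (e2pi_natM _ 3).
  have [[k l] /= hkl] := coprimezP _ _ (hga qn).
  have T3 : T = (k * m1 + l * m2)%:~R / 3.
    have h3 : (k * be n + l * ga n)%:~R = 1 :> R by rewrite hkl.
    transitivity ((k * be n + l * ga n)%:~R * T); first by rewrite h3 mul1r.
    by rewrite !intrD !intrM -hm1 -hm2; field.
  set z := k * m1 + l * m2 in T3.
  have hbz : ~~ (3 %| be n * z)%Z.
    apply/negP => /dvdzP[j hj].
    have u1 : u = 1.
      rewrite /u T3 mulrA -rmorphM hj rmorphM /= mulfK //; exact: e2pi_int.
    have v1 : v = 1 by move: uv; rewrite u1 mul1r.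
    move: h1; rewrite u1 v1 => /eqP.
    by rewrite -(natrD _ 1 1) -(natrD _ 2 1) pnatr_eq0.
  have hb : ~~ (3 %| be n)%Z by apply: contra hbz => h; exact: dvdz_mulr.
  have hz : ~~ (3 %| z)%Z by apply: contra hbz => h; exact: dvdz_mull.
  have hs : (3 %| (be n + ga n) * z)%Z.
    apply: e2pi_int_dvd => //; rewrite rmorphM rmorphD /= -mulrA -T3 mulrDl e2piD.
    exact: uv.
  split; last by exists z.
  move=> _; split => //; move: hs hz.
  by rewrite !dvdzE abszM Euclid_dvdM // => /orP[//|->].
move=> [/(_ erefl)[hb hs] [z [hz T3]]].
have uv : u * v = 1.
  have /dvdzP[k hk] := hs.
  rewrite /u /v -e2piD -mulrDl -rmorphD hk T3 rmorphM /= mulrAC.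
  have -> : k%:~R * (z%:~R / 3%:R) * 3%:~R = (k * z)%:~R :> R.
    by rewrite rmorphM /=; field.
  exact: e2pi_int.
have u3 : u ^+ 3 = 1.
  rewrite -e2pi_natM T3.
  have -> : 3%:R * ((be n)%:~R * (z%:~R / 3%:R)) = (be n * z)%:~R :> R.
    by rewrite rmorphM /=; field.
  exact: e2pi_int.
have u1 : u - 1 != 0.
  rewrite subr_eq0; apply/eqP; rewrite /u T3 mulrA -rmorphM => /e2pi_int_dvd.
  move=> /(_ isT); move: hb hz; rewrite !dvdzE abszM Euclid_dvdM //.
  by move=> /negPf -> /negPf ->.
have u0 : u != 0 by exact: e2pi_neq0.
apply/eqP; apply: (mulfI u0); apply: (mulfI u1).
have -> : (u - 1) * (u * (1 + u + v)) = u ^+ 3 - 1 + (u - 1) * (u * v - 1) by ring.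
by rewrite u3 uv !subrr !mulr0 addr0.
Qed.

Lemma e2pi_period (y : R) (m : int) : e2pi (y + m%:~R) = e2pi y.
Proof. by rewrite e2piD e2pi_int mulr1. Qed.

(** Along the period lattice the transform changes by a phase only. *)
Lemma nrm_favg_lattice n x y : lattice d Q n y ->
  Normc.normc (favg (factor n) (x + y)) = Normc.normc (favg (factor n) x).
Proof.
move=> [z hz]; rewrite /favg !Normc.normcM; congr (_ * _).
rewrite !fsum_factor !Normc.normcM !nrm_e2pi.
have -> : t n (x + y) = t n x + z%:~R.
  by rewrite /t mulrDl hz mulfK ?period_neq0.
by rewrite !mulrDr -!intrM !e2pi_period.
Qed.

End FactorZeros.

(** * Uniform measures on finite lists and their convolutions *)

Section FiniteAverages.
Variable R : realType.
Implicit Types (X Y : seq R) (f g : R -> R) (B : set R).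

Definition avg X f : R := (\sum_(x <- X) f x) / (size X)%:R.

Definition avg_measure X (mu : set R -> \bar R) :=
  forall B, measurable B -> mu B = (avg X (\1_B))%:E.

Lemma ge0_integral_avg X (mu : {measure set R -> \bar R}) f : (0 < size X)%N ->
  avg_measure X mu -> measurable_fun setT f -> (forall x, 0 <= f x) ->
  (\int[mu]_x (f x)%:E = (avg X f)%:E)%E.
Proof.
move=> X0 hmu mf f0.
have n0 : 0 <= ((size X)%:R : R)^-1 by rewrite invr_ge0.
pose nu := mscale (NngNum n0) (msum (fun k => \d_(X`_k)) (size X)).
have e B : measurable B -> B `<=` setT -> mu B = nu B.
  move=> mB _; rewrite hmu // /nu /mscale /msum /= /avg (big_nth 0) big_mkord.
  by rewrite mulrC EFinM -sumEFin; congr (_ * _)%E.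
rewrite (eq_measure_integral nu e) /nu.
have mfE : measurable_fun setT (EFin \o f) by apply/measurable_EFinP.
rewrite ge0_integral_mscale //; last by move=> x _; rewrite lee_fin.
rewrite ge0_integral_measure_sum //; last by move=> x _; rewrite lee_fin.
rewrite /avg mulrC EFinM; congr (_ * _)%E.
rewrite (big_nth 0) big_mkord -sumEFin; apply: eq_bigr => i _.
by rewrite integral_dirac // diracT mul1e.
Qed.

Lemma Rintegral_avg X (mu : {measure set R -> \bar R}) f : (0 < size X)%N ->
  avg_measure X mu -> measurable_fun setT f ->
  \int[mu]_x f x = avg X f.
Proof.
move=> X0 hmu mf; rewrite /Rintegral integralE.
have h1 : (\int[mu]_x ((EFin \o f)^\+ x) = (avg X (fun x => Num.max (f x) 0))%:E)%E.
  rewrite -(ge0_integral_avg X0 hmu).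
  - by apply: eq_integral => x _; rewrite funeposE /= EFin_max.
  - by apply: measurable_maxr => //; exact: measurable_cst.
  - by move=> x; rewrite le_max lexx orbT.
have h2 : (\int[mu]_x ((EFin \o f)^\- x) = (avg X (fun x => Num.max (- f x) 0))%:E)%E.
  rewrite -(ge0_integral_avg X0 hmu).
  - by apply: eq_integral => x _; rewrite funenegE /= EFin_max.
  - apply: measurable_maxr; last exact: measurable_cst.
    exact: measurableT_comp.
  - by move=> x; rewrite le_max lexx orbT.
rewrite h1 h2 -EFinB /= /avg -mulrBl -sumrB; congr (_ / _).
apply: eq_bigr => x _; rewrite /Num.max; case: ifPn; case: ifPn; lra.
Qed.

(** Convolution with a uniform measure on a finite set is the uniform measure on
    all the sums, counted with multiplicity; this is why points are kept in lists
    and not in sets. *)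
Lemma avg_measure_conv X (A : {fset R}) (mu : probability R R) : (0 < size X)%N ->
  A != fset0 -> avg_measure X mu ->
  avg_measure (sumset A X) (convolution mu (delta_fset A)).
Proof.
move=> X0 A0 hmu B mB.
rewrite /convolution /distribution /pushforward /product_measure1.
pose F x : R := (\sum_(y <- A) \1_B (x + y)) / #|` A|%:R.
transitivity (\int[mu]_x (F x)%:E)%E.
  apply: eq_integral => x _.
  change (delta_fset A (xsection (addpair @^-1` B) x) = (F x)%:E).
  rewrite delta_fsetE // /F mulrC EFinM; congr (_ * _)%E.
  rewrite -sumEFin; apply: eq_bigr => y _.
  rewrite diracE indicE; congr ((_ : bool)%:R%:E).
  by apply/idP/idP; rewrite !inE /xsection /= ?inE /addpair.
have mF : measurable_fun setT F.
  apply: measurable_funM; last exact: measurable_cst.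
  apply: measurable_sum => y.
  have h : measurable_fun setT ((\1_B : R -> R) \o (fun x : R => x + y)).
    apply: measurableT_comp; first exact: measurable_indic.
    by apply: measurable_funD => //; exact: measurable_cst.
  exact: h.
rewrite (ge0_integral_avg X0 hmu) //; last first.
  by move=> x; rewrite divr_ge0 // sumr_ge0.
congr EFin; rewrite /avg /sumset size_allpairs natrM invfM.
rewrite big_allpairs_dep /= exchange_big /= -mulr_suml -!mulrA; congr (_ * _).
  by apply: eq_bigr => x _; apply: eq_bigr => y _; rewrite addrC.
Qed.

End FiniteAverages.

(** * Totality of the exponentials in L2 of a probability measure *)

Section SquareIntegrals.
Variables (R : realType) (mu : probability R R).
Implicit Types (f g h : R -> R[i]).

Definition cmeas f := measurable_fun setT (fun x => complex.Re (f x)) /\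
  measurable_fun setT (fun x => complex.Im (f x)).

(** The square of the [L2] norm; finite sums and limits are easier to handle
    without the square root. *)
Definition E2 f : \bar R := (\int[mu]_x (nsq (f x))%:E)%E.

Lemma cmeasD f g : cmeas f -> cmeas g -> cmeas (fun x => f x + g x).
Proof.
move=> [f1 f2] [g1 g2]; split.
  apply: (eq_measurable_fun (fun x => complex.Re (f x) + complex.Re (g x))).
    by move=> x _; case: (f x) (g x) => [a b] [c d].
  exact: measurable_funD.
apply: (eq_measurable_fun (fun x => complex.Im (f x) + complex.Im (g x))).
  by move=> x _; case: (f x) (g x) => [a b] [c d].
exact: measurable_funD.
Qed.

Lemma cmeasM f g : cmeas f -> cmeas g -> cmeas (fun x => f x * g x).
Proof.
move=> [f1 f2] [g1 g2]; split.
  apply: (eq_measurable_fun (fun x => complex.Re (f x) * complex.Re (g x) - complex.Im (f x) * complex.Im (g x))).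
    by move=> x _; case: (f x) (g x) => [a b] [c d].
  by apply: measurable_funB; exact: measurable_funM.
apply: (eq_measurable_fun (fun x => complex.Re (f x) * complex.Im (g x) + complex.Im (f x) * complex.Re (g x))).
  by move=> x _; case: (f x) (g x) => [a b] [c d].
by apply: measurable_funD; exact: measurable_funM.
Qed.

Lemma cmeas_cst (z : R[i]) : cmeas (fun=> z).
Proof. by split; exact: measurable_cst. Qed.

Lemma cmeasB f g : cmeas f -> cmeas g -> cmeas (fun x => f x - g x).
Proof.
move=> hf hg; have : cmeas (fun x => f x + (-1) * g x).
  by apply: cmeasD => //; apply: cmeasM => //; exact: cmeas_cst.
by congr cmeas; apply/funext => x; rewrite mulN1r.
Qed.

Lemma continuous_cos_e2pi (t : R) : continuous (fun x => cos (2 * pi * (t * x)) : R).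
Proof.
move=> x; apply: (@continuous_comp _ _ _ (fun x => 2 * pi * (t * x)) cos).
  by apply: cvgMr; apply: cvgMr; exact: cvg_id.
exact: continuous_cos.
Qed.

Lemma continuous_sin_e2pi (t : R) : continuous (fun x => sin (2 * pi * (t * x)) : R).
Proof.
move=> x; apply: (@continuous_comp _ _ _ (fun x => 2 * pi * (t * x)) sin).
  by apply: cvgMr; apply: cvgMr; exact: cvg_id.
exact: continuous_sin.
Qed.

Lemma cmeas_e2pi (t : R) : cmeas (fun x => e2pi (t * x)).
Proof.
split; apply: continuous_measurable_fun;
  [exact: continuous_cos_e2pi|exact: continuous_sin_e2pi].
Qed.

Lemma cmeas_sum (I : Type) (r : seq I) (F : I -> R -> R[i]) :
  (forall i, cmeas (F i)) -> cmeas (fun x => \sum_(i <- r) F i x).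
Proof.
move=> hF; elim: r => [|i r IH].
  have := cmeas_cst 0; congr cmeas; apply/funext => x; by rewrite big_nil.
have := cmeasD (hF i) IH; congr cmeas; apply/funext => x; by rewrite big_cons.
Qed.

Lemma measurable_nsq f : cmeas f -> measurable_fun setT (fun x => nsq (f x)).
Proof.
by move=> [f1 f2]; apply: measurable_funD; exact: measurable_funX.
Qed.

Lemma measurable_nsqE f : cmeas f -> measurable_fun setT (fun x => (nsq (f x))%:E).
Proof. by move=> hf; apply/measurable_EFinP; exact: measurable_nsq. Qed.

Lemma E2_ge0 f : (0 <= E2 f)%E.
Proof. by apply: integral_ge0 => x _; rewrite lee_fin nsq_ge0. Qed.

Lemma nsqD_le (u v : R[i]) (e : R) : 0 < e ->
  nsq (u + v) <= (1 + e) * nsq u + (1 + e^-1) * nsq v.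
Proof.
case: u v => [a b] [c d] e0; rewrite /nsq /=.
have key (x y : R) : (x + y) ^+ 2 <= (1 + e) * x ^+ 2 + (1 + e^-1) * y ^+ 2.
  rewrite -subr_ge0.
  have -> : (1 + e) * x ^+ 2 + (1 + e^-1) * y ^+ 2 - (x + y) ^+ 2 = (e * x - y) ^+ 2 / e.
    by field; rewrite gt_eqF.
  by rewrite divr_ge0 ?sqr_ge0 // ltW.
by have := key a c; have := key b d; lra.
Qed.

Lemma nsqD_le2 (u v : R[i]) : nsq (u + v) <= 2 * nsq u + 2 * nsq v.
Proof. by have := @nsqD_le u v 1 ltr01; rewrite invr1; lra. Qed.

Lemma E2D_le f g : cmeas f -> cmeas g ->
  (E2 (fun x => f x + g x)%R <= 2%:E * E2 f + 2%:E * E2 g)%E.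
Proof.
move=> hf hg.
have mf := measurable_nsqE hf; have mg := measurable_nsqE hg.
rewrite /E2 -!ge0_integralZl_EFin //; try by move=> x _; rewrite lee_fin nsq_ge0.
rewrite -ge0_integralD //; try by move=> x _; rewrite lee_fin mulr_ge0 ?nsq_ge0.
- apply: ge0_le_integral => //.
  + by move=> x _; rewrite lee_fin nsq_ge0.
  + by apply: measurable_nsqE; exact: cmeasD.
  + by apply: emeasurable_funD; apply: measurable_funeM.
  + by move=> x _; rewrite lee_fin nsqD_le2.
- by apply: measurable_funeM.
- by apply: measurable_funeM.
Qed.

Lemma E2Z (z : R[i]) f : cmeas f -> E2 (fun x => z * f x)%R = ((nsq z)%:E * E2 f)%E.
Proof.
move=> hf; rewrite /E2 -ge0_integralZl_EFin ?nsq_ge0 //.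
- by apply: eq_integral => x _; rewrite nsqM.
- by move=> x _; rewrite lee_fin nsq_ge0.
- exact: measurable_nsqE.
Qed.

Lemma L2norm_lt f (eps : R) : 0 < eps ->
  (L2norm mu f < eps%:E)%E <-> (E2 f < (eps ^+ 2)%:E)%E.
Proof.
move=> e0; rewrite /L2norm Lnorm.unlock.
have -> : (\int[mu]_x (`|(Normc.normc (f x))%:E| `^ 2) = E2 f)%E.
  apply: eq_integral => x _; rewrite abse_EFin poweR_EFin ger0_norm ?nrm_ge0 //.
  by rewrite (powR_mulrn 2) ?nrm_ge0 // nrm_sqr.
have := E2_ge0 f; case: (E2 f) => [r| |] // r0; last first.
  by rewrite poweRyr ?invr_eq0 //; split; rewrite ltNge leey.
rewrite poweR_EFin powR12_sqrt // !lte_fin.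
rewrite -(@ltr_sqrt _ r) ?exprn_gt0 // sqrtr_sqr gtr0_norm //.
Qed.

Lemma in_L2E f : in_L2 mu f <-> cmeas f /\ (E2 f < +oo)%E.
Proof.
have aux (y : \bar R) : (0 <= y)%E -> (y < +oo)%E <-> exists2 e : R, 0 < e & (y < (e ^+ 2)%:E)%E.
  case: y => [r| |] // r0; last by split => // -[e _]; rewrite ltNge leey.
  split => [_|_]; last by rewrite ltry.
  exists (r + 1); first by rewrite ltr_wpDl.
  by rewrite lte_fin expr2; move: r0; rewrite lee_fin => r0; nra.
have nlt : (L2norm mu f < +oo)%E <-> exists2 e : R, 0 < e & (L2norm mu f < e%:E)%E.
  have := Lnorm_ge0 mu 2%:E (fun x => (Normc.normc (f x))%:E); rewrite -/(L2norm mu f).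
  case: (L2norm mu f) => [r| |] // r0; last by split => // -[e _]; rewrite ltNge leey.
  split => [_|_]; last by rewrite ltry.
  exists (r + 1); first by rewrite ltr_wpDl.
  by rewrite lte_fin ltrDl.
have e2 := aux _ (E2_ge0 f).
split.
  move=> [h1 h2 /nlt[e e0 /L2norm_lt h3]]; split => //.
  by apply/e2; exists e => //; exact: h3.
move=> [[h1 h2] /e2[e e0 h3]]; split => //.
by apply/nlt; exists e => //; apply/L2norm_lt.
Qed.

Definition trig_poly (Lam : set R) h := exists s : seq (R[i] * R),
  (forall k, k \in s -> Lam k.2) /\ forall x, h x = \sum_(k <- s) k.1 * e2pi (k.2 * x).

(** Membership in the closed span of the exponentials with frequencies in [Lam]. *)
Definition approx (Lam : set R) f := cmeas f /\
  forall eps : R, 0 < eps -> exists2 h, trig_poly Lam h &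
    (E2 (fun x => f x - h x)%R < eps%:E)%E.

Lemma trig_poly_meas Lam h : trig_poly Lam h -> cmeas h.
Proof.
move=> [s [_ hs]]; have -> : h = fun x => \sum_(k <- s) k.1 * e2pi (k.2 * x).
  exact/funext.
by apply: cmeas_sum => k; apply: cmeasM; [exact: cmeas_cst|exact: cmeas_e2pi].
Qed.

Lemma trig_polyD Lam f g : trig_poly Lam f -> trig_poly Lam g ->
  trig_poly Lam (fun x => f x + g x).
Proof.
move=> [s [hs es]] [t [ht et]]; exists (s ++ t); split.
  by move=> k; rewrite mem_cat => /orP[/hs|/ht].
by move=> x; rewrite big_cat es et.
Qed.

Lemma trig_polyZ Lam (z : R[i]) f : trig_poly Lam f -> trig_poly Lam (fun x => z * f x).
Proof.
move=> [s [hs es]]; exists [seq (z * k.1, k.2) | k <- s]; split.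
  by move=> k' /mapP[k ks ->] /=; exact: hs.
by move=> x; rewrite big_map es mulr_sumr; apply: eq_bigr => k _ /=; rewrite mulrA.
Qed.

Lemma approx_meas Lam f : approx Lam f -> cmeas f. Proof. by case. Qed.

Lemma approx_close Lam f : cmeas f ->
  (forall eps : R, 0 < eps -> exists2 g, approx Lam g & (E2 (fun x => f x - g x)%R < eps%:E)%E) ->
  approx Lam f.
Proof.
move=> mf H; split => // eps e0.
have e4 : 0 < eps / 4 by rewrite divr_gt0.
have [g [mg hg] fg] := H _ e4; have [h Lh gh] := hg _ e4.
exists h => //.
have mh := trig_poly_meas Lh.
have -> : (fun x => f x - h x) = (fun x => (f x - g x) + (g x - h x)).
  by apply/funext => x; ring.
apply: le_lt_trans (E2D_le (cmeasB mf mg) (cmeasB mg mh)) _.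
have -> : eps%:E = (2%:E * (eps / 4)%:E + 2%:E * (eps / 4)%:E)%E.
  by rewrite -!EFinM -EFinD; congr EFin; field.
by apply: lteD; rewrite lte_pmul2l // ?lte_fin.
Qed.

Lemma approxD Lam f g : approx Lam f -> approx Lam g -> approx Lam (fun x => f x + g x).
Proof.
move=> [mf hf] [mg hg]; split; first exact: cmeasD.
move=> eps e0; have e4 : 0 < eps / 4 by rewrite divr_gt0.
have [f' Lf ff'] := hf _ e4; have [g' Lg gg'] := hg _ e4.
exists (fun x => f' x + g' x); first exact: trig_polyD.
have mf' := trig_poly_meas Lf; have mg' := trig_poly_meas Lg.
have -> : (fun x => f x + g x - (f' x + g' x)) = (fun x => (f x - f' x) + (g x - g' x)).
  by apply/funext => x; ring.
apply: le_lt_trans (E2D_le (cmeasB mf mf') (cmeasB mg mg')) _.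
have -> : eps%:E = (2%:E * (eps / 4)%:E + 2%:E * (eps / 4)%:E)%E.
  by rewrite -!EFinM -EFinD; congr EFin; field.
by apply: lteD; rewrite lte_pmul2l // ?lte_fin.
Qed.

Lemma approxZ Lam z f : approx Lam f -> approx Lam (fun x => z * f x).
Proof.
move=> [mf hf]; split; first by apply: cmeasM => //; exact: cmeas_cst.
move=> eps e0; have z0 := nsq_ge0 z.
have [h Lh fh] := hf (eps / (nsq z + 1)) (divr_gt0 e0 (ltr_wpDl z0 ltr01)).
exists (fun x => z * h x); first exact: trig_polyZ.
have -> : (fun x => z * f x - z * h x) = (fun x => z * (f x - h x)).
  by apply/funext => x; ring.
rewrite E2Z; last by apply: cmeasB => //; exact: trig_poly_meas Lh.
move: fh (E2_ge0 (fun x => f x - h x)); case: (E2 _) => [r| |] //.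
rewrite lte_fin lee_fin -EFinM lte_fin => h1 r0.
have : r * (nsq z + 1) < eps by rewrite -ltr_pdivlMr // ltr_wpDl.
by lra.
Qed.

Lemma trig_poly_approx Lam h : trig_poly Lam h -> approx Lam h.
Proof.
move=> hh; split; first exact: trig_poly_meas hh.
move=> eps e0; exists h => //.
have -> : (fun x => h x - h x) = (fun=> 0) by apply/funext => x; rewrite subrr.
rewrite /E2 integral0_eq ?lte_fin // => x _.
by rewrite /nsq /= expr0n addr0.
Qed.

Lemma approx0 Lam : approx Lam (fun=> 0).
Proof. by apply: trig_poly_approx; exists [::]; split => // x; rewrite big_nil. Qed.

Lemma approx_sum Lam (I : Type) (r : seq I) (F : I -> R -> R[i]) :
  (forall i, approx Lam (F i)) -> approx Lam (fun x => \sum_(i <- r) F i x).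
Proof.
move=> hF; elim: r => [|i r IH].
  have := approx0 Lam; congr approx; apply/funext => x; by rewrite big_nil.
have := approxD (hF i) IH; congr approx; apply/funext => x; by rewrite big_cons.
Qed.

Lemma approx_trig Lam h : (forall t, approx Lam (fun x => e2pi (t * x))) ->
  trig_poly setT h -> approx Lam h.
Proof.
move=> H [s [_ hs]].
have -> : h = fun x => \sum_(k <- s) k.1 * e2pi (k.2 * x) by exact/funext.
by apply: approx_sum => k; exact: approxZ.
Qed.

(** Dominated convergence. *)
Lemma approx_lim Lam (g : nat -> R -> R[i]) f (G : R -> R) :
  (forall n, approx Lam (g n)) -> cmeas f ->
  mu.-integrable setT (EFin \o G) ->
  (forall n x, nsq (f x - g n x) <= G x) ->
  (forall x, (fun n => nsq (f x - g n x)) @ \oo --> (0 : R)) ->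
  approx Lam f.
Proof.
move=> hg mf iG hG hc; apply: approx_close => // eps e0.

have hc' x : setT x -> (fun n => (nsq (f x - g n x))%:E) @ \oo --> 0%:E.
  by move=> _; apply/fine_cvgP; split; [exact: nearW|exact: hc].
have hG' x n : setT x -> (`|(nsq (f x - g n x))%:E| <= (EFin \o G) x)%E.
  by rewrite abse_EFin ger0_norm ?nsq_ge0 // lee_fin.
have [_ _] := @dominated_convergence _ _ _ mu setT measurableT
  (fun n x => (nsq (f x - g n x))%:E) (fun=> 0%:E) (EFin \o G)
  (fun n => measurable_nsqE (cmeasB mf (approx_meas (hg n)))) (measurable_cst _)
  (aeW _ hc') iG
  (aeW _ hG').
rewrite integral0 => /fine_cvgP[hfin hlim].
have [n [h1 h2]] := filter_ex (filterI hfin (cvgr_lt _ hlim eps e0)).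
exists (g n) => //; have h3 := fineK h1.
by rewrite /= in h1 h2 h3; rewrite /E2 -h3 lte_fin.
Qed.

Lemma trig_polyM f g : trig_poly setT f -> trig_poly setT g ->
  trig_poly setT (fun x => f x * g x).
Proof.
move=> [s [_ es]] [t [_ et]].
exists [seq (k.1 * l.1, k.2 + l.2) | k <- s, l <- t]; split => // x.
rewrite big_allpairs_dep /= es et mulr_suml; apply: eq_bigr => k _.
rewrite mulr_sumr; apply: eq_bigr => l _; rewrite mulrDl e2piD; ring.
Qed.

Lemma trig_poly_cst (z : R[i]) : trig_poly setT (fun=> z).
Proof.
exists [:: (z, 0)]; split => // x.
by rewrite big_seq1 /= mul0r e2pi0 mulr1.
Qed.

Lemma trig_polyX f n : trig_poly setT f -> trig_poly setT (fun x => f x ^+ n).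
Proof.
move=> hf; elim: n => [|n IH].
  exact: trig_poly_cst.
have := trig_polyM hf IH; congr (trig_poly _ _); apply/funext => x.
by rewrite exprS.
Qed.

Lemma trig_poly_1B f : trig_poly setT f -> trig_poly setT (fun x => 1 - f x).
Proof.
move=> hf; have := trig_polyD (trig_poly_cst 1) (trig_polyZ (-1) hf).
by congr (trig_poly _ _); apply/funext => x; rewrite mulN1r.
Qed.

(** A trigonometric polynomial with values between 0 and 1.  With a small [k] and
    a suitable phase it is below [1 / 2] on the left of a given point and above
    on the right, on an interval as long as desired. *)
Definition wave (k b x : R) : R := (1 + cos (2 * pi * (k * x + b))) / 2.

Lemma trig_poly_wave k b : trig_poly setT (fun x => (wave k b x)%:C%C).
Proof.
exists [:: ((4%:R^-1)%:C%C * e2pi b, k); ((4%:R^-1)%:C%C * e2pi (- b), - k); ((2%:R^-1)%:C%C, 0)]; split => // x.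
rewrite !big_cons big_nil /= -!mulrA -!e2piD mul0r e2pi0 mulNr -opprD e2piNr [b + _]addrC /wave.
apply/eqP; rewrite eq_complex /=; by apply/andP; split; apply/eqP; field.
Qed.

Lemma wave_bound k b x : 0 <= wave k b x <= 1.
Proof. by rewrite /wave; have := cos_le1 (2 * pi * (k * x + b)); have := cos_geN1 (2 * pi * (k * x + b)); lra. Qed.

(** A polynomial in [s] that tends to 1 for [s < 1/2] and to 0 for [s >= 1/2]:
    compare [n * 2 ^ n * s ^ n = n * (2 * s) ^ n] with 1. *)
Definition threshold (n : nat) (s : R) := (1 - s ^+ n) ^+ (n * 2 ^ n).

Lemma threshold_bound n (s : R) : 0 <= s <= 1 -> 0 <= threshold n s <= 1.
Proof.
move=> /andP[s0 s1]; have h0 : 0 <= s ^+ n by rewrite exprn_ge0.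
have h1 : s ^+ n <= 1 by rewrite exprn_ile1.
have h2 : 0 <= 1 - s ^+ n by rewrite subr_ge0.
by rewrite /threshold exprn_ge0 //= exprn_ile1 // gerBl.
Qed.

Lemma bernoulli_lower (u : R) k : 0 <= u <= 1 -> 1 - k%:R * u <= (1 - u) ^+ k.
Proof.
move=> /andP[u0 u1]; elim: k => [|k IH]; first by rewrite mul0r subr0 expr0.
rewrite exprS -natr1; have k0 : 0 <= k%:R :> R by [].
have h : (1 - u) * (1 - k%:R * u) <= (1 - u) * (1 - u) ^+ k.
  by rewrite ler_wpM2l // subr_ge0.
have h2 : 0 <= k%:R * (u * u) by rewrite !mulr_ge0.
by apply: le_trans h; lra.
Qed.

Lemma bernoulli_upper (u : R) k : 0 <= u <= 1 -> (1 - u) ^+ k * (1 + k%:R * u) <= 1.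
Proof.
move=> /andP[u0 u1].
have hb : 1 + k%:R * u <= (1 + u) ^+ k.
  elim: k => [|k IH]; first by rewrite mul0r addr0 expr0.
  rewrite exprS -natr1; have k0 : 0 <= k%:R :> R by [].
  have h : (1 + u) * (1 + k%:R * u) <= (1 + u) * (1 + u) ^+ k.
    by rewrite ler_wpM2l // addr_ge0.
  have h2 : 0 <= k%:R * (u * u) by rewrite !mulr_ge0.
  by apply: le_trans h; lra.
have h1 : 0 <= (1 - u) ^+ k by rewrite exprn_ge0 // subr_ge0.
apply: le_trans (ler_wpM2l h1 hb) _; rewrite -exprMn.
have -> : (1 - u) * (1 + u) = 1 - u ^+ 2 by ring.
have : 0 <= u ^+ 2 <= 1 by rewrite sqr_ge0 exprn_ile1.
by move=> /andP[h2 h3]; rewrite exprn_ile1 // ?subr_ge0 // gerBl.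
Qed.

Lemma nexp_cvg0 (r : R) : 0 <= r < 1 -> (fun n => n%:R * r ^+ n) @ \oo --> (0 : R).
Proof.
move=> /andP[r0 r1]; set s := Num.sqrt r.
have s0 : 0 <= s by exact: sqrtr_ge0.
have ss : s * s = r by rewrite -expr2 sqr_sqrtr.
have s1 : s < 1 by rewrite -sqrtr1 ltr_sqrt.
have key n : n%:R * s ^+ n * (1 - s) + s ^+ n <= 1.
  elim: n => [|n IH]; first by rewrite !mul0r add0r expr0.
  rewrite exprS -natr1.
  have h1 : s ^+ n <= 1 by rewrite exprn_ile1 // ltW.
  have h2 : 0 <= s ^+ n by rewrite exprn_ge0.
  have h3 : s * (n%:R * s ^+ n * (1 - s) + s ^+ n) <= s * 1 by rewrite ler_wpM2l.
  have h4 : (1 - s) * (s * s ^+ n) <= (1 - s) * 1.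
    by rewrite ler_wpM2l ?subr_ge0 ?mulr_ile1 // ltW.
  by lra.
have c0 : 0 < 1 - s by rewrite subr_gt0.
apply: (@squeeze_cvgr _ _ _ _ (fun=> 0) (fun n => (1 - s)^-1 * s ^+ n)).
- apply: nearW => n; rewrite mulr_ge0 ?exprn_ge0 //=.
  rewrite -ss exprMn mulrA ler_wpM2r ?exprn_ge0 // -[leRHS]mul1r ler_pdivlMr //.
  have h := key n; have h2 : 0 <= s ^+ n by rewrite exprn_ge0.
  by lra.
- exact: cvg_cst.
- rewrite -[X in _ --> X](mulr0 (1 - s)^-1); apply: cvgMr.
  by apply: cvg_expr; rewrite ger0_norm.
Qed.

Lemma threshold_cvg (s : R) : 0 <= s <= 1 ->
  (fun n => threshold n s) @ \oo --> ((s < 2^-1)%R%:R : R).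
Proof.
move=> s01; have /andP[s0 s1] := s01.
have un n : 0 <= s ^+ n <= 1 by rewrite exprn_ge0 // exprn_ile1.
have ku n : (n * 2 ^ n)%:R * s ^+ n = n%:R * (2 * s) ^+ n.
  by rewrite natrM natrX exprMn mulrA.
case: ltP => h.
  apply: (@squeeze_cvgr _ _ _ _ (fun n => 1 - n%:R * (2 * s) ^+ n) (fun=> 1)).
  - apply: nearW => n; rewrite -ku bernoulli_lower //=.
    by have /andP[] := threshold_bound n s01.
  - rewrite -[X in _ --> X](subr0 (1 : R)); apply: cvgB; first exact: cvg_cst.
    by apply: nexp_cvg0; lra.
  - exact: cvg_cst.
apply: (@squeeze_cvgr _ _ _ _ (fun=> 0) (@harmonic R)).
- apply: nearW => n; have /andP[h0 _] := threshold_bound n s01; rewrite h0 /=.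
  have := @bernoulli_upper (s ^+ n) (n * 2 ^ n) (un n); rewrite -/(threshold n s) ku => h1.
  have h2 : n%:R <= n%:R * (2 * s) ^+ n.
    by rewrite ler_peMr // exprn_ege1 //; lra.
  rewrite /harmonic /= -[X in _ <= X]mul1r ler_pdivlMr ?ltr0n // -natr1.
  by apply: le_trans h1; rewrite ler_wpM2l //; lra.
- exact: cvg_cst.
- exact: cvg_harmonic.
Qed.

Lemma nsq_real (a b : R) : nsq (a%:C%C - b%:C%C) = (a - b) ^+ 2.
Proof. by rewrite -rmorphB /= /nsq /= expr0n addr0. Qed.

Lemma cvg_nsq_real (u : nat -> R) (l : R) : u @ \oo --> l ->
  (fun n => nsq (l%:C%C - (u n)%:C%C)) @ \oo --> (0 : R).
Proof.
move=> h.
have h1 : (fun n => l - u n) @ \oo --> l - l by apply: cvgB => //; exact: cvg_cst.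
rewrite subrr in h1; have h2 := cvgM h1 h1; rewrite mulr0 in h2.
apply: cvg_trans (h2 _); apply: near_eq_cvg; apply: nearW => n.
by rewrite nsq_real expr2.
Qed.

Lemma cmeas_real (f : R -> R) : measurable_fun setT f -> cmeas (fun x => (f x)%:C%C).
Proof. by move=> mf; split => //; exact: measurable_cst. Qed.

Lemma integrable_cst1 (k : R) : mu.-integrable setT (EFin \o cst k).
Proof. exact: finite_measure_integrable_cst. Qed.

Section Dense.
Variable Lam : set R.
Hypothesis HLam : forall t, approx Lam (fun x => e2pi (t * x)).

Definition rapprox (f : R -> R) := approx Lam (fun x => (f x)%:C%C).

Lemma rapprox_meas (f : R -> R) : rapprox f -> measurable_fun setT f.
Proof. by case=> -[]. Qed.

Lemma rapprox_lim (g : nat -> R -> R) (f : R -> R) :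
  (forall n, rapprox (g n)) -> (forall x, 0 <= f x <= 1) -> (forall n x, 0 <= g n x <= 1) ->
  (forall x, (fun n => g n x) @ \oo --> f x) -> rapprox f.
Proof.
move=> hg hf hgb hc.
have mf : measurable_fun setT f.
  by apply: (@measurable_fun_cvg _ _ _ _ g) => // n; exact: rapprox_meas.
apply: (@approx_lim _ (fun n x => (g n x)%:C%C) _ (cst 1)) => //.
- exact: integrable_cst1.
- move=> n x; rewrite nsq_real /=; have /andP[a0 a1] := hf x; have /andP[b0 b1] := hgb n x.
  by nra.
- by move=> x; exact: cvg_nsq_real.
Qed.

Lemma rapprox_threshold k b : rapprox (fun x => (wave k b x < 2^-1)%R%:R).
Proof.
apply: (@rapprox_lim (fun n x => threshold n (wave k b x))).
- move=> n; apply: approx_trig => //.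
  have := trig_polyX (n * 2 ^ n) (trig_poly_1B (trig_polyX n (trig_poly_wave k b))).
  by congr (trig_poly _ _); apply/funext => x; rewrite /threshold rmorphXn rmorphB rmorphXn rmorph1.
- by move=> x; case: ltP => _; rewrite ?lexx ?ler01.
- by move=> n x; apply: threshold_bound; exact: wave_bound.
- by move=> x; apply: threshold_cvg; exact: wave_bound.
Qed.

(** The half line is the pointwise limit of the sets where a slower and slower
    wave is below [1 / 2]. *)
Lemma rapprox_line t : rapprox (fun x => (x < t)%R%:R).
Proof.
have pi0 := pi_gt0 R.
apply: (@rapprox_lim (fun m x => (wave m.+1%:R^-1 (- (m.+1%:R^-1 * t) - 4^-1) x < 2^-1)%R%:R)).
- by move=> n; exact: rapprox_threshold.
- by move=> x; case: ltP => _; rewrite ?lexx ?ler01.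
- by move=> n x; case: ltP => _; rewrite ?lexx ?ler01.
move=> x; apply: cvg_near_cst.
have [N hN] : exists N : nat, 2 * `|x - t| < N%:R.
  by exists (Num.bound (2 * `|x - t|)); by apply: archi_boundP; rewrite mulr_ge0.
exists N => // m /= Nm; congr ((_ : bool)%:R).
set k := (m.+1%:R^-1 : R).
have k0 : 0 < k by rewrite invr_gt0 ltr0n.
have kx : `|2 * (k * (x - t))| < 1.
  rewrite mulrCA normrM (gtr0_norm k0) mulrC ltr_pdivrMr ?ltr0n // mul1r.
  rewrite normrM normr_nat; apply: lt_trans hN _.
  by rewrite ltr_nat ltnS.
have e : cos (2 * pi * (k * x + (- (k * t) - 4^-1))) = sin (pi * (2 * (k * (x - t)))).
  by rewrite -[RHS]cosBpihalf; congr cos; field.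
rewrite /wave e; set y := 2 * (k * (x - t)) in kx *.
have ys : (x < t) = (y < 0).
  by rewrite /y pmulr_rlt0 // pmulr_rlt0 // subr_lt0.
rewrite ys; move: kx; rewrite ltr_norml => /andP[y1 y2].
have [yn|yp|->] := ltgtP y 0.
- have : 0 < sin (pi * - y).
    by apply: sin_gt0_pi; rewrite mulr_gt0 ?oppr_gt0 //= gtr_pMr //; lra.
  by rewrite mulrN sinN oppr_gt0 => h; apply/idP; lra.
- have : 0 < sin (pi * y).
    by apply: sin_gt0_pi; rewrite mulr_gt0 //= gtr_pMr //; lra.
  by move=> h; apply/negbTE; rewrite -leNgt; lra.
- by rewrite mulr0 sin0; apply/negbTE; rewrite -leNgt; lra.
Qed.

Lemma rapprox_indic_dynkin :
  dynkin [set A : set R | measurable A /\ rapprox (\1_A : R -> R)].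
Proof.
split.
- split; first exact: measurableT.
  have := HLam 0; congr approx; apply/funext => x.
  by rewrite mul0r e2pi0 indicE in_setT.
- move=> A [mA hA]; split; first exact: measurableC.
  have := approxD (approx_trig HLam (trig_poly_cst 1)) (approxZ (-1) hA).
  congr approx; apply/funext => x; rewrite !indicE in_setC mulN1r.
  by case: (x \in A); rewrite ?rmorph1 ?rmorph0 ?subr0 ?subrr.
- move=> F tF hF; split.
    by apply: bigcup_measurable => k _; have [] := hF k.
  have uniqF x i j : F i x -> F j x -> i = j.
    by move=> Fi Fj; apply: (tF i j I I); exists x.
  have sumF x n : \sum_(i < n) (\1_(F i) x : R) = (`[< exists2 i, (i < n)%N & F i x >])%:R.
    elim: n => [|n IH].
      by rewrite big_ord0; case: asboolP => // -[].
    rewrite big_ord_recr /= IH indicE; case: (boolP (x \in F n)) => [|/negP] Fn.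
      rewrite inE in Fn; rewrite asboolF; last first.
        by move=> [i ni Fi]; move: ni; rewrite (uniqF _ _ _ Fi Fn) ltnn.
      by rewrite add0r asboolT //; exists n.
    rewrite addr0; congr ((_ : bool)%:R); apply/asboolP/asboolP.
      by move=> [i ni Fi]; exists i => //; exact: ltnW.
    move=> [i ni Fi]; exists i => //; move: ni; rewrite ltnS leq_eqVlt => /orP[/eqP e|//].
    by exfalso; apply: Fn; rewrite inE -e.
  apply: (@rapprox_lim (fun n x => \sum_(i < n) (\1_(F i) x : R))).
  + move=> n; rewrite /rapprox.
    have := @approx_sum Lam _ (enum 'I_n) (fun (i : 'I_n) x => (\1_(F i) x : R)%:C%C)
      (fun i => (hF i).2).
    by congr approx; apply/funext => x; rewrite big_enum /= rmorph_sum.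
  + by move=> x; rewrite indicE; case: (_ \in _); rewrite ?lexx ?ler01.
  + by move=> n x; rewrite sumF; case: asboolP; rewrite ?lexx ?ler01.
  + move=> x; apply: cvg_near_cst; have [[k _ Fk]|nF] := pselect ((\bigcup_k F k) x).
      exists k.+1 => // n /= kn; rewrite sumF indicE mem_set; last by exists k.
      by rewrite asboolT //; exists k.
    apply: nearW => n; rewrite sumF indicE memNset //.
    by rewrite asboolF // => -[i _ Fi]; apply: nF; exists i.
Qed.

(** Half lines are stable under intersection and generate the Borel sets. *)
Lemma rapprox_indic (A : set R) : measurable A -> rapprox (\1_A : R -> R).
Proof.
move=> mA.
have cG : setI_closed (@RGenInftyO.G R).
  move=> _ _ [x ->] [y ->]; exists (Num.min x y).
  apply/seteqP; split => z /=; rewrite !in_itv /=.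
    by move=> [zx zy]; rewrite lt_min zx zy.
  by rewrite lt_min => /andP[].
have : <<s (@RGenInftyO.G R) >> A.
  exact: (eq_rect _ (fun X : set (set R) => X A) mA _ (RGenInftyO.measurableE R)).
rewrite -(setI_closed_g_dynkin_g_sigma_algebra cG) => /(_ _ (conj rapprox_indic_dynkin _)).
case=> // _ [x ->]; split; first exact: measurable_itv.
have := rapprox_line x; congr approx; apply/funext => y.
have -> // : (y < x)%R%:R = \1_(`]-oo, x[%classic) y :> R.
rewrite indicE; case: ltP => h; first by rewrite mem_set //= in_itv.
by rewrite memNset //= in_itv /= ltNge h.
Qed.

Import HBNNSimple.

Lemma rapprox_nnsfun (g : {nnsfun R >-> R}) : rapprox g.
Proof.
have := @approx_sum Lam _ (fset_set (range g)) (fun (y : R) x => (y%:C%C * ((\1_(g @^-1` [set y]) x : R)%:C)%C))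
   (fun y => approxZ y%:C%C (rapprox_indic (measurable_sfunP g (measurable_set1 y)))).
congr approx; apply/funext => x.
rewrite (fimfunE g x) fsbig_finite /=; last exact: fimfunP.
by rewrite rmorph_sum; apply: eq_bigr => y _; rewrite rmorphM.
Qed.

Lemma rapprox_ge0 (f : R -> R) : measurable_fun setT f -> (forall x, 0 <= f x) ->
  mu.-integrable setT (fun x => (f x ^+ 2)%:E) -> rapprox f.
Proof.
move=> mf f0 fi.
have mfE : measurable_fun setT (EFin \o f) by apply/measurable_EFinP.
pose g := nnsfun_approx measurableT mfE.
have gc x : (fun n => g n x) @ \oo --> f x.
  have /fine_cvgP[] : EFin \o (fun n => g n x) @ \oo --> (f x)%:E.
    by apply: (@cvg_nnsfun_approx _ _ _ _ measurableT _ mfE) => // y _; rewrite /= lee_fin.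
  by [].
have gf n x : g n x <= f x.
  have nd : nondecreasing_seq (fun n => g n x).
    by move=> m k mk; have /lefP := nd_nnsfun_approx measurableT mfE mk; exact.
  have := nondecreasing_cvgn_le nd (cvgP _ (gc x)) n.
  by rewrite (cvg_lim (@Rhausdorff R) (gc x)).
apply: (@approx_lim _ (fun n x => (g n x)%:C%C) _ (fun x => f x ^+ 2)) => //.
- by move=> n; exact: rapprox_nnsfun.
- move=> n x; rewrite nsq_real; have h1 := gf n x; have h2 : 0 <= g n x by [].
  by rewrite ler_sqr ?nnegrE ?subr_ge0 // gerBl.
- by move=> x; exact: cvg_nsq_real.
Qed.

Lemma rapprox_L2 (f : R -> R) : measurable_fun setT f ->
  mu.-integrable setT (fun x => (f x ^+ 2)%:E) -> rapprox f.
Proof.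
move=> mf fi.
have h (g : R -> R) : measurable_fun setT g -> (forall x, g x ^+ 2 <= f x ^+ 2) ->
    mu.-integrable setT (fun x => (g x ^+ 2)%:E).
  move=> mg hg; apply: le_integrable fi => //.
    by apply/measurable_EFinP; exact: measurable_funX.
  by move=> x _; rewrite !abse_EFin lee_fin !ger0_norm ?sqr_ge0.
have m1 : measurable_fun setT (fun x => Num.max (f x) 0).
  by apply: measurable_maxr => //; exact: measurable_cst.
have m2 : measurable_fun setT (fun x => Num.max (- f x) 0).
  apply: measurable_maxr; last exact: measurable_cst.
  exact: measurableT_comp.
have a1 : rapprox (fun x => Num.max (f x) 0).
  apply: rapprox_ge0 => //; first by move=> x; rewrite le_max lexx orbT.
  by apply: h => // x; rewrite /Num.max; case: ifP => _; rewrite ?lexx ?expr0n /= ?sqr_ge0.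
have a2 : rapprox (fun x => Num.max (- f x) 0).
  apply: rapprox_ge0 => //; first by move=> x; rewrite le_max lexx orbT.
  by apply: h => // x; rewrite /Num.max; case: ifP => _; rewrite ?sqrrN ?lexx ?expr0n /= ?sqr_ge0.
have := approxD a1 (approxZ (-1) a2); congr approx; apply/funext => x.
rewrite mulN1r -rmorphB; congr (_%:C)%C.
by rewrite /Num.max; case: ifPn; case: ifPn; lra.
Qed.

(** If the closed span of the exponentials with frequencies in [Lam] contains all
    the exponentials, it is stable under bounded pointwise limits of
    trigonometric polynomials.  It then contains indicators of half lines, hence
    of Borel sets, hence simple functions, hence everything. *)
Lemma approx_L2 (f : R -> R[i]) : cmeas f -> (E2 f < +oo)%E -> approx Lam f.
Proof.
move=> [mr mi] fi.
have h (g : R -> R) : measurable_fun setT g -> (forall x, g x ^+ 2 <= nsq (f x)) -> rapprox g.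
  move=> mg hg; apply: rapprox_L2 => //.
  apply: (@le_integrable _ _ _ mu setT measurableT _ (fun x => (nsq (f x))%:E)).
  - by apply/measurable_EFinP; exact: measurable_funX.
  - by move=> x _; rewrite !abse_EFin lee_fin !ger0_norm ?sqr_ge0 ?nsq_ge0.
  - apply/integrableP; split; first exact: measurable_nsqE.
    by under eq_integral do rewrite abse_EFin ger0_norm ?nsq_ge0 //.
have := approxD (h _ mr _) (approxZ 'i%C (h _ mi _)).
have -> : (fun x => ((complex.Re (f x))%:C + 'i * (complex.Im (f x))%:C)%C) = f.
  by apply/funext => x; rewrite -complexE.
by apply => x; rewrite /nsq ?lerDl ?lerDr sqr_ge0.
Qed.

End Dense.

End SquareIntegrals.

(** * Trigonometric polynomials and weak limits of uniform measures *)

Section TrigAverage.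
Variable R : realType.
Notation nrm := (@Normc.normc R).

Lemma avgE (X : seq R) (f : R -> R) :
  ((avg X f)%:C)%C = (\sum_(x <- X) ((f x)%:C)%C) / (size X)%:R.
Proof. by rewrite /avg rmorphM rmorph_sum fmorphV rmorph_nat. Qed.

Lemma conjM (u v : R[i]) : conjc (u * v) = conjc u * conjc v. Proof. exact: rmorphM. Qed.

Lemma conj_sum (I : Type) (r : seq I) (F : I -> R[i]) :
  conjc (\sum_(i <- r) F i) = \sum_(i <- r) conjc (F i).
Proof. exact: rmorph_sum. Qed.

Definition tsum (s : seq (R[i] * R)) (x : R) : R[i] := \sum_(k <- s) k.1 * e2pi (k.2 * x).

Lemma avg_nsq X (s : seq (R[i] * R)) :
  ((avg X (fun x => nsq (tsum s x)))%:C)%C =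
  \sum_(k <- s) \sum_(l <- s) k.1 * (l.1)^*%C * favg X (k.2 - l.2).
Proof.
rewrite avgE mulr_suml.
under [RHS]eq_bigr do under eq_bigr do rewrite /favg /fsum mulrA mulr_sumr mulr_suml.
under [RHS]eq_bigr do rewrite exchange_big.
rewrite [RHS]exchange_big; apply: eq_bigr => x _ /=.
rewrite nsqE /tsum conj_sum mulr_suml mulr_suml; apply: eq_bigr => k _.
rewrite mulr_sumr mulr_suml; apply: eq_bigr => l _.
by rewrite conjM -e2piNr mulrBl e2piD; ring.
Qed.

(** [F] stands for the transform of a measure for which the exponentials in [L]
    are orthonormal. *)
Lemma quad_orth (F : R -> R[i]) (L : seq R) (c : R -> R[i]) : uniq L -> F 0 = 1 ->
  {in L &, forall l m, l != m -> F (l - m) = 0} ->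
  \sum_(k <- L) \sum_(l <- L) c k * (c l)^*%C * F (k - l) = ((\sum_(k <- L) nsq (c k))%:C)%C.
Proof.
move=> uL F0 hF; rewrite rmorph_sum; apply: eq_big_seq => k kL.
rewrite (bigD1_seq k) //= subrr F0 mulr1 nsqE big_seq_cond big1 ?addr0 // => l.
by move=> /andP[lL lk]; rewrite hF ?mulr0 // eq_sym.
Qed.

(** The squared distance of the exponential with frequency [- t] to its
    orthogonal projection on the span of [L], see [bessel_dist]. *)
Lemma quad_dist (F : R -> R[i]) (L : seq R) (t : R) (c : R -> R[i]) : uniq L -> F 0 = 1 ->
  (forall x, F (- x) = conjc (F x)) -> (forall l, c l = - conjc (F (t + l))) ->
  {in L &, forall l m, l != m -> F (l - m) = 0} ->
  let s := (1 : R[i], - t) :: [seq (c l, l) | l <- L] in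
  \sum_(k <- s) \sum_(l <- s) k.1 * (l.1)^*%C * F (k.2 - l.2) =
  ((1 - \sum_(l <- L) nsq (F (t + l)))%:C)%C.
Proof.
move=> uL F0 FN hc hL /=; rewrite big_cons big_cons !big_map /=.
under [X in _ + X]eq_bigr do rewrite big_cons big_map /=.
have c1 : (1 -i* 0)%C = 1 :> R[i] by apply/eqP; rewrite eq_complex /= oppr0 !eqxx.
rewrite big_split /= (quad_orth c uL F0 hL) c1 subrr F0 !mulr1 rmorphB rmorph1.
have e1 : \sum_(l <- L) 1 * conjc (c l) * F (- t - l) = - ((\sum_(l <- L) nsq (F (t + l)))%:C)%C.
  rewrite rmorph_sum -sumrN; apply: eq_bigr => l _.
  rewrite /= nsqE mul1r -opprD FN hc.
  have -> : conjc (- conjc (F (t + l))) = - F (t + l) by rewrite (rmorphN conjc) /= conjcK.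
  by rewrite mulNr.
have e2 : \sum_(l <- L) c l * 1 * F (l - - t) = - ((\sum_(l <- L) nsq (F (t + l)))%:C)%C.
  rewrite rmorph_sum -sumrN; apply: eq_bigr => l _.
  by rewrite /= nsqE mulr1 opprK addrC hc mulNr mulrC.
have e3 : \sum_(k <- L) nsq (c k) = \sum_(l <- L) nsq (F (t + l)).
  apply: eq_bigr => l _; rewrite hc; case: (F _) => x y; rewrite /nsq /=.
  by rewrite opprK !sqrrN.
by rewrite e1 e2 e3; ring.
Qed.

Lemma avg_nsq_orth X (L : seq R) (c : R -> R[i]) : uniq L -> (0 < size X)%N ->
  {in L &, forall l m, l != m -> favg X (l - m) = 0} ->
  avg X (fun x => nsq (\sum_(l <- L) c l * e2pi (l * x))) = \sum_(l <- L) nsq (c l).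
Proof.
move=> uL X0 hL; apply: complexI.
rewrite -(quad_orth c uL (favg0 X0) hL).
have := avg_nsq X [seq (c l, l) | l <- L].
rewrite big_map; under [in RHS]eq_bigr do rewrite big_map.
move=> <-; congr (_%:C)%C; rewrite /avg; congr (_ / _); apply: eq_bigr => x _.
by rewrite /tsum big_map.
Qed.

End TrigAverage.

Section WeakLimit.
Variables (R : realType) (mu : probability R R) (X : nat -> seq R).
Notation nrm := (@Normc.normc R).
Hypothesis hX : forall N, (0 < size (X N))%N.
Hypothesis hw : forall f : R -> R, continuous f -> (exists M : R, forall x, `|f x| <= M) ->
  (fun N => avg (X N) f) @ \oo --> (\int[mu]_x f x : R).

(** The Fourier transform of [mu], with the sign of the exponent chosen so that
    it is the limit of [favg]. *)
Definition muhat t : R[i] := cintegral mu (fun x => e2pi (t * x)).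

Definition ccvg (u : nat -> R[i]) (z : R[i]) :=
  ((fun n => complex.Re (u n)) @ \oo --> (complex.Re z : R)) /\
  ((fun n => complex.Im (u n)) @ \oo --> (complex.Im z : R)).

Lemma ReM (u v : R[i]) : complex.Re (u * v) = complex.Re u * complex.Re v - complex.Im u * complex.Im v.
Proof. by case: u v => [x y] [z t]. Qed.
Lemma ImM (u v : R[i]) : complex.Im (u * v) = complex.Re u * complex.Im v + complex.Im u * complex.Re v.
Proof. by case: u v => [x y] [z t]. Qed.
Lemma ImD (u v : R[i]) : complex.Im (u + v) = complex.Im u + complex.Im v.
Proof. by case: u v => [x y] [z t]. Qed.

Lemma ccvg_cst z : ccvg (fun=> z) z. Proof. by split; exact: cvg_cst. Qed.

Lemma ccvgD u v z t : ccvg u z -> ccvg v t -> ccvg (fun n => u n + v n) (z + t).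
Proof.
move=> [u1 u2] [v1 v2]; split; rewrite ?ReD ?ImD.
  by under eq_fun do rewrite ReD; exact: cvgD.
by under eq_fun do rewrite ImD; exact: cvgD.
Qed.

Lemma ccvgM u v z t : ccvg u z -> ccvg v t -> ccvg (fun n => u n * v n) (z * t).
Proof.
move=> [u1 u2] [v1 v2]; split; rewrite ?ReM ?ImM.
  by under eq_fun do rewrite ReM; apply: cvgB; exact: cvgM.
by under eq_fun do rewrite ImM; apply: cvgD; exact: cvgM.
Qed.

Lemma ccvg_sum (I : Type) (r : seq I) (u : I -> nat -> R[i]) (z : I -> R[i]) :
  (forall i, ccvg (u i) (z i)) ->
  ccvg (fun n => \sum_(i <- r) u i n) (\sum_(i <- r) z i).
Proof.
move=> h; elim: r => [|i r IH].
  by rewrite big_nil; under eq_fun do rewrite big_nil; exact: ccvg_cst.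
by rewrite big_cons; under eq_fun do rewrite big_cons; exact: ccvgD.
Qed.

Lemma Re_favg (Y : seq R) t : complex.Re (favg Y t) = avg Y (fun x => cos (2 * pi * (t * x))).
Proof.
rewrite /favg /avg -(rmorph_nat (real_complex R)) -fmorphV ReM /= mulr0 subr0.
by congr (_ * _); rewrite /fsum Re_sum.
Qed.

Lemma Im_favg (Y : seq R) t : complex.Im (favg Y t) = avg Y (fun x => sin (2 * pi * (t * x))).
Proof.
rewrite /favg /avg -(rmorph_nat (real_complex R)) -fmorphV ImM /= mulr0 add0r.
congr (_ * _); rewrite /fsum; elim: Y => [|y Y IH]; first by rewrite !big_nil.
by rewrite !big_cons ImD IH.
Qed.

Lemma favg_cvg t : ccvg (fun N => favg (X N) t) (muhat t).
Proof.
split.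
  under eq_fun do rewrite Re_favg; apply: hw; first exact: continuous_cos_e2pi.
  by exists 1 => x; rewrite ler_norml cos_geN1 cos_le1.
under eq_fun do rewrite Im_favg; apply: hw; first exact: continuous_sin_e2pi.
by exists 1 => x; rewrite ler_norml sin_geN1 sin_le1.
Qed.

Lemma ccvg_nsq u z : ccvg u z -> (fun n => nsq (u n)) @ \oo --> nsq z.
Proof.
by move=> [h1 h2]; rewrite /nsq; apply: cvgD; rewrite expr2; under eq_fun do rewrite expr2; exact: cvgM.
Qed.

Lemma muhat_nsq_cvg t : (fun N => nsq (favg (X N) t)) @ \oo --> nsq (muhat t).
Proof. exact: ccvg_nsq (favg_cvg t). Qed.

Lemma ccvg_uniq u z t : ccvg u z -> ccvg u t -> z = t.
Proof.
move=> [h1 h2] [h3 h4]; apply/eqP; rewrite eq_complex.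
by rewrite (cvg_unique _ h1 h3) // (cvg_unique _ h2 h4) // !eqxx.
Qed.

Lemma muhat0 : muhat 0 = 1.
Proof.
apply: ccvg_uniq (favg_cvg 0) _; under eq_fun do rewrite favg0 //; exact: ccvg_cst.
Qed.

Lemma muhatN t : muhat (- t) = (muhat t)^*%C.
Proof.
apply: ccvg_uniq (favg_cvg (- t)) _.
have [h1 h2] := favg_cvg t.
have e N : favg (X N) (- t) = (favg (X N) t)^*%C.
  by rewrite /favg fsumN rmorphM fmorphV rmorph_nat.
split; under eq_fun do rewrite e.
  have -> : complex.Re (muhat t)^*%C = complex.Re (muhat t) by case: (muhat t).
  have e1 (z : R[i]) : complex.Re (z^*)%C = complex.Re z by case: z.
  by under eq_fun do rewrite e1.
have -> : complex.Im (muhat t)^*%C = - complex.Im (muhat t) by case: (muhat t).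
have e2 (z : R[i]) : complex.Im (z^*)%C = - complex.Im z by case: z.
by under eq_fun do rewrite e2; exact: cvgN.
Qed.

Lemma continuous_sumr (I : Type) (r : seq I) (F : I -> R -> R) :
  (forall i, continuous (F i)) -> continuous (fun x => \sum_(i <- r) F i x).
Proof.
move=> hF; elim: r => [|i r IH].
  have -> : (fun x => \sum_(i <- [::]) F i x) = fun=> 0 by apply/funext => x; rewrite big_nil.
  by move=> x; exact: cvg_cst.
have -> : (fun x => \sum_(j <- i :: r) F j x) = fun x => F i x + \sum_(j <- r) F j x.
  by apply/funext => x; rewrite big_cons.
by move=> x; apply: cvgD; [exact: hF|exact: IH].
Qed.

Lemma continuous_tsum (s : seq (R[i] * R)) :
  continuous (fun x => complex.Re (tsum s x)) /\ continuous (fun x => complex.Im (tsum s x)).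
Proof.
have e1 : (fun x => complex.Re (tsum s x)) = fun x => \sum_(k <- s)
    (complex.Re k.1 * cos (2 * pi * (k.2 * x)) - complex.Im k.1 * sin (2 * pi * (k.2 * x))).
  by apply/funext => x; rewrite /tsum Re_sum; apply: eq_bigr => k _; rewrite ReM.
have e2 : (fun x => complex.Im (tsum s x)) = fun x => \sum_(k <- s)
    (complex.Re k.1 * sin (2 * pi * (k.2 * x)) + complex.Im k.1 * cos (2 * pi * (k.2 * x))).
  apply/funext => x; rewrite /tsum; elim: s {e1} => [|k s IH]; first by rewrite !big_nil.
  by rewrite !big_cons ImD IH ImM.
split.
  rewrite e1; apply: continuous_sumr => k x.
  by apply: cvgB; apply: cvgMr; [exact: continuous_cos_e2pi|exact: continuous_sin_e2pi].
rewrite e2; apply: continuous_sumr => k x.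
by apply: cvgD; apply: cvgMr; [exact: continuous_sin_e2pi|exact: continuous_cos_e2pi].
Qed.

Lemma nsq_tsum_bounded (s : seq (R[i] * R)) : exists M : R, forall x, `|nsq (tsum s x)| <= M.
Proof.
exists ((\sum_(k <- s) nrm k.1) ^+ 2) => x.
rewrite ger0_norm ?nsq_ge0 // -nrm_sqr ler_sqr ?nnegrE ?nrm_ge0 ?sumr_ge0 //; last first.
  by move=> k _; exact: nrm_ge0.
apply: le_trans (nrm_sum _ _) _; apply: ler_sum => k _.
by rewrite Normc.normcM nrm_e2pi mulr1.
Qed.

Lemma continuous_nsq (f : R -> R[i]) : continuous (fun x => complex.Re (f x)) ->
  continuous (fun x => complex.Im (f x)) -> continuous (fun x => nsq (f x)).
Proof.
move=> h1 h2 x; rewrite /nsq; apply: cvgD; rewrite expr2; under eq_fun do rewrite expr2.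
  by apply: cvgM; exact: h1.
by apply: cvgM; exact: h2.
Qed.

Lemma E2_Rintegral (f : R -> R[i]) : cmeas f -> (exists M : R, forall x, `|nsq (f x)| <= M) ->
  E2 mu f = (\int[mu]_x nsq (f x))%:E.
Proof.
move=> mf [M hM]; rewrite /Rintegral fineK //.
apply: integrable_fin_num => //.
apply: (@le_integrable _ _ _ mu setT measurableT _ (EFin \o cst M)).
- exact: measurable_nsqE.
- by move=> x _; rewrite !abse_EFin lee_fin (le_trans (hM x)) // ler_norm.
- exact: integrable_cst1.
Qed.

Lemma nsq_tsum_cvg s : (fun N => avg (X N) (fun x => nsq (tsum s x))) @ \oo -->
  \int[mu]_x nsq (tsum s x).
Proof.
apply: hw; last exact: nsq_tsum_bounded.
by apply: continuous_nsq; have [] := continuous_tsum s.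
Qed.

Lemma quad_muhat s : ((\int[mu]_x nsq (tsum s x))%:C)%C =
  \sum_(k <- s) \sum_(l <- s) k.1 * (l.1)^*%C * muhat (k.2 - l.2).
Proof.
apply: (@ccvg_uniq (fun N => ((avg (X N) (fun x => nsq (tsum s x)))%:C)%C)).
  by split => /=; [exact: nsq_tsum_cvg|exact: cvg_cst].
under eq_fun do rewrite avg_nsq.
apply: ccvg_sum => k; apply: ccvg_sum => l; apply: ccvgM; first exact: ccvg_cst.
exact: favg_cvg.
Qed.

Lemma cmeas_tsum (s : seq (R[i] * R)) : cmeas (tsum s).
Proof. by apply: cmeas_sum => k; apply: cmeasM; [exact: cmeas_cst|exact: cmeas_e2pi]. Qed.

Lemma bessel_dist (L : seq R) (t : R) : uniq L ->
  {in L &, forall l m, l != m -> muhat (l - m) = 0} ->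
  E2 mu (fun x => e2pi (- t * x) - \sum_(l <- L) (muhat (t + l))^*%C * e2pi (l * x))%R =
  (1 - \sum_(l <- L) nsq (muhat (t + l)))%:E.
Proof.
move=> uL hL; pose c l := - (muhat (t + l))^*%C.
pose s := (1 : R[i], - t) :: [seq (c l, l) | l <- L].
have -> : (fun x => e2pi (- t * x) - \sum_(l <- L) (muhat (t + l))^*%C * e2pi (l * x)) = tsum s.
  apply/funext => x; rewrite /tsum big_cons big_map /= mul1r; congr (_ + _).
  by rewrite -sumrN; apply: eq_bigr => l _; rewrite /c mulNr.
rewrite E2_Rintegral; [|exact: cmeas_tsum|exact: nsq_tsum_bounded].
congr EFin; apply: complexI; rewrite quad_muhat.
by apply: quad_dist => //; [exact: muhat0|exact: muhatN].
Qed.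

Lemma L2inner_e2pi l m : L2inner mu (fourier_exp l) (fourier_exp m) = muhat (l - m).
Proof.
rewrite /L2inner /muhat /cintegral.
by congr Complex; apply: eq_Rintegral => x _; rewrite !fourier_expE -e2piNr -e2piD mulrBl.
Qed.

End WeakLimit.

(** * The finite stages of the convolution and lower bounds for the tails *)

Section GeometricSums.
Variable R : realType.

Lemma ler_sum_subset (T : eqType) (S S' : seq T) (F : T -> R) : uniq S ->
  {subset S <= S'} -> (forall x, 0 <= F x) -> \sum_(x <- S) F x <= \sum_(x <- S') F x.
Proof.
elim: S S' => [|x S IH] S' /=; first by move=> _ _ F0; rewrite big_nil sumr_ge0.
move=> /andP[xS uS] sub F0.
have xS' : x \in S' by apply: sub; rewrite inE eqxx.
rewrite big_cons (perm_big _ (perm_to_rem xS')) /= big_cons lerD2l; apply: IH => //.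
move=> y yS; have : y \in S' by apply: sub; rewrite inE yS orbT.
rewrite (perm_mem (perm_to_rem xS')) inE => /orP[/eqP e|//].
by move: xS; rewrite -e yS.
Qed.

Lemma sum_pow_iota J k : \sum_(n <- iota J k) (2 ^+ n)^-1 <= 2 / 2 ^+ J :> R.
Proof.
have h : \sum_(n <- iota J k) (2 ^+ n)^-1 = 2 / 2 ^+ J - 2 / 2 ^+ (J + k) :> R.
  elim: k => [|k IH]; first by rewrite big_nil addn0 subrr.
  rewrite -addn1 iotaD big_cat IH /= big_seq1 addnA addn1 exprS.
  have u0 : (2 : R) ^+ (J + k) != 0 by rewrite expf_neq0.
  have v0 : (2 : R) ^+ J != 0 by rewrite expf_neq0.
  by move: (2 ^+ (J + k)) (2 ^+ J) u0 v0 => u v u0 v0; field; rewrite u0 v0.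
by rewrite h gerBl divr_ge0 ?exprn_ge0.
Qed.

Lemma sum_pow S J : uniq S -> (forall n, n \in S -> (J <= n)%N) ->
  \sum_(n <- S) (2 ^+ n)^-1 <= 2 / 2 ^+ J :> R.
Proof.
move=> uS hS.
apply: le_trans (sum_pow_iota J (\max_(n <- S) n).+1); apply: ler_sum_subset => //.
  move=> n nS; rewrite mem_iota hS //=.
  by have := @leq_bigmax_seq _ S xpredT id n nS isT; move=> /= h; lia.
Qed.

End GeometricSums.

Section Moran.
Variables (R : realType) (q d : nat -> nat) (p Q : nat -> int) (C : nat).
Hypothesis hq : forall n, q n = 2%N \/ q n = 3%N.
Hypothesis hd : forall n, (0 < d n <= C)%N.
Hypothesis hQ0 : forall n, Q n != 0.
Hypothesis hQS : forall n, Q n.+1 = Q n * p n.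
Variables (a be ga : nat -> int).
Hypothesis hbe : forall n, q n = 2%N -> be n = 1 \/ be n = -1.
Hypothesis hga : forall n, q n = 3%N -> coprimez (be n) (ga n).
Variable Mb : nat.
Notation digits := (digits q d a be ga).
Notation factor := (factor R q d Q a be ga).
Notation nrm := (@Normc.normc R).
Hypothesis hMb : forall n x, x \in digits n -> `|x| <= Mb%:Z.
Hypothesis hpd : forall n x y, x \in digits n -> y \in digits n -> `|x - y| <= `|p n| - 1.

Definition points (S : seq nat) : seq R := foldr (fun n X => sumset (factor n) X) [:: 0] S.

(** The Fourier transform of the convolution of the factors in [S]. *)
Definition ft S t : R[i] := favg (points S) t.

Lemma favg_one t : favg [:: 0 : R] t = 1.
Proof. by rewrite /favg /fsum big_seq1 mulr0 e2pi0 divr1. Qed.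

Lemma ftE S t : ft S t = \prod_(n <- S) favg (factor n) t.
Proof.
elim: S => [|n S IH]; first by rewrite big_nil /ft favg_one.
by rewrite big_cons -IH /ft /= favg_sumset.
Qed.

Lemma size_points S : size (points S) = \prod_(n <- S) q n.
Proof.
elim: S => [|n S IH]; first by rewrite big_nil.
by rewrite big_cons -IH /= size_allpairs size_factor.
Qed.

Lemma size_points_gt0 S : (0 < size (points S))%N.
Proof.
by rewrite size_points prodn_gt0 // => n; exact: q_gt0.
Qed.

Lemma ft_cat S S' t : ft (S ++ S') t = ft S t * ft S' t.
Proof. by rewrite !ftE big_cat. Qed.

Lemma nrm_ft_le1 S t : nrm (ft S t) <= 1. Proof. exact: nrm_favg_le1. Qed.

Lemma nsq_ft_le1 S t : nsq (ft S t) <= 1.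
Proof. by rewrite -nrm_sqr expr_le1 ?nrm_ge0 // nrm_ft_le1. Qed.

Lemma ft0 S : ft S 0 = 1. Proof. by rewrite /ft favg0 // size_points_gt0. Qed.

Hypothesis hp2 : forall n, 2 <= `|p n|.

Notation QR n := (`|(Q n)%:~R| : R).

Lemma p_ge2 n : 2 <= `|(p n)%:~R| :> R.
Proof. by have := hp2 n; rewrite -(ler_int R) intr_norm. Qed.

Lemma QR_gt0 n : 0 < QR n. Proof. by rewrite normr_gt0 intr_eq0. Qed.

Lemma QRS n : QR n.+1 = QR n * `|(p n)%:~R|.
Proof. by rewrite hQS rmorphM normrM. Qed.

Lemma Q_growth m n : (m <= n)%N -> 2 ^+ (n - m) * QR m <= QR n.
Proof.
move=> /subnKC <-; rewrite addKn; elim: (n - m)%N => [|k IH].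
  by rewrite expr0 mul1r addn0.
rewrite addnS QRS exprS -mulrA mulrC.
by apply: ler_pM => //; rewrite ?mulr_ge0 ?exprn_ge0 // p_ge2.
Qed.

Hypothesis hQ00 : Q 0 = 1.

Lemma Q_pow n : 2 ^+ n <= QR n.
Proof. by have := @Q_growth 0 n isT; rewrite subn0 hQ00 normr1 mulr1. Qed.

Lemma factor_bound n x : x \in factor n -> `|x| <= Mb%:R / 2 ^+ n.+1.
Proof.
move=> /mapP[z zd ->]; rewrite normrM normfV.
have h1 : `|z%:~R| <= Mb%:R :> R by have := hMb zd; rewrite -(ler_int R) intr_norm.
by apply: ler_pM => //; rewrite ?invr_ge0 // lef_pV2 ?posrE ?QR_gt0 ?exprn_gt0 // Q_pow.
Qed.

Lemma factor_lip n x y : nrm (favg (factor n) x - favg (factor n) y) <= pi * Mb%:R * `|x - y| / 2 ^+ n.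
Proof.
have h := @favg_lip R (factor n) (Mb%:R / 2 ^+ n.+1) x y _ (@factor_bound n).
apply: le_trans (h _) _; first by rewrite divr_ge0 ?exprn_ge0.
rewrite exprS le_eqVlt; apply/orP; left; apply/eqP; field.
by rewrite expf_neq0.
Qed.

Lemma ft_lip S J x y : uniq S -> (forall n, n \in S -> (J <= n)%N) ->
  nrm (ft S x - ft S y) <= 2 * pi * Mb%:R * `|x - y| / 2 ^+ J.
Proof.
move=> uS hS; rewrite !ftE.
apply: le_trans (nrm_prodB _ _ _) _; try by move=> n; exact: nrm_favg_le1.
apply: (@le_trans _ _ (\sum_(n <- S) pi * Mb%:R * `|x - y| / 2 ^+ n)).
  by apply: ler_sum => n _; exact: factor_lip.
rewrite -mulr_sumr.
have h : 0 <= pi * Mb%:R * `|x - y| by rewrite !mulr_ge0 // pi_ge0.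
apply: le_trans (ler_wpM2l h (sum_pow R uS hS)) _.
by rewrite le_eqVlt; apply/orP; left; apply/eqP; ring.
Qed.

Lemma ft_near1 S J x : uniq S -> (forall n, n \in S -> (J <= n)%N) ->
  nrm (ft S x - 1) <= 2 * pi * Mb%:R * `|x| / 2 ^+ J.
Proof.
move=> uS hS; rewrite -(ft0 S) -[x in `|x|]subr0; exact: ft_lip.
Qed.

(** The midpoint of the extreme points. *)
Lemma centre (X : seq R) (r : R) : (forall x y, x \in X -> y \in X -> `|x - y| <= r) ->
  exists m, forall x, x \in X -> `|x - m| <= r / 2.
Proof.
have [->|X0] := eqVneq X [::]; first by exists 0.
move=> h.
have argm (f : R -> R) (s : seq R) : s != [::] ->
    exists2 x, x \in s & forall y, y \in s -> f x <= f y.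
  elim: s => // x [|y s] IH _.
    by exists x; rewrite ?inE // => z; rewrite inE => /eqP ->.
  have [//|g gG hg] := IH.
  have [l|l] := leP (f x) (f g).
    exists x; first by rewrite inE eqxx.
    by move=> z; rewrite inE => /orP[/eqP -> //|/hg]; exact: le_trans.
  exists g; first by rewrite inE gG orbT.
  by move=> z; rewrite inE => /orP[/eqP ->|/hg //]; exact: ltW.
have [m1 m1X h1] := argm id X X0; have [m2 m2X h2] := argm -%R X X0.
exists ((m1 + m2) / 2) => x xX.
have := h m2 m1 m2X m1X; have := h1 x xX; have := h2 x xX.
rewrite !ler_norml; lra.
Qed.

(* The smaller of [`|p n| - 1] and [2 * Mb] is at most [(1 - io) * `|p n|]. *)
Let io : R := (2 * Mb%:R + 2)^-1.
Let rho : R := 2^-1 - io / 4.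

Lemma io_bound : 0 < io <= 2^-1.
Proof.
have M0 : 0 <= Mb%:R :> R by [].
rewrite /io invr_gt0 lef_pV2 ?posrE; lra.
Qed.

(** The range of the digits is at most [`|p n| - 1] and bounded, which leaves a
    margin proportional to [`|p n|]. *)
Lemma factor_range n x y : x \in factor n -> y \in factor n ->
  `|x - y| <= (1 - io) * `|(p n)%:~R| / QR n.+1.
Proof.
move=> /mapP[z zd ->] /mapP[t td ->]; rewrite -mulrBl normrM normfV.
rewrite ler_wpM2r ?invr_ge0 // -rmorphB /= -!intr_norm.
have h1 := hpd zd td; have h2 := hMb zd; have h3 := hMb td.
have {}h1 : `|z - t|%:~R <= `|p n|%:~R - 1 :> R.
  by rewrite -(rmorphB _ _ 1) ler_int.
have h4 : `|z - t|%:~R <= 2 * Mb%:R :> R.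
  have : (`|z - t| <= (2 * Mb)%N%:Z)%R by lia.
  by rewrite -(ler_int R) -pmulrn natrM.
have [i0 i1] := andP io_bound.
have M0 : 0 <= Mb%:R :> R by [].
have e : io * (2 * Mb%:R + 2) = 1 by rewrite mulVf // gt_eqF //; lra.
have [h|h] := leP (`|p n|%:~R : R) (2 * Mb%:R + 2).
  have : io * `|p n|%:~R <= io * (2 * Mb%:R + 2) by rewrite ler_wpM2l // ltW.
  by lra.
have : (1 - io) * (2 * Mb%:R + 2) <= (1 - io) * `|p n|%:~R.
  by rewrite ler_wpM2l // ?subr_ge0 ?(le_trans i1) ?ltW //; lra.
by lra.
Qed.

(** By [favg_cos], factor [T + i] is at least the cosine of an angle at most
    [th / 2 ^+ i], where [th < pi / 2] thanks to the margin of [factor_range]; the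
    product of these cosines is bounded below by [prod_cos_half]. *)
Lemma tail_lower : exists2 c0 : R, 0 < c0 & forall T k y,
  `|y| <= QR T * (rho / (1 - io)) -> c0 <= nrm (ft (iota T k) y).
Proof.
have [i0 i1] := andP io_bound; have pi0 := pi_gt0 R.
have r0 : 0 < rho by rewrite /rho; lra.
have r1 : rho < 2^-1 by rewrite /rho; lra.
set th := pi * rho.
have th0 : 0 < th by rewrite mulr_gt0.
have th1 : th < pi / 2 by rewrite /th ltr_pM2l.
exists (sin (2 * th) / (2 * th)).
  by rewrite divr_gt0 ?mulr_gt0 //; apply: sin_gt0_pi; rewrite mulr_gt0 //=; lra.
move=> T k y hy.
apply: le_trans (@prod_cos_half R th k _) _; first by rewrite th0.
have -> : iota T k = [seq (T + i)%N | i <- iota 0 k] by rewrite -iotaDl addn0.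
rewrite ftE big_map nrm_prod -[k in iota 0 k]subn0 -/(index_iota 0 k) big_mkord.
apply: ler_prod => i _; set n := (T + i)%N.
have pw : 1 <= (2 : R) ^+ i by rewrite exprn_ege1 // ler1n.
have pw0 : 0 < (2 : R) ^+ i by rewrite exprn_gt0.
have h4 : th / 2 ^+ i <= th by rewrite ler_pdivrMr // ler_peMr // ltW.
have h3 : 0 <= th / 2 ^+ i by rewrite divr_ge0 ?ltW.
apply/andP; split; first by apply: cos_ge0_pihalf; apply/andP; split; lra.
have [m hm] := centre (@factor_range n).
set r := (1 - io) * _ / _ in hm.
have rr0 : 0 <= r by rewrite /r !mulr_ge0 ?invr_ge0 //; lra.
have ry : r * `|y| <= rho / 2 ^+ i.
  have -> : r = (1 - io) / QR n.
    by rewrite /r QRS; field; rewrite !normr_eq0 !intr_eq0 hQ0 /= -(intr_eq0 R) -normr_gt0 (lt_le_trans _ (p_ge2 n)).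
  have g := @Q_growth T n (leq_addr _ _); rewrite /n addKn -/n in g.
  have i2 : 0 < 1 - io by lra.
  rewrite mulrAC ler_pdivrMr ?QR_gt0 //.
  apply: (@le_trans _ _ ((1 - io) * (QR T * (rho / (1 - io))))).
    by rewrite ler_wpM2l // ltW.
  have -> : (1 - io) * (QR T * (rho / (1 - io))) = rho / 2 ^+ i * (2 ^+ i * QR T).
    by field; rewrite !gt_eqF.
  by rewrite ler_wpM2l // divr_ge0 // ltW.
have rh : rho / 2 ^+ i <= rho by rewrite ler_pdivrMr // ler_peMr // ltW.
have h0 : (0 < size (factor n))%N by rewrite size_factor // q_gt0.
apply: le_trans (@favg_cos R (factor n) m r y h0 rr0 hm _); last by lra.
have hh : pi * (r * `|y|) <= th / 2 ^+ i by rewrite /th -mulrA ler_wpM2l // ltW.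
have hh0 : 0 <= pi * (r * `|y|) := mulr_ge0 (ltW pi0) (mulr_ge0 rr0 (normr_ge0 y)).
rewrite leNgt; apply/negP => hlt.
have : pi * (r * `|y|) < th / 2 ^+ i \/ pi * (r * `|y|) = th / 2 ^+ i.
  by move: hh; rewrite le_eqVlt => /orP[/eqP|]; tauto.
case=> [h|e]; last by rewrite e ltxx in hlt.
have : cos (th / 2 ^+ i) < cos (pi * (r * `|y|)).
  by rewrite ltr_cos // in_itv /= ?hh0 ?h3 /=; lra.
by move/(lt_trans hlt); rewrite ltxx.
Qed.

(** The point is that [r] exceeds [1/2]: frequencies are reduced to absolute value
    at most [`|Q T| / 2], and a fixed translation must still be allowed. *)
Lemma tail_bound : exists c0 r : R, [/\ 0 < c0, 2^-1 < r & forall T k y,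
  `|y| <= QR T * r -> c0 <= nrm (ft (iota T k) y)].
Proof.
have [c0 c0p h] := tail_lower; exists c0, (rho / (1 - io)); split => //.
have [i0 i1] := andP io_bound.
by rewrite ltr_pdivlMr ?subr_gt0 ?(le_lt_trans i1) ?invf_lt1 ?ltr1n // /rho; lra.
Qed.

End Moran.

(** * Sufficiency: construction of a spectrum *)

Section Sufficiency.
Variables (R : realType) (q d : nat -> nat) (p Q : nat -> int) (C : nat).
Hypothesis hq : forall n, q n = 2%N \/ q n = 3%N.
Hypothesis hd : forall n, (0 < d n <= C)%N.
Hypothesis hQ0 : forall n, Q n != 0.
Hypothesis hQS : forall n, Q n.+1 = Q n * p n.
Variables (a be ga : nat -> int).
Hypothesis hbe : forall n, q n = 2%N -> be n = 1 \/ be n = -1.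
Hypothesis hga : forall n, q n = 3%N -> coprimez (be n) (ga n).
Variable Mb : nat.
Notation digits := (digits q d a be ga).
Notation factor := (factor R q d Q a be ga).
Notation ft := (@ft R q d Q a be ga).
Notation points := (@points R q d Q a be ga).
Notation lattice := (@lattice R d Q).
Notation zset := (@zset R q d Q).
Notation zsetS := (@zsetS R q d Q).
Notation orthog := (@orthog R q d Q).
Notation early := (early q d Q).
Notation nrm := (@Normc.normc R).
Notation QR n := (`|(Q n)%:~R| : R).
Hypothesis hMb : forall n x, x \in digits n -> `|x| <= Mb%:Z.
Hypothesis hpd : forall n x y, x \in digits n -> y \in digits n -> `|x - y| <= `|p n| - 1.
Hypothesis hp2 : forall n, 2 <= `|p n|.
Hypothesis hQ00 : Q 0 = 1.
Hypothesis hres : forall n, resid q be ga n.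
Hypothesis harr : forall m n, m <> n -> arrow q d Q m n \/ arrow q d Q n m.

Lemma ft_zsetS S x : zsetS S x -> ft S x = 0.
Proof.
move=> [n nS hz]; rewrite ftE (perm_big _ (perm_to_rem nS)) big_cons /=.
suff -> : favg (factor n) x = 0 by rewrite mul0r.
by apply/(factor_zero hq hd hQ0 _ hbe hga).
Qed.

(** Parseval's identity for the convolution of the factors in [S]. *)
Lemma sum_ft S L t : orthog S L -> size L = \prod_(n <- S) q n ->
  \sum_(l <- L) nsq (ft S (t + l)) = 1.
Proof.
move=> oL sL; apply: unitary; first by rewrite size_points.
  exact: size_points_gt0.
rewrite size_points // -sL => i j iL jL ij.
suff h : zsetS S (L`_i - L`_j).
  have := ft_zsetS h; rewrite /ft /favg => /eqP; rewrite mulf_eq0 => /orP[/eqP //|].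
  by rewrite invr_eq0 (negPf (natC_neq0 _ _)) // size_points_gt0.
have /(pairwiseP 0) P := oL.
have [lt|lt|//] := ltngtP i j; first by apply/asboolP; exact: P.
by rewrite -opprB; apply: zsetSN; apply/asboolP; exact: P.
Qed.

Lemma nsq_ft_lattice S x y : (forall n, n \in S -> lattice n y) -> nsq (ft S (x + y)) = nsq (ft S x).
Proof.
move=> hy; rewrite -!nrm_sqr !ftE !nrm_prod; congr (_ ^+ 2).
by apply: eq_big_seq => n nS; apply: nrm_favg_lattice => //; exact: hy.
Qed.

Lemma zset_neq0 n : ~ zset n 0.
Proof.
move=> [z [hz /eqP]]; rewrite eq_sym mulf_eq0 intr_eq0 => /orP[/eqP z0|].
  by move: hz; rewrite z0 dvdz0.
by rewrite mulf_eq0 (negPf (period_neq0 R hd hQ0 n)) invr_eq0 (negPf (qR_neq0 R hq n)).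
Qed.

Lemma orthog_uniq S L : orthog S L -> uniq L.
Proof.
rewrite uniq_pairwise; apply: sub_pairwise => x y /asboolP h /=.
by apply/eqP => e; move: h; rewrite e subrr => -[n _]; exact: zset_neq0.
Qed.

Definition done T := [seq j <- iota 0 T | `[< early T j >]].
Definition late T := [seq j <- iota 0 T | ~~ `[< early T j >]].

Lemma mem_done T j : (j \in done T) = `[< early T j >].
Proof.
rewrite mem_filter mem_iota; case: asboolP => //= -[h _]; exact: h.
Qed.

Lemma mem_late T j : (j \in late T) = (j < T)%N && ~~ `[< early T j >].
Proof. by rewrite mem_filter mem_iota andbC. Qed.

Lemma iota_perm T : perm_eq (iota 0 T) (done T ++ late T).
Proof. by rewrite perm_sym; exact: permEl (perm_filterC _ _). Qed.

(** There are at most [2 * C.+1] late factors, of size at most 3. *)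
Let cV : R := (9%:R ^+ C.+1)^-1.

Lemma cV_le : cV <= 9%:R^-1.
Proof. by rewrite lef_pV2 ?posrE ?exprn_gt0 // exprS ler_peMr // exprn_ege1 // ler1n. Qed.

Lemma prod_late T : (\prod_(n <- late T) q n <= 9 ^ C.+1)%N.
Proof.
apply: (@leq_trans (3 ^ size (late T))).
  elim: (late T) => [|n S IH]; first by rewrite big_nil.
  rewrite big_cons /= expnS leq_mul //; by case: (hq n) => ->.
rewrite (_ : 9 = 3 ^ 2)%N // -expnM leq_exp2l //.
apply: (late_size hq hd hQ0 hQS harr (T := T)).
  by rewrite filter_uniq // iota_uniq.
by move=> j; rewrite mem_late => /andP[h /asboolPn].
Qed.

(** An orthogonal basis of frequencies for the early factors below [T], reduced
    modulo [Q T], on which the late factors are bounded below; [k] measures how far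
    the late factors are. *)
Definition stage T (L : seq R) (k : nat) :=
  [/\ (k <= T)%N, orthog (done T) L /\ size L = \prod_(n <- done T) q n,
      forall l, l \in L -> `|l| <= QR T / 2,
      forall l, l \in L -> cV <= nsq (ft (late T) l) &
      forall n, n \in late T -> (k <= n)%N].

Lemma stage0 : stage 0 [:: 0] 0.
Proof.
split=> //.
- by split => //=; rewrite big_nil.
- by move=> l; rewrite inE => /eqP ->; rewrite normr0 divr_ge0.
- move=> l _; rewrite /late /= ftE big_nil /nsq /= expr1n expr0n addr0.
  by apply: le_trans cV_le _; rewrite invf_le1 // ler1n.
Qed.

(** A full orthogonal set of frequencies for the late factors exists inside the
    lattices of the early ones.  By Parseval's identity the values of the late
    transform along its translate by [x] have sum 1, so one of them is large. *)
Lemma late_shift T x : exists2 g, (forall n, n \in done T -> lattice n g) &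
  cV <= nsq (ft (late T) (x + g)).
Proof.
have [|g h gl hd'|B [sB oB lB]] := @orthogonal_block R q d Q C hq hd hQ0 harr (late T) (done T).
- by rewrite filter_uniq // iota_uniq.
- move: gl hd'; rewrite mem_late mem_done => /andP[_ /asboolPn gl] /asboolP.
  by move/(early_arrow hq harr); exact.
have s1 := @sum_ft (late T) (0 :: B) x oB sB.
apply: contrapT => H.
have : \sum_(l <- 0 :: B) nsq (ft (late T) (x + l)) < \sum_(l <- 0 :: B) cV.
  rewrite !big_seq; apply: ltr_sum.
    by apply/hasP; exists 0; rewrite inE eqxx.
  move=> l lB'; rewrite ltNge; apply/negP => h; apply: H; exists l => // n nd.
  exact: lB.
rewrite s1 big_const_seq count_predT iter_addr_0 sB ltNge => /negP; apply.
rewrite -[leLHS]mulr_natr mulrC /cV ler_pdivrMr ?exprn_gt0 // mul1r -natrX ler_nat.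
exact: prod_late.
Qed.

(** For a large [T'], the factors that become early in between admit an orthogonal
    set [B] of frequencies in the lattices of the already early ones.  Each sum of
    an old frequency and a nonzero element of [B] is corrected by [late_shift] and
    reduced modulo [Q T'], both of which leave the early factors alone.  The old
    frequencies are kept: at these the late factors, being far away, are close
    to 1. *)
Lemma step T L k : stage T L k -> exists T' L', stage T' L' k.+1 /\ {subset L <= L'}.
Proof.
move=> [kT [oL sL] bL vL lk].
have pi0 := pi_ge0 R.
have [J0 hJ0] : exists J0, forall l, l \in L -> 2 * pi * Mb%:R * `|l| / 2 ^+ J0 <= 4%:R^-1.
  have [N hN] : exists N : nat, 4 * (2 * pi * Mb%:R * (QR T / 2)) < N%:R.
    by exists (Num.bound (4 * (2 * pi * Mb%:R * (QR T / 2)))); apply: archi_boundP; rewrite !mulr_ge0.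
  exists N => l /bL hl; rewrite ler_pdivrMr ?exprn_gt0 //.
  have h1 : N%:R < 2 ^+ N :> R by rewrite -natrX ltr_nat ltn_expl.
  have h2 : 2 * pi * Mb%:R * `|l| <= 2 * pi * Mb%:R * (QR T / 2).
    by rewrite ler_wpM2l // !mulr_ge0.
  by lra.
set J := maxn J0 (maxn k.+1 T).
have [T0 hT0] := early_ev hq hd hQ0 hQS harr J.
set T' := maxn T0 J.
have TT' : (T <= T')%N by rewrite /T' /J !leq_max leqnn !orbT.
have JT' : (J <= T')%N by rewrite /T' leq_max leqnn orbT.
have lateJ n : n \in late T' -> (J <= n)%N.
  rewrite mem_late => /andP[_ /asboolPn h]; rewrite leqNgt; apply/negP => nJ.
  by apply: h; apply: hT0 => //; rewrite /T' leq_maxl.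
set A := done T; set A' := done T'; set V := late T'.
have AA' : {subset A <= A'}.
  by move=> j; rewrite !mem_done => /asboolP h; apply/asboolP; exact: early_mono h.
set G := [seq j <- A' | j \notin A].
have uA' : uniq A' by rewrite filter_uniq // iota_uniq.
have uA : uniq A by rewrite filter_uniq // iota_uniq.
have pA : perm_eq A' (A ++ G).
  rewrite -(perm_filterC (mem A) A'); apply: perm_cat => //.
  apply: uniq_perm => //; first exact: filter_uniq.
  by move=> j; rewrite mem_filter /=; case jA: (j \in A) => //; rewrite AA'.
have [|g h gG hA|B [sB oB lB]] := @orthogonal_block R q d Q C hq hd hQ0 harr G A.
- by rewrite filter_uniq.
- move: gG hA; rewrite mem_filter !mem_done => /andP[/asboolPn gG _] /asboolP.
  by move/(early_arrow hq harr); exact.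
have hg x := cid2 (late_shift T' x).
pose g x := s2val (hg x).
have g1 x n : n \in A' -> lattice n (g x) by exact: s2valP (hg x) n.
have g2 x : cV <= nsq (ft V (x + g x)) by exact: s2valP' (hg x).
(* Reduction modulo [Q T'] to the interval centred at 0. *)
pose fl (x : R) : int := Num.floor (x / (Q T')%:~R + 2^-1).
pose red (x : R) : R := x - (fl x)%:~R * (Q T')%:~R.
have QT0 : (Q T')%:~R != 0 :> R by rewrite intr_eq0.
have redb x : `|red x| <= QR T' / 2.
  have -> : red x = (Q T')%:~R * (x / (Q T')%:~R - (fl x)%:~R).
    by rewrite /red; field.
  rewrite normrM ler_wpM2l //.
  have f1 : (fl x)%:~R <= x / (Q T')%:~R + 2^-1 by exact: Num.Theory.floor_le.
  have f2 : x / (Q T')%:~R + 2^-1 < (fl x)%:~R + 1.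
    by rewrite -(intrD _ _ 1) floorD1_gt.
  by rewrite ler_norml; apply/andP; split; lra.
(* The value at [y = 0] keeps the old frequencies in the new list. *)
pose f (x y : R) := if y == 0 then x else red (x + y + g (x + y)).
have fE x y : exists2 r, f x y = x + y + r & forall n, n \in A' -> lattice n r.
  rewrite /f; case: eqP => [->|_].
    by exists 0 => [|n _]; [rewrite !addr0|exact: lattice0].
  exists (g (x + y) + (- fl (x + y + g (x + y)))%:~R * (Q T')%:~R).
    by rewrite /red rmorphN mulNr addrA.
  move=> n nA'; apply: latticeD; first exact: g1.
  apply: Q_lattice => //; move: nA'; rewrite mem_done => /asboolP[]; done.
exists T', [seq f x y | x <- L, y <- 0 :: B]; split; last first.
  move=> l lL; apply/allpairsP; exists (l, 0); rewrite /f eqxx; split => //.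
  by rewrite inE eqxx.
split.
- by apply: leq_trans JT'; rewrite /J !leq_max leqnn orbT.
- split; last first.
    by rewrite size_allpairs sL sB (perm_big _ pA) big_cat.
  apply: pairwise_allpairs.
    move=> x xL; apply: sub_pairwise oB => y y' /asboolP h; apply/asboolP.
    have [r -> hr] := fE x y; have [r' -> hr'] := fE x y'.
    have -> : x + y + r - (x + y' + r') = (y - y') + (r - r') by ring.
    have GA' : {subset G <= A'} by move=> j; rewrite mem_filter => /andP[].
    apply: (zsetS_sub GA'); apply: zsetS_latticeD => // n /GA' nG.
    by apply: latticeB; [exact: hr|exact: hr'].
  apply: sub_pairwise oL => x x' /asboolP h; apply/asboolP => y y' yB yB'; apply/asboolP.
  have [r -> hr] := fE x y; have [r' -> hr'] := fE x' y'.
  have -> : x + y + r - (x' + y' + r') = (x - x') + (y - y' + (r - r')) by ring.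
  apply: (zsetS_sub AA'); apply: zsetS_latticeD => // n nA.
  apply: latticeD; first by apply: latticeB; exact: lB.
  by apply: latticeB; [apply: hr|apply: hr']; exact: AA'.
- move=> _ /allpairsP[[x y] [/= xL yB ->]]; rewrite /f; case: eqP => _ //.
  apply: le_trans (bL x xL) _; rewrite ler_wpM2r //.
  apply: le_trans (Q_growth R hQS hp2 TT'); rewrite ler_peMl //.
  by rewrite exprn_ege1 // ler1n.
- move=> _ /allpairsP[[x y] [/= xL yB ->]]; rewrite /f; case: eqP => _.
    have uV : uniq V by rewrite filter_uniq // iota_uniq.
    have hV n : n \in V -> (J0 <= n)%N.
      by move/lateJ; apply: leq_trans; rewrite /J leq_max leqnn.
    have := ft_near1 hq hQ0 hQS hMb hp2 hQ00 x uV hV.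
    move/le_trans/(_ (hJ0 x xL)) => h1.
    have h2 : 1 <= nrm (ft V x) + 4%:R^-1.
      rewrite -{1}(Normc.normc1 R).
      have -> : 1 = ft V x + - (ft V x - 1) by rewrite opprB addrC subrK.
      by apply: le_trans (nrmD _ _) _; rewrite lerD2l nrmN.
    by apply: le_trans cV_le _; rewrite -nrm_sqr; nra.
  rewrite /red -mulNr -rmorphN nsq_ft_lattice //.
  by move=> n; rewrite mem_late => /andP[nT _]; exact: Q_lattice.
- by move=> n /lateJ; apply: leq_trans; rewrite /J !leq_max leqnn orbT.
Qed.

Lemma stages : exists (T : nat -> nat) (L : nat -> seq R),
  (forall k, stage (T k) (L k) k) /\ forall k, {subset L k <= L k.+1}.
Proof.
have st (k : nat) (TL : {TL : nat * seq R | stage TL.1 TL.2 k}) :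
    {TL' : nat * seq R | stage TL'.1 TL'.2 k.+1 & {subset (sval TL).2 <= TL'.2}}.
  apply: cid2; have [T' [L' [h1 h2]]] := step (svalP TL).
  by exists (T', L').
pose fix s k : {TL : nat * seq R | stage TL.1 TL.2 k} :=
  if k is k'.+1 then exist _ (s2val (st k' (s k'))) (s2valP (st k' (s k')))
  else exist _ (0%N, [:: 0]) stage0.
exists (fun k => (sval (s k)).1), (fun k => (sval (s k)).2); split.
  by move=> k; exact: svalP (s k).
by move=> k /=; exact: s2valP' (st k (s k)).
Qed.

Variable mu : probability R R.
Hypothesis hw : forall f : R -> R, continuous f -> (exists M : R, forall x, `|f x| <= M) ->
  (fun N => avg (points (iota 0 N)) f) @ \oo --> (\int[mu]_x f x : R).
Notation muhat := (muhat mu).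

Let hX N : (0 < size (points (iota 0 N)))%N. Proof. exact: size_points_gt0. Qed.

Lemma ft_cvg t : (fun N => nsq (ft (iota 0 N) t)) @ \oo --> nsq (muhat t).
Proof. exact: (muhat_nsq_cvg hw). Qed.

Lemma ft_split T N t : (T <= N)%N ->
  ft (iota 0 N) t = ft (done T) t * ft (late T) t * ft (iota T (N - T)) t.
Proof.
move=> TN; rewrite -{1}(subnKC TN) iotaD add0n ft_cat; congr (_ * _).
by rewrite !ftE (perm_big _ (iota_perm T)) big_cat.
Qed.

(** Translation by the fixed [t] changes the late factors little, and leaves the
    frequencies of the stage within the range of [tail_bound]. *)
Lemma stage_lower : exists2 c : R, 0 < c & forall t, exists k0, forall k T L, (k0 <= k)%N ->
  stage T L k -> forall l, l \in L -> c * nsq (ft (done T) (t + l)) <= nsq (muhat (t + l)).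
Proof.
have pi0 := pi_ge0 R.
have [c0 [r [c0p r2 hc0]]] := tail_bound R hq hQ0 hQS hMb hpd hp2 hQ00.
pose s : R := (3 ^+ C.+1)^-1.
have s0 : 0 < s by rewrite invr_gt0 exprn_gt0.
have ss : s ^+ 2 = cV by rewrite /s /cV exprVn -exprM mulnC exprM -natrX.
exists ((s / 2 * c0) ^+ 2); first by rewrite exprn_gt0 // mulr_gt0 // divr_gt0.
move=> t.
have [N hN] : exists N : nat, 2 * pi * Mb%:R * `|t| * (2 / s) + `|t| / (r - 2^-1) < N%:R.
  exists (Num.bound (2 * pi * Mb%:R * `|t| * (2 / s) + `|t| / (r - 2^-1))).
  by apply: archi_boundP; rewrite addr_ge0 ?mulr_ge0 ?invr_ge0 ?subr_ge0 // ltW.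
exists N => k T L Nk [kT [oL sL] bL vL lk] l lL.
have Nk2 : N%:R < 2 ^+ k :> R.
  by rewrite -natrX ltr_nat (leq_trans (ltn_expl N (ltnSn 1))) // leq_pexp2l.
have a0 : 0 <= 2 * pi * Mb%:R * `|t| * (2 / s) by rewrite !mulr_ge0 ?invr_ge0 // ltW.
have b0 : 0 <= `|t| / (r - 2^-1) by rewrite divr_ge0 // subr_ge0 ltW.
have p2 : 0 < (2 : R) ^+ k by rewrite exprn_gt0.
have uV : uniq (late T) by rewrite filter_uniq // iota_uniq.
have h1 : s / 2 <= nrm (ft (late T) (t + l)).
  have h2 : 2 * pi * Mb%:R * `|t| / 2 ^+ k <= s / 2.
    rewrite ler_pdivrMr // -ler_pdivrMl ?divr_gt0 // invf_div mulrC; lra.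
  have h3 := @ft_lip R q d p Q hQ0 hQS a be ga Mb hMb hp2 hQ00 _ k (t + l) l uV lk.
  rewrite addrK in h3.
  have h4 : s <= nrm (ft (late T) l).
    by rewrite -ler_sqr ?nnegrE ?nrm_ge0 ?(ltW s0) // nrm_sqr ss vL.
  have h5 : nrm (ft (late T) l) <= nrm (ft (late T) (t + l)) + nrm (ft (late T) (t + l) - ft (late T) l).
    rewrite -[X in _ + X]nrmN.
    have {1}-> : ft (late T) l = ft (late T) (t + l) + - (ft (late T) (t + l) - ft (late T) l).
      by rewrite opprB addrC subrK.
    exact: nrmD.
  by have := le_trans h3 h2; lra.
have QT : 2 ^+ k <= QR T.
  by apply: le_trans (Q_pow R hQS hp2 hQ00 T); rewrite ler_weXn2l // ler1n.
have h6 j : c0 <= nrm (ft (iota T j) (t + l)).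
  apply: hc0; apply: le_trans (ler_normD _ _) _.
  have h7 := bL l lL.
  have h8 : `|t| <= QR T * (r - 2^-1) by rewrite -ler_pdivrMr ?subr_gt0 //; lra.
  by lra.
have h7 : (fun N => nsq (ft (iota 0 N) (t + l))) @ \oo --> nsq (muhat (t + l)) by exact: ft_cvg.
apply: (ler_cvg_to (cvg_cst _) h7); exists T => // M /= TM.
rewrite (ft_split _ TM) nsqM (nsqM (ft (done T) _)) [leLHS]mulrC -[leRHS]mulrA.
rewrite ler_wpM2l ?nsq_ge0 //.
rewrite exprMn -!nrm_sqr; apply: ler_pM; rewrite ?sqr_ge0 //.
  by rewrite ler_sqr ?nnegrE ?nrm_ge0 // divr_ge0 // ltW.
by rewrite ler_sqr ?nnegrE ?nrm_ge0 // ltW.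
Qed.

(** The factors that are not early start at index [k], so that their product is
    close to 1 at a fixed point. *)
Lemma stage_upper k T L x : stage T L k ->
  nsq (ft (done T) x) <= nsq (muhat x) + 4 * pi * Mb%:R * `|x| / 2 ^+ k.
Proof.
move=> [kT _ _ _ lk].
have h : (fun M => nsq (ft (iota 0 M) x) + 4 * pi * Mb%:R * `|x| / 2 ^+ k) @ \oo -->
    nsq (muhat x) + 4 * pi * Mb%:R * `|x| / 2 ^+ k.
  by apply: cvgD; [exact: ft_cvg|exact: cvg_cst].
apply: (ler_cvg_to (cvg_cst _) h); exists T => // M /= TM.
rewrite (ft_split _ TM) -mulrA -ft_cat nsqM.
set S := late T ++ _.
have uS : uniq S.
  rewrite cat_uniq filter_uniq ?iota_uniq //= andbT; apply/hasPn => j.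
  by rewrite mem_iota mem_late => /andP[Tj _]; rewrite ltnNge Tj.
have hS j : j \in S -> (k <= j)%N.
  rewrite mem_cat mem_iota => /orP[/lk //|/andP[Tj _]]; exact: leq_trans Tj.
have h1 := ft_near1 hq hQ0 hQS hMb hp2 hQ00 x uS hS.
have h2 : 1 <= nrm (ft S x) + nrm (ft S x - 1).
  rewrite -{1}(Normc.normc1 R) -[X in _ + X]nrmN.
  have {1}-> : 1 = ft S x + - (ft S x - 1) by rewrite opprB addrC subrK.
  exact: nrmD.
have h3 := nrm_ge0 (ft S x); have h4 := nrm_ft_le1 q d Q a be ga S x.
have h5 := nsq_ge0 (ft (done T) x); have h6 := nsq_ft_le1 q d Q a be ga (done T) x.
rewrite -(nrm_sqr (ft S x)).
move: (nsq _) h5 h6 (nrm (ft S x)) h2 h3 h4 => u u0 u1 v h2 v0 v1.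
set e := 2 * pi * Mb%:R * `|x| / 2 ^+ k in h1.
have -> : 4 * pi * Mb%:R * `|x| / 2 ^+ k = 2 * e by rewrite /e; ring.
have h7 : 1 - v <= e by lra.
have h8 : u * (1 - v ^+ 2) <= 1 * (2 * (1 - v)).
  by apply: ler_pM => //; nra.
by lra.
Qed.

Section WithStages.
Variables (T : nat -> nat) (L : nat -> seq R).
Hypothesis hst : forall k, stage (T k) (L k) k.
Hypothesis hsub : forall k, {subset L k <= L k.+1}.

Definition spectrum : set R := [set l | exists k, l \in L k].

Lemma L_mono k k' : (k <= k')%N -> {subset L k <= L k'}.
Proof.
move=> /subnKC <-; elim: (k' - k)%N => [|n IH]; first by rewrite addn0.
by move=> x /IH; rewrite addnS; exact: hsub.
Qed.

Lemma L_uniq k : uniq (L k).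
Proof. by have [_ [/orthog_uniq ]] := hst k. Qed.

Lemma muhat_orth k l m : l \in L k -> m \in L k -> l != m -> muhat (l - m) = 0.
Proof.
move=> lL mL lm; have [_ [oL _] _ _ _] := hst k.
have hz : zsetS (done (T k)) (l - m).
  have /(pairwiseP 0) P := oL.
  have lt i j : (i < size (L k))%N -> (j < size (L k))%N -> i != j ->
      zsetS (done (T k)) ((L k)`_i - (L k)`_j).
    move=> iL jL ij; have [lt|lt|e] := ltngtP i j; last by rewrite e eqxx in ij.
      by apply/asboolP; exact: P.
    by rewrite -opprB; apply: zsetSN; apply/asboolP; exact: P.
  rewrite -(nth_index 0 lL) -(nth_index 0 mL); apply: lt; rewrite ?index_mem //.
  apply: contraNN lm => /eqP e; apply/eqP.
  by rewrite -(nth_index 0 lL) e nth_index.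
have h0 : nsq (muhat (l - m)) = 0.
  have h1 : (fun N => nsq (ft (iota 0 N) (l - m))) @ \oo --> nsq (muhat (l - m)) by exact: ft_cvg.
  apply: (cvg_unique _ h1) => //; apply: cvg_near_cst; exists (T k) => // N /= TN.
  by rewrite (ft_split _ TN) (ft_zsetS hz) !mul0r /nsq /= expr0n addr0.
by apply: Normc.eq0_normc; apply/eqP; rewrite -sqrf_eq0 nrm_sqr h0.
Qed.

Lemma sum_L_mono k k' (F : R -> R) : (k <= k')%N ->
  \sum_(l <- L k') F l = \sum_(l <- L k) F l + \sum_(l <- L k' | l \notin L k) F l.
Proof.
move=> kk'; rewrite (bigID (mem (L k))) /=; congr (_ + _).
rewrite -big_filter; apply: perm_big; apply: uniq_perm; rewrite ?filter_uniq ?L_uniq //.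
move=> x; rewrite mem_filter; case xk: (x \in L k) => //=; exact: L_mono xk.
Qed.

(** Let [s k] be the sums, bounded by 1 and increasing.  Parseval's identity at
    stage [k] writes 1 as a sum over [L k].  The part over [L k0] is at most [s k0]
    up to an error tending to 0 ([stage_upper]), and the rest at most
    [(s k - s k0) / c] ([stage_lower]), which is small uniformly in [k]. *)
Lemma complete t (eps : R) : 0 < eps -> exists k,
  1 - eps < \sum_(l <- L k) nsq (muhat (t + l)).
Proof.
move=> e0; have [c c0 hc] := stage_lower; have [k1 hk1] := hc t.
pose s k := \sum_(l <- L k) nsq (muhat (t + l)).
apply: contrapT => /forallNP H.
have hs k : s k <= 1 - eps by have /negP := H k; rewrite -leNgt.
have nd : nondecreasing_seq s.
  move=> m n mn; rewrite /s (sum_L_mono _ mn) lerDl; apply: sumr_ge0 => l _; exact: nsq_ge0.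
have cs : cvgn s.
  by apply: nondecreasing_is_cvgn => //; exists (1 - eps) => _ [n _ <-].
set S := limn s in cs.
have SE : s @ \oo --> S by exact: cs.
have S1 : S <= 1 - eps by apply: (limr_le cs); apply: nearW.
have e4 : 0 < c * eps / 4 by rewrite divr_gt0 // mulr_gt0.
have [k0 k01 hk0] : exists2 k0, (k1 <= k0)%N & S - s k0 < c * eps / 4.
  have : \forall n \near \oo, S - c * eps / 4 < s n.
    by apply: (cvgr_gt _ SE); rewrite gtrBl.
  move=> [n0 _ hn0]; exists (maxn k1 n0); first exact: leq_maxl.
  by have := hn0 (maxn k1 n0) (leq_maxr _ _); rewrite /=; lra.
have up k : (k0 <= k)%N -> 1 <= s k0 + \sum_(l <- L k0) 4 * pi * Mb%:R * `|t + l| / 2 ^+ k + eps / 4.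
  move=> kk; have [kT [oL sL] _ _ _] := hst k.
  have e1 := sum_ft t oL sL; rewrite (sum_L_mono _ kk) in e1; rewrite -[leLHS]e1.
  apply: lerD.
    by rewrite -big_split /=; apply: ler_sum => l _; exact: stage_upper (hst k).
  have h1 : c * (\sum_(l <- L k | l \notin L k0) nsq (ft (done (T k)) (t + l))) <= s k - s k0.
    rewrite /s (sum_L_mono _ kk) addrC addKr mulr_sumr big_seq_cond [leRHS]big_seq_cond.
    apply: ler_sum => l /andP[lL _]; exact: (hk1 k (T k) (L k) (leq_trans k01 kk) (hst k)).
  have h2 : s k <= S by exact: (nondecreasing_cvgn_le nd cs k).
  by rewrite -(ler_pM2l c0); lra.
set B := \sum_(l <- L k0) 4 * pi * Mb%:R * `|t + l|.
have B0 : 0 <= B by apply: sumr_ge0 => l _; rewrite !mulr_ge0 ?pi_ge0.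
have [N hN] : exists N : nat, B * (4 / eps) < N%:R.
  by exists (Num.bound (B * (4 / eps))); apply: archi_boundP; rewrite mulr_ge0 // divr_ge0 // ltW.
have := up (maxn k0 N) (leq_maxl _ _).
rewrite -mulr_suml -/B; set k := maxn k0 N.
have p2 : 0 < (2 : R) ^+ k by rewrite exprn_gt0.
have Nk2 : N%:R < 2 ^+ k :> R.
  by rewrite -natrX ltr_nat (leq_trans (ltn_expl N (ltnSn 1))) // leq_pexp2l // /k leq_maxr.
have hB : B / 2 ^+ k <= eps / 4.
  by rewrite ler_pdivrMr // -ler_pdivrMl ?divr_gt0 // invf_div mulrC; lra.
by have := hs k0; lra.
Qed.

Lemma spectrum_e2pi t : approx mu spectrum (fun x => e2pi (t * x)).
Proof.
split; first exact: cmeas_e2pi.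
move=> eps e0; have [k hk] := complete (- t) e0.
exists (fun x => \sum_(l <- L k) (muhat (- t + l))^*%C * e2pi (l * x)).
  exists [seq ((muhat (- t + l))^*%C, l) | l <- L k]; split.
    by move=> _ /mapP[l lL ->]; exists k.
  by move=> x; rewrite big_map.
have := bessel_dist hX hw (- t) (L_uniq k) (fun l m lL mL => @muhat_orth k l m lL mL).
by rewrite opprK => ->; rewrite lte_fin; lra.
Qed.

(** Orthonormality and countability come from the stages, and density from
    [spectrum_e2pi] and [approx_L2]. *)
Lemma spectrum_basis : spectral mu.
Proof.
exists spectrum; split.
  have -> : spectrum = \bigcup_k [set` L k].
    by apply/seteqP; split => [l [k lk]|l [k _ lk]]; exists k.
  by apply: bigcup_countable => // k _; exact: finite_set_countable.
split.
- move=> l _.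
  have -> : fourier_exp l = fun x => e2pi (l * x) by apply/funext => x; exact: fourier_expE.
  apply/in_L2E; split; first exact: cmeas_e2pi.
  rewrite E2_Rintegral ?ltry //; first exact: cmeas_e2pi.
  by exists 1 => x; rewrite nsq_e2pi normr1.
- move=> l m [k lk] [k' mk]; rewrite L2inner_e2pi.
  have [->|lm] := eqVneq l m; first by rewrite subrr (muhat0 hX hw).
  by apply: (@muhat_orth (maxn k k')) => //; [apply: L_mono lk|apply: L_mono mk]; rewrite ?leq_maxl ?leq_maxr.
- move=> f /in_L2E[mf fi] eps e0.
  have [_ /(_ (eps ^+ 2) (exprn_gt0 _ e0))[h [s [hs hE]] hh]] := approx_L2 spectrum_e2pi mf fi.
  exists [fset k.2 | k in s]%fset, (fun l => \sum_(k <- s) if k.2 == l then k.1 else 0); split.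
    by move=> l /imfsetP[k /= ks ->]; exact: hs.
  apply/L2norm_lt => //.
  suff -> : (fun x => f x - \sum_(l <- [fset k.2 | k in s]%fset)
     (\sum_(k <- s) if k.2 == l then k.1 else 0) * fourier_exp l x) = fun x => f x - h x by [].
  apply/funext => x; congr (_ - _); rewrite hE.
  under eq_bigr do rewrite mulr_suml.
  rewrite exchange_big /=; apply: eq_big_seq => k ks.
  rewrite (bigD1_seq k.2) ?fset_uniq //=; last by apply/imfsetP; exists k.
  rewrite eqxx fourier_expE big1 ?addr0 // => l /negPf lk.
  by rewrite eq_sym lk mul0r.
Qed.

End WithStages.

Lemma sufficiency : spectral mu.
Proof. by have [T [L [h1 h2]]] := stages; exact: spectrum_basis h1 h2. Qed.

End Sufficiency.

(** * Averages over sums of lists and leftmost points *)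

Section AverageOverSums.
Variable R : realType.
Implicit Types (X Y Z : seq R) (f g : R -> R).

Lemma avg_sumset X Y f : avg (sumset X Y) f = avg X (fun x => avg Y (fun y => f (x + y))).
Proof.
rewrite /avg /sumset size_allpairs big_allpairs_dep /= natrM invfM mulrA.
by rewrite -mulrA [_^-1 * _]mulrC mulrA mulr_suml.
Qed.

Lemma avg1 x f : avg [:: x] f = f x.
Proof. by rewrite /avg big_seq1 divr1. Qed.

Lemma avg_perm X Y f : perm_eq X Y -> avg X f = avg Y f.
Proof. by move=> h; rewrite /avg (perm_big _ h) (perm_size h). Qed.

Lemma eq_avg X f g : (forall x, f x = g x) -> avg X f = avg X g.
Proof. by move=> h; congr avg; apply/funext. Qed.

Lemma avg_exchange X Y (f : R -> R -> R) :
  avg X (fun x => avg Y (fun y => f x y)) = avg Y (fun y => avg X (fun x => f x y)).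
Proof.
rewrite /avg -!mulr_suml exchange_big /= -!mulrA; congr (_ * _).
by rewrite mulrC.
Qed.

Lemma avgD X f g : avg X (fun x => f x + g x) = avg X f + avg X g.
Proof. by rewrite /avg big_split mulrDl. Qed.

Lemma avgZ X k f : avg X (fun x => k * f x) = k * avg X f.
Proof. by rewrite /avg -mulr_sumr mulrA. Qed.

Lemma le_avg X f g : (forall x, x \in X -> f x <= g x) -> avg X f <= avg X g.
Proof.
move=> h; rewrite /avg ler_wpM2r // big_seq [leRHS]big_seq; exact: ler_sum.
Qed.

Lemma avg_ge0 X f : (forall x, 0 <= f x) -> 0 <= avg X f.
Proof. by move=> h; rewrite /avg divr_ge0 // sumr_ge0. Qed.

Lemma avg_cst X k : (0 < size X)%N -> avg X (fun=> k) = k.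
Proof.
move=> X0; rewrite /avg big_const_seq count_predT iter_addr_0 -[k *+ _]mulr_natr mulfK //.
by rewrite pnatr_eq0 -lt0n.
Qed.

Lemma avg_atom X y f : (forall x, 0 <= f x) ->
  (count_mem y X)%:R * f y <= (size X)%:R * avg X f.
Proof.
move=> f0; case: (posnP (size X)) => [/size0nil ->|X0]; first by rewrite /= !mul0r.
rewrite mulrC /avg mulrCA mulfV ?pnatr_eq0 -?lt0n // mulr1.
rewrite (bigID (pred1 y)) /= -[leLHS]addr0 lerD ?sumr_ge0 //.
rewrite (eq_bigr (fun=> f y)) => [|x /eqP -> //].
by rewrite big_const_seq iter_addr_0 mulr_natr.
Qed.

Definition leftmost y0 X := exists2 Y, perm_eq X (y0 :: Y) & forall y, y \in Y -> y0 < y.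

Lemma leftmost_uniq X : uniq X -> (0 < size X)%N -> exists y0, leftmost y0 X.
Proof.
elim: X => // x [|z X] IH /= => [_ _|/andP[xX uX] _].
  by exists x, [::].
have [y0 [Y pY hY]] := IH uX isT.
have y0X : y0 \in z :: X by rewrite (perm_mem pY) mem_head.
have [lt|lt|e] := ltgtP x y0; last by rewrite e y0X in xX.
  exists x, (z :: X) => // y; rewrite (perm_mem pY) inE => /orP[/eqP -> //|/hY].
  exact: lt_trans.
exists y0, (x :: Y) => [|y]; last by rewrite inE => /orP[/eqP ->|/hY].
by rewrite (perm_trans (y := x :: y0 :: Y)) ?perm_cons // (perm_catCA [:: x] [:: y0] Y).
Qed.

Lemma leftmost_sumset x0 y0 X Y : leftmost x0 X -> leftmost y0 Y ->
  leftmost (x0 + y0) (sumset X Y).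
Proof.
move=> [X' pX hX] [Y' pY hY].
exists ([seq x0 + y | y <- Y'] ++ sumset X' (y0 :: Y')).
  rewrite (_ : _ :: _ = sumset (x0 :: X') (y0 :: Y')) //; exact: perm_allpairs.
move=> z; rewrite mem_cat => /orP[/mapP[y /hY yY ->]|]; first by rewrite ltrD2l.
move=> /allpairsP[[x y] [/= /hX xX + ->]].
by rewrite inE => /orP[/eqP ->|/hY yY]; [rewrite ltrD2r|exact: ltrD].
Qed.

Lemma leftmost_gap y0 X : leftmost y0 X -> exists2 Y, perm_eq X (y0 :: Y) &
  exists2 r : R, 0 < r & forall y, y \in Y -> y0 + r <= y.
Proof.
move=> [Y pY hY]; exists Y => //; elim: Y {pY} hY => [|z Y IH] hY; first by exists 1.
have [|r r0 hr] := IH; first by move=> y yY; apply: hY; rewrite inE yY orbT.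
have zy : y0 < z by apply: hY; exact: mem_head.
exists (Num.min r (z - y0)); first by rewrite lt_min r0 subr_gt0.
move=> y; rewrite inE => /orP[/eqP ->|/hr h]; rewrite -lerBrDl ge_min.
  by rewrite lexx orbT.
by rewrite lerBrDl h.
Qed.

(** Among the translates [x + Z], with [x] in [X], the weight
    [expR (- s * `|_ + b|)], exponential to the right of [- b], concentrates on the
    leftmost one as [s] grows. *)
Lemma avg_leftmost y0 X (e : R) : leftmost y0 X -> 0 < e -> exists2 s : R, 0 < s &
  forall Z b, (forall x z, x \in X -> z \in Z -> - b <= x + z) ->
  (size X)%:R * avg (sumset X Z) (fun x => expR (- s * `|x + b|)) <=
  (1 + e) * avg Z (fun z => expR (- s * `|y0 + z + b|)).
Proof.
move=> /leftmost_gap[Y pY [r r0 hr]] e0.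
pose k : R := (size Y)%:R.
exists (k / (r * e) + 1); first by rewrite ltr_wpDl // divr_ge0 // mulr_ge0 // ltW.
move=> Z b hb; set s := _ + 1.
have s0 : 0 < s by rewrite ltr_wpDl // divr_ge0 // mulr_ge0 // ltW.
have h1 : k * expR (- s * r) <= e.
  have : 1 + s * r <= expR (s * r) by exact: expR_ge1Dx.
  rewrite mulNr expRN ler_pdivrMr ?expR_gt0 // => /(ler_wpM2l (ltW e0)).
  apply: le_trans; rewrite /s.
  have -> : e * (1 + (k / (r * e) + 1) * r) = k + e * (1 + r).
    by field; rewrite !gt_eqF.
  by rewrite lerDl mulr_ge0 // ?ltW // ltr_wpDl // ltW.
rewrite avg_sumset (avg_perm _ pY) (perm_size pY) /= {1}/avg /= mulrCA mulfV ?pnatr_eq0 //.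
rewrite mulr1 big_cons mulrDl mul1r lerD2l.
set A := avg Z _.
have h2 y : y \in Y -> avg Z (fun z => expR (- s * `|y + z + b|)) <= expR (- s * r) * A.
  move=> yY; rewrite /A -avgZ; apply: le_avg => z zZ; rewrite -expRD ler_expR.
  have m0 : y0 \in X by rewrite (perm_mem pY) mem_head.
  have m1 : y \in X by rewrite (perm_mem pY) inE yY orbT.
  have h3 := hb _ _ m0 zZ; have h4 := hb _ _ m1 zZ; have h5 := hr _ yY.
  have -> : `|y + z + b| = y + z + b by apply: ger0_norm; lra.
  have -> : `|y0 + z + b| = y0 + z + b by apply: ger0_norm; lra.
  by rewrite -mulrDr ler_wnM2l ?oppr_le0 ?(ltW s0) //; lra.
have A0 : 0 <= A by apply: avg_ge0 => z; exact: expR_ge0.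
apply: (@le_trans _ _ (\sum_(y <- Y) expR (- s * r) * A)).
  by rewrite big_seq [leRHS]big_seq; apply: ler_sum.
rewrite big_const_seq count_predT iter_addr_0 -mulr_natl mulrA.
by rewrite ler_wpM2r.
Qed.

End AverageOverSums.

(** * Necessity *)

Section Necessity.
Variables (R : realType) (q d : nat -> nat) (p Q : nat -> int) (C : nat).
Hypothesis hq : forall n, q n = 2%N \/ q n = 3%N.
Hypothesis hd : forall n, (0 < d n <= C)%N.
Hypothesis hQ0 : forall n, Q n != 0.
Hypothesis hQS : forall n, Q n.+1 = Q n * p n.
Variables (a be ga : nat -> int).
Hypothesis hbe : forall n, q n = 2%N -> be n = 1 \/ be n = -1.
Hypothesis hga : forall n, q n = 3%N -> coprimez (be n) (ga n).
Variable Mb : nat.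
Notation digits := (digits q d a be ga).
Notation factor := (factor R q d Q a be ga).
Notation ft := (@ft R q d Q a be ga).
Notation points := (@points R q d Q a be ga).
Notation zset := (@zset R q d Q).
Notation period := (period R d Q).
Notation nrm := (@Normc.normc R).
Hypothesis hMb : forall n x, x \in digits n -> `|x| <= Mb%:Z.
Hypothesis hp2 : forall n, 2 <= `|p n|.
Hypothesis hQ00 : Q 0 = 1.
Hypothesis hud : forall n, uniq (digits n).

Lemma avg_points_cat S S' f :
  avg (points (S ++ S')) f = avg (points S) (fun x => avg (points S') (fun y => f (x + y))).
Proof.
elim: S f => [|n S IH] f.
  by rewrite avg1; apply: eq_avg => y; rewrite add0r.
rewrite /= !avg_sumset; apply: eq_avg => x; rewrite IH; apply: eq_avg => y.
by apply: eq_avg => z; rewrite addrA.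
Qed.

(** Convolution is commutative and associative. *)
Lemma avg_points_perm S S' f : perm_eq S S' -> avg (points S) f = avg (points S') f.
Proof.
have cat3 s1 s2 s3 : avg (points (s1 ++ s2 ++ s3)) f =
    avg (points s1) (fun x => avg (points s2) (fun y => avg (points s3) (fun z => f (x + y + z)))).
  rewrite avg_points_cat; apply: eq_avg => x; rewrite avg_points_cat; apply: eq_avg => y.
  by apply: eq_avg => z; rewrite addrA.
move=> h; have := catCA_perm_ind (P := fun S' => avg (points S) f = avg (points S') f) _ h.
apply=> // s1 s2 s3 ->; rewrite !cat3 avg_exchange; apply: eq_avg => x; apply: eq_avg => y.
by apply: eq_avg => z; rewrite [y + x]addrC.
Qed.

Lemma points_bound S x : uniq S -> x \in points S -> `|x| <= Mb%:R.
Proof.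
move=> uS xS.
have h : `|x| <= \sum_(n <- S) Mb%:R / 2 ^+ n.+1.
  elim: S {uS} x xS => [|n S IH] x; first by rewrite inE big_nil => /eqP ->; rewrite normr0.
  move=> /allpairsP[[y z] [/= yn zS ->]]; rewrite big_cons.
  apply: le_trans (ler_normD _ _) _; apply: lerD; last exact: IH.
  exact: factor_bound yn.
apply: le_trans h _.
have -> : \sum_(n <- S) Mb%:R / 2 ^+ n.+1 = Mb%:R / 2 * \sum_(n <- S) (2 ^+ n)^-1 :> R.
  by rewrite mulr_sumr; apply: eq_bigr => n _; rewrite exprS invfM mulrA.
apply: (@le_trans _ _ (Mb%:R / 2 * (2 / 2 ^+ 0))); last by rewrite expr0 divr1 divfK.
by rewrite ler_wpM2l ?divr_ge0 //; exact: (sum_pow R (J := 0) uS).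
Qed.

Lemma factor_uniq n : uniq (factor n).
Proof.
rewrite map_inj_uniq // => x y /(congr1 ( *%R^~ (Q n.+1)%:~R)).
by rewrite !divfK ?intr_eq0 // => /eqP; rewrite eqr_int => /eqP.
Qed.

Lemma leftmost_points S : exists y0, leftmost y0 (points S).
Proof.
elim: S => [|n S [y0 h]]; first by exists 0, [::].
have [|x0 h0] := leftmost_uniq (factor_uniq n); first exact: factor_gt0.
by exists (x0 + y0); exact: leftmost_sumset.
Qed.

Variable mu : probability R R.
Hypothesis hw : forall f : R -> R, continuous f -> (exists M : R, forall x, `|f x| <= M) ->
  (fun N => avg (points (iota 0 N)) f) @ \oo --> (\int[mu]_x f x : R).
Notation muhat := (muhat mu).

(** An infinite product of factors tending fast to 1 vanishes only if a factor
    does. *)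
Lemma muhat_zero x : muhat x = 0 -> exists n, favg (factor n) x = 0.
Proof.
move=> h0; apply: contrapT => /forallNP H.
have [J hJ] : exists J, 2 * pi * Mb%:R * `|x| / 2 ^+ J <= 2^-1.
  have [N hN] : exists N : nat, 2 * (2 * pi * Mb%:R * `|x|) < N%:R.
    exists (Num.bound (2 * (2 * pi * Mb%:R * `|x|))); apply: archi_boundP.
    by rewrite !mulr_ge0 // pi_ge0.
  exists N; rewrite ler_pdivrMr ?exprn_gt0 //.
  have h1 : N%:R < 2 ^+ N :> R by rewrite -natrX ltr_nat ltn_expl.
  by lra.
have f0 : 0 < nsq (ft (iota 0 J) x).
  rewrite -nrm_sqr exprn_gt0 // lt_def nrm_ge0 andbT.
  apply/eqP => /Normc.eq0_normc /eqP; rewrite ftE prodf_seq_eq0 => /hasP[n _ /=].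
  by move/eqP; exact: H.
have h1 : (fun N => nsq (ft (iota 0 N) x)) @ \oo --> nsq (muhat x).
  exact: (muhat_nsq_cvg hw).
have : nsq (ft (iota 0 J) x) / 4 <= nsq (muhat x).
  apply: (ler_cvg_to (cvg_cst _) h1); exists J => // N /= JN.
  rewrite -(subnKC JN) iotaD add0n ft_cat nsqM ler_wpM2l ?nsq_ge0 //.
  have hS n : n \in iota J (N - J) -> (J <= n)%N by rewrite mem_iota => /andP[].
  have h2 := ft_near1 hq hQ0 hQS hMb hp2 hQ00 x (iota_uniq _ _) hS.
  set z := ft _ x in h2 *.
  have h3 : 1 <= nrm z + nrm (z - 1).
    rewrite -{1}(Normc.normc1 R) -[X in _ + X]nrmN.
    have {1}-> : 1 = z + - (z - 1) by rewrite opprB addrC subrK.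
    exact: nrmD.
  by rewrite -nrm_sqr; have := nrm_ge0 z; nra.
by move: (nsq (ft _ _)) f0 => u u0; rewrite h0 /nsq /= expr0n /= addr0; lra.
Qed.

(** Uniformity in finitely many differences, so that a single finite stage
    realizes the orthogonality. *)
Lemma orth_early (L : seq R) :
  {in L &, forall l m, l != m -> muhat (l - m) = 0} -> exists N0,
  {in L &, forall l m, l != m -> exists2 n, (n < N0)%N & favg (factor n) (l - m) = 0}.
Proof.
move=> hL; pose nn x := xget 0%N [set n | favg (factor n) x = 0].
exists (\max_(x <- [seq l - m | l <- L, m <- L]) nn x).+1 => l m lL mL lm.
exists (nn (l - m)); last exact: (xgetPex 0%N (muhat_zero (hL l m lL mL lm))).
by rewrite ltnS; apply: leq_bigmax_seq => //; apply/allpairsP; exists (l, m).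
Qed.

(** [A] and [B] stand for averages over a translate of the remaining factors and
    over the full measure; [p], [h] and [q] stand for a function, its approximation
    and the error.  Going around the inequalities multiplies [Ap] by at most
    [(1 + x) ^+ 3 * rho], which is at most [1 - x] for this choice of [x]. *)
Lemma squeeze (rho K x Ap Ah Aq Bp Bh Bq : R) : 0 <= rho < 1 -> 0 <= K -> x = (1 - rho) / 8%:R ->
  0 <= Ap -> 0 <= Bq ->
  Ap <= (1 + x) * Ah + (1 + x^-1) * Aq -> Ah <= rho * K * Bh -> Aq <= K * Bq ->
  Bh <= (1 + x) * Bp + (1 + x^-1) * Bq -> K * Bp <= (1 + x) * Ap ->
  x * Ap <= 3 * K * (1 + x^-1) * Bq.
Proof.
move=> /andP[r0 r1] K0 xE Ap0 Bq0 h1 h2 h3 h4 h5.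
have x0 : 0 < x by rewrite xE; lra.
have x1 : x <= 8%:R^-1 by rewrite xE; lra.
have y0 : 0 < 1 + x^-1 by rewrite ltr_wpDl // invr_gt0.
set y := 1 + x^-1 in h1 h4 y0 *; clearbody y.
have z0 : 0 <= y * (K * Bq) by rewrite !mulr_ge0 // ltW.
have h6 : (1 + x) * Ah <= (1 + x) * (rho * K * Bh) by rewrite ler_wpM2l //; lra.
have h7 : y * Aq <= y * (K * Bq) by rewrite ler_wpM2l // ltW.
have h8 : K * Bh <= K * ((1 + x) * Bp + y * Bq) by rewrite ler_wpM2l.
have h9 : (1 + x) * (K * Bp) <= (1 + x) * ((1 + x) * Ap) by rewrite ler_wpM2l //; lra.
have r2 : 0 <= (1 + x) * rho by rewrite mulr_ge0 //; lra.
have h10 : (1 + x) * rho * (K * Bh) <= (1 + x) * rho * ((1 + x) ^+ 2 * Ap + y * (K * Bq)).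
  by rewrite ler_wpM2l //; lra.
have h11 : (1 + x) * rho <= 2 by nra.
have h12 : (1 + x) * rho * (1 + x) ^+ 2 <= 1 - x.
  have -> : rho = 1 - 8%:R * x by rewrite xE; field.
  by nra.
have h13 : (1 + x) * rho * (1 + x) ^+ 2 * Ap <= (1 - x) * Ap by rewrite ler_wpM2r.
have h14 : (1 + x) * rho * (y * (K * Bq)) <= 2 * (y * (K * Bq)) by rewrite ler_wpM2r.
by lra.
Qed.

(** Let [y0] be the leftmost sum of points of the factors in [S], and [N] large.
    For a trigonometric polynomial [h] with frequencies in the spectrum,
    replacing the factors in [S] by the list [y0 + U] does not change the mean of
    [nsq (h _)].  Keeping only the mass of [U] at 0 bounds the mean over [y0] plus
    the remaining factors by [rho * K] times the full mean, with [rho < 1] and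
    [K = size (points S)].  For the exponential weight of [avg_leftmost] this mean
    is about [K] times the full mean, and the square root of this weight is not
    approximated by such polynomials. *)
Lemma not_spectral S U : uniq S ->
  (forall n x, n \in S -> favg (factor n) x = 0 -> favg U x = 0) ->
  (size U < size (points S) * count_mem 0%R U)%N -> ~ spectral mu.
Proof.
move=> uS hU cU [Lam [_ [_ orth dens]]].
have lam_orth : forall l m, Lam l -> Lam m -> l != m -> muhat (l - m) = 0.
  by move=> l m hl hm /negPf lm; rewrite -L2inner_e2pi orth // lm.
have [y0 ly0] := leftmost_points S.
set K : R := (size (points S))%:R.
set c0 : R := (count_mem 0 U)%:R.
have c0p : 0 < c0 by rewrite ltr0n; move: cU; case: (count_mem _ _) => //; rewrite muln0.
have K0 : 0 < K by rewrite ltr0n size_points_gt0.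
set rho : R := (size U)%:R / (K * c0).
have rho01 : 0 <= rho < 1.
  apply/andP; split; first by rewrite divr_ge0 // mulr_ge0 // ltW.
  by rewrite /rho ltr_pdivrMr ?mulr_gt0 // mul1r /K /c0 -natrM ltr_nat.
have [/andP[r0 r1] U0] : 0 <= rho < 1 /\ (0 < size U)%N.
  split=> //; have := count_size (pred1 0) U; apply: leq_trans.
  by rewrite -(ltr0n R).
pose x : R := (1 - rho) / 8%:R.
have x0 : 0 < x by rewrite divr_gt0 // subr_gt0.
have [s s0 hs] := avg_leftmost ly0 x0.
pose b : R := 2 * Mb%:R.
pose w y := expR (- s * `|y + b|) : R.
(* The square root of [w]; all the points that matter lie to the right of [- b]. *)
pose phi y := expR (- s / 2 * `|y + b|) : R.
have phi2 y : nsq (phi y)%:C%C = w y.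
  rewrite /nsq /= expr0n /= addr0 /phi expr2 -expRD; congr expR.
  by rewrite -mulrDl -splitr.
have phi_cont : continuous phi.
  move=> y; apply: (@continuous_comp _ _ _ (fun y => - s / 2 * `|y + b|) expR).
    apply: cvgMr; apply: cvg_norm; apply: cvgD; [exact: cvg_id|exact: cvg_cst].
  exact: continuous_expR.
have w01 y : 0 <= w y <= 1.
  rewrite expR_ge0 /= -[leRHS]expR0 ler_expR mulNr oppr_le0 mulr_ge0 // ltW //.
pose a0 : R := expR (- s * (2 * b)).
have a0p : 0 < a0 by exact: expR_gt0.
pose y : R := 1 + x^-1.
have yp : 0 < y by rewrite addr_gt0 // invr_gt0.
pose eps : R := x * a0 / (6%:R * K * y).
have eps0 : 0 < eps by apply: divr_gt0; [exact: mulr_gt0|apply: mulr_gt0 => //; exact: mulr_gt0].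
have phiC : cmeas (fun y => (phi y)%:C%C).
  by apply: cmeas_real; exact: continuous_measurable_fun.
have phiL2 : in_L2 mu (fun y => (phi y)%:C%C).
  apply/in_L2E; split => //; rewrite E2_Rintegral ?ltry //; exists 1 => z.
  by rewrite phi2; have /andP[? ?] := w01 z; rewrite ger0_norm.
have se0 : 0 < Num.sqrt eps by rewrite sqrtr_gt0.
have [L [c [LL]]] := dens _ phiL2 _ se0.
move/(L2norm_lt _ _ se0); rewrite sqr_sqrtr ?(ltW eps0) // => hE.
pose tp := [seq (c i, i) | i <- (L : seq R)].
pose h z := \sum_(i <- L) c i * e2pi (i * z).
have hT z : h z = tsum tp z by rewrite /tsum big_map.
pose psi z := (phi z)%:C%C - h z.
have hE' : (E2 mu psi < eps%:E)%E.
  move: hE; congr (E2 mu _ < _)%E; apply/funext => z; congr (_ - _).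
  by apply: eq_bigr => i _; rewrite fourier_expE.
have psiC : continuous (fun z => nsq (psi z)).
  have [cr ci] := continuous_tsum tp.
  have e1 z : psi z = (phi z)%:C%C + (-1) * tsum tp z by rewrite /psi hT mulN1r.
  apply: continuous_nsq.
    have -> : (fun z => complex.Re (psi z)) = fun z => phi z - complex.Re (tsum tp z).
      by apply/funext => z; rewrite e1; case: (tsum tp z) => u v /=; ring.
    by move=> z; apply: cvgB; [exact: phi_cont|exact: cr].
  have -> : (fun z => complex.Im (psi z)) = fun z => - complex.Im (tsum tp z).
    by apply/funext => z; rewrite e1; case: (tsum tp z) => u v /=; ring.
  by move=> z; apply: cvgN; exact: ci.
have psib : exists M : R, forall z, `|nsq (psi z)| <= M.
  have [M hM] := nsq_tsum_bounded tp; exists (2 + 2 * M) => z.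
  have h1 := nsqD_le2 (phi z)%:C%C (- h z).
  have e1 : nsq (- h z) = nsq (h z) by rewrite -!nrm_sqr nrmN.
  have h2 := hM z; rewrite -hT ger0_norm ?nsq_ge0 // in h2.
  have /andP[_ h3] := w01 z; rewrite ger0_norm ?nsq_ge0 // /psi.
  by rewrite phi2 e1 in h1; lra.
have psim : cmeas psi.
  apply: cmeasB => //; have -> : h = tsum tp by exact/funext.
  exact: cmeas_tsum.
have [N1 hN1] : exists N1, forall N, (N1 <= N)%N ->
    avg (points (iota 0 N)) (fun z => nsq (psi z)) < eps.
  have h1 : \int[mu]_z nsq (psi z) < eps by rewrite -lte_fin -E2_Rintegral.
  have [N1 _ h2] := cvgr_lt _ (hw psiC psib) _ h1.
  by exists N1 => N; exact: h2.
have [N0 hN0] : exists N0, {in (L : seq R) &, forall l m, l != m ->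
    exists2 n, (n < N0)%N & favg (factor n) (l - m) = 0}.
  by apply: orth_early => l m lL mL; apply: lam_orth; exact: LL.
pose N := maxn (maxn N0 N1) (\max_(n <- S) n.+1).
have SN : {subset S <= iota 0 N}.
  move=> n nS; rewrite mem_iota /= /N leq_max; apply/orP; right.
  exact: (@leq_bigmax_seq _ S xpredT (fun n => n.+1)).
pose rest := [seq n <- iota 0 N | n \notin S].
have pN : perm_eq (iota 0 N) (S ++ rest).
  rewrite -(perm_filterC (mem S) (iota 0 N)); apply: perm_cat => //.
  apply: uniq_perm => //; first by rewrite filter_uniq // iota_uniq.
  by move=> n; rewrite mem_filter /=; case nS: (n \in S) => //; rewrite SN.
pose A f := avg (points rest) (fun z => f (y0 + z)) : R.
pose B f := avg (points (iota 0 N)) f : R.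
have BE f : B f = avg (sumset (points S) (points rest)) f.
  by rewrite /B (avg_points_perm _ pN) avg_points_cat avg_sumset.
have u_rest : uniq rest by rewrite filter_uniq // iota_uniq.
(* [y0] is one of the points of [S], so the translate at [y0] carries at least a
   proportion [1 / K] of the full mean. *)
have KAB f : (forall z, 0 <= f z) -> A f <= K * B f.
  move=> f0; rewrite BE avg_sumset.
  apply: le_trans (avg_atom (points S) y0 (f := fun u => avg (points rest) (fun z => f (u + z))) _).
    rewrite -[leLHS]mul1r ler_wpM2r ?avg_ge0 // (ler_nat R 1) -has_count has_pred1.
    by have [Y pY _] := ly0; rewrite (perm_mem pY) mem_head.
  by move=> u; exact: avg_ge0.
have Bh : B (fun z => nsq (h z)) = \sum_(l <- L) nsq (c l).
  apply: avg_nsq_orth; [exact: fset_uniq|exact: size_points_gt0|].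
  move=> l m lL mL lm; have [n nN hn] := hN0 l m lL mL lm.
  suff : ft (iota 0 N) (l - m) = 0 by [].
  rewrite ftE; apply/eqP; rewrite prodf_seq_eq0; apply/hasP; exists n.
    by rewrite mem_iota /= (leq_trans nN) // /N !leq_max leqnn.
  by apply/eqP.
(* Both means are the sum of the [nsq (c l)], as the exponentials are orthonormal
   for both lists. *)
have UB : avg (sumset U (sumset [:: y0] (points rest))) (fun z => nsq (h z)) = B (fun z => nsq (h z)).
  rewrite Bh; apply: avg_nsq_orth; first exact: fset_uniq.
    by rewrite !size_allpairs mul1n muln_gt0 U0 size_points_gt0.
  move=> l m lL mL lm; have [n nN hn] := hN0 l m lL mL lm.
  rewrite !favg_sumset; have [nS|nS] := boolP (n \in S).
    by rewrite (hU n) // mul0r.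
  rewrite [X in _ * (_ * X)](_ : _ = 0) ?mulr0 //.
  suff : ft rest (l - m) = 0 by [].
  rewrite ftE; apply/eqP; rewrite prodf_seq_eq0; apply/hasP; exists n.
    by rewrite mem_filter nS mem_iota /= (leq_trans nN) // /N !leq_max leqnn.
  by apply/eqP.
have Ah : A (fun z => nsq (h z)) <= rho * K * B (fun z => nsq (h z)).
  have -> : rho * K = (size U)%:R / c0 by rewrite /rho; field; rewrite !gt_eqF.
  rewrite mulrAC ler_pdivlMr // mulrC -UB avg_sumset.
  apply: le_trans (avg_atom U 0
    (f := fun u => avg (sumset [:: y0] (points rest)) (fun z => nsq (h (u + z)))) _).
    rewrite /c0 ler_wpM2l // avg_sumset avg1 /A le_eqVlt; apply/orP; left; apply/eqP.
    by apply: eq_avg => z; rewrite add0r.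
  by move=> u; apply: avg_ge0 => z; exact: nsq_ge0.
have phE z : (phi z)%:C%C = h z + psi z by rewrite /psi addrC subrK.
have hE2 z : h z = (phi z)%:C%C + (- psi z) by rewrite phE addrK.
have nsqN (z : R[i]) : nsq (- z) = nsq z by rewrite -!nrm_sqr nrmN.
have Aphi : a0 <= A w.
  rewrite -(@avg_cst R (points rest) a0) ?size_points_gt0 //; apply: le_avg => z zr.
  rewrite ler_expR ler_wnM2l ?oppr_le0 ?(ltW s0) //.
  have h1 : `|z| <= Mb%:R by exact: points_bound zr.
  have h2 : `|y0| <= Mb%:R.
    by apply: points_bound uS _; have [Y pY _] := ly0; rewrite (perm_mem pY) mem_head.
  apply: le_trans (ler_normD _ _) _; apply: le_trans (lerD (ler_normD _ _) (lexx _)) _.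
  by rewrite (ger0_norm (_ : 0 <= b)) /b ?mulr_ge0 //; lra.
have psiB : B (fun z => nsq (psi z)) < eps.
  by apply: hN1; rewrite /N !leq_max leqnn orbT.
have : x * A w <= 3 * K * y * B (fun z => nsq (psi z)).
  apply: (@squeeze rho K x (A w) (A (fun z => nsq (h z))) (A (fun z => nsq (psi z)))
    (B w) (B (fun z => nsq (h z)))) => //.
  - exact: le_trans (ltW a0p) Aphi.
  - by apply: avg_ge0 => z; exact: nsq_ge0.
  - rewrite /A -!avgZ -avgD; apply: le_avg => z _; rewrite -phi2 phE; exact: nsqD_le.
  - by apply: KAB => z; exact: nsq_ge0.
  - rewrite /B -!avgZ -avgD; apply: le_avg => z _; rewrite -phi2 hE2 -(nsqN (psi z)).
    exact: nsqD_le.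
  - rewrite BE; apply: hs => u v /(points_bound uS) hu /(points_bound u_rest) hv.
    by have := ler_norm (- u); have := ler_norm (- v); rewrite !normrN /b; lra.
have xA : x * a0 <= x * A w by rewrite ler_wpM2l // ltW.
have h1 : 3 * K * y * B (fun z => nsq (psi z)) < 3 * K * y * eps.
  by rewrite ltr_pM2l // !mulr_gt0.
have h2 : 3 * K * y * eps = x * a0 / 2.
  by rewrite /eps; field; rewrite !gt_eqF.
have h3 : 0 < x * a0 by rewrite mulr_gt0.
by lra.
Qed.

(** Kernels with transforms proportional to [1 + cos] and to [1 + 2 * cos], whose
    first zeros are at [1/2] and at [1/3] of the period.  The repeated 0 gives more
    mass to the centre. *)
Definition comb (r : nat) : seq int := if r == 2%N then [:: -1; 0; 0; 1] else [:: -1; 0; 1].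

Lemma comb_zero r (k : int) (g x : R) : r = 2%N \/ r = 3%N -> ~~ (r %| k)%Z ->
  x / g = k%:~R / r%:R -> favg [seq u%:~R / g | u <- comb r] x = 0.
Proof.
move=> hr hk hx; pose y := x / g.
have r0 : r%:R != 0 :> R by case: hr => ->; rewrite pnatr_eq0.
have ry : r%:R * y = k%:~R by rewrite /y hx mulrC divfK.
have w1 : e2pi y != 1.
  apply: contra hk => /eqP /e2pi_eq1[m hm]; apply/dvdzP; exists m.
  have /eqP := ry; rewrite hm -[r%:R]/(r%:~R) -intrM eqr_int => /eqP <-.
  exact: mulrC.
have vw := e2pi_mulN y.
have wr : e2pi (r%:R * y) = 1 by rewrite ry e2pi_int.
have w0 : e2pi y != 0 by apply/eqP => w0; move: vw; rewrite w0 mul0r => /eqP; rewrite eq_sym oner_eq0.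
have e1 (u : int) : e2pi (x * (u%:~R / g)) = e2pi (u%:~R * y) by congr e2pi; rewrite /y; ring.
rewrite /favg /fsum big_map; under eq_bigr do rewrite e1.
suff -> : \sum_(u <- comb r) e2pi (u%:~R * y) = 0 by rewrite mul0r.
case: hr r0 ry wr {hk hx} => -> _ _ wr; rewrite /comb /= !big_cons big_nil !mulN1r !mul0r !mul1r e2pi0 addr0;
  apply: (mulfI w0); rewrite mulr0 !mulrDr mulr1 vw.
- have w2 : (e2pi y - 1) * (e2pi y + 1) = 0.
    rewrite -subr_sqr expr1n expr2 -e2piD (_ : y + y = 2%:R * y) ?wr ?subrr //; ring.
  move/eqP: w2; rewrite mulf_eq0 subr_eq0 (negPf w1) /= => /eqP w2.
  have -> : 1 + (e2pi y + (e2pi y + e2pi y * e2pi y)) = (e2pi y + 1) * (e2pi y + 1) by ring.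
  by rewrite w2 mul0r.
- have w3 : (e2pi y - 1) * (1 + (e2pi y + e2pi y * e2pi y)) = 0.
    have -> : (e2pi y - 1) * (1 + (e2pi y + e2pi y * e2pi y)) = e2pi y * e2pi y * e2pi y - 1 by ring.
    by rewrite -!e2piD (_ : y + y + y = 3%:R * y) ?wr ?subrr //; ring.
  by move/eqP: w3; rewrite mulf_eq0 subr_eq0 (negPf w1) /= => /eqP.
Qed.

(** The [t]-part of the gcd is all of the [t]-part of [X]. *)
Lemma gcd_cofactor (t : nat) (X Y s : int) : prime t -> X != 0 -> Y != 0 ->
  (logn t `|X| <= logn t `|Y|)%N -> X = s * gcdz X Y -> ~~ (t %| s)%Z.
Proof.
move=> pt X0 Y0 le hX.
have hX' : `|X|%N = (`|s| * gcdn `|X| `|Y|)%N by rewrite {1}hX abszM.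
have s0 : (0 < `|s|)%N by rewrite absz_gt0; apply: contraNneq X0 => s0; rewrite hX s0 mul0r.
have G0 : (0 < gcdn `|X| `|Y|)%N by rewrite gcdn_gt0 absz_gt0 X0.
apply/negP; rewrite /dvdz /= => ts.
have h1 : (0 < logn t `|s|)%N by rewrite logn_gt0 mem_primes pt s0.
have h2 : (logn t `|X| <= logn t (gcdn `|X| `|Y|))%N.
  rewrite -pfactor_dvdn // dvdn_gcd !pfactor_dvdn ?absz_gt0 // leqnn /=.
  exact: le.
have := lognM t s0 G0; rewrite -hX'; lia.
Qed.

(** Over the common denominator [d m * d n] the periods become integers, and [g] is
    their gcd. *)
Lemma common_scale m n :
  scale_val d Q (q m) m <= scale_val d Q (q m) n -> scale_val d Q (q n) n <= scale_val d Q (q n) m ->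
  exists g (s s' : int), [/\ g != 0, period m = s%:~R * g, period n = s'%:~R * g,
    ~~ (q m %| s)%Z & ~~ (q n %| s')%Z].
Proof.
have pq k : prime (q k) by case: (hq k) => ->.
have d0 k : (0 < d k)%N by case/andP: (hd k).
move=> hm hn; pose X := Q m.+1 * (d n)%:Z; pose Y := Q n.+1 * (d m)%:Z.
have dz k : (d k)%:Z != 0 by rewrite eqz_nat -lt0n.
have X0 : X != 0 by rewrite mulf_neq0.
have Y0 : Y != 0 by rewrite mulf_neq0.
have dR k : (d k)%:R != 0 :> R by rewrite pnatr_eq0 -lt0n.
have lX t : prime t -> logn t `|X| = (logn t `|Q m.+1| + logn t (d n))%N.
  by move=> pt; rewrite abszM lognM // absz_gt0.
have lY t : prime t -> logn t `|Y| = (logn t `|Q n.+1| + logn t (d m))%N.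
  by move=> pt; rewrite abszM lognM // absz_gt0.
exists ((gcdz X Y)%:~R / ((d m)%:R * (d n)%:R)), (X %/ gcdz X Y)%Z, (Y %/ gcdz X Y)%Z.
have eX : X = (X %/ gcdz X Y)%Z * gcdz X Y by rewrite divzK // dvdz_gcdl.
have eY : Y = (Y %/ gcdz X Y)%Z * gcdz X Y by rewrite divzK // dvdz_gcdr.
split.
- by rewrite mulf_neq0 ?invr_eq0 ?mulf_neq0 // intr_eq0 gcdz_eq0 (negPf X0).
- rewrite mulrA -intrM -eX /X /period intrM -[(d n)%:Z%:~R]/((d n)%:R); field.
  by rewrite !dR.
- rewrite mulrA -intrM -eY /Y /period intrM -[(d m)%:Z%:~R]/((d m)%:R); field.
  by rewrite !dR.
- apply: (@gcd_cofactor _ X Y) => //; rewrite lX // lY //.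
  by move: hm; rewrite /scale_val; lia.
- apply: (@gcd_cofactor _ Y X) => //; last by rewrite [gcdz Y X]gcdzC.
  by rewrite lX // lY //; move: hn; rewrite /scale_val; lia.
Qed.

Lemma factor_comb n (s : int) g x : g != 0 -> period n = s%:~R * g -> ~~ (q n %| s)%Z ->
  favg (factor n) x = 0 -> favg [seq u%:~R / g | u <- comb (q n)] x = 0.
Proof.
move=> g0 hs qs /(factor_zero hq hd hQ0 a hbe hga)[_ [z [qz ->]]].
have pq : prime (q n) by case: (hq n) => ->.
apply: (@comb_zero _ (z * s)) => //.
  by rewrite dvdzE abszM Euclid_dvdM // negb_or -!(dvdzE (q n)) qz qs.
rewrite hs intrM; field.
by rewrite g0 pnatr_eq0 -lt0n prime_gt0.
Qed.

(** When no arrow joins [m] and [n], the zeros of the two factors are zeros of the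
    kernels [comb (q m)] and [comb (q n)] scaled by [g].  Their convolution gives 0
    a mass of 6/16, 4/12 or 3/9 according to [q m] and [q n], always more than
    [1 / (q m * q n)]. *)
Lemma necessity : spectral mu ->
  (forall n, resid q be ga n) /\ (forall m n, m <> n -> arrow q d Q m n \/ arrow q d Q n m).
Proof.
move=> sp; split.
- move=> n; apply: contrapT => nr; apply: (@not_spectral [:: n] [:: 0]) sp => //.
    by move=> k x; rewrite inE => /eqP -> /(factor_zero hq hd hQ0 a hbe hga)[].
  rewrite size_points // big_seq1 /= eqxx muln1.
  by case: (hq n) => ->.
- move=> m n mn; apply: contrapT => /not_orP[/not_arrow h1 /not_arrow h2].
  have [g [s [s' [g0 hs hs' qs qs']]]] := common_scale h2 h1.
  apply: (@not_spectral [:: m; n] (sumset [seq u%:~R / g | u <- comb (q m)] [seq u%:~R / g | u <- comb (q n)])) sp.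
  + by rewrite /= inE andbT; apply/eqP.
  + move=> k x; rewrite favg_sumset !inE => /orP[] /eqP -> h.
      by rewrite (factor_comb g0 hs qs h) mul0r.
    by rewrite (factor_comb g0 hs' qs' h) mulr0.
  set U := sumset _ _.
  have UE : U = [seq u%:~R / g | u <- [seq i + j | i <- comb (q m), j <- comb (q n)]].
    rewrite /U /sumset allpairs_mapl allpairs_mapr map_allpairs.
    by apply: eq_allpairs => i j; rewrite intrD mulrDl.
  have -> : size (points [:: m; n]) = (q m * q n)%N by rewrite size_points // !big_cons big_nil mulr1.
  rewrite UE size_map count_map.
  rewrite (@eq_count _ _ (pred1 (0 : int))).
    by case: (hq m) => ->; case: (hq n) => ->.
  by move=> u /=; rewrite mulf_eq0 invr_eq0 (negPf g0) orbF intr_eq0.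
Qed.

End Necessity.
(** * Translation of the arithmetic conditions *)

Section Valuation.
Implicit Types (t : nat) (x y : rat).

(** Cross-multiply with the reduced form and compare valuations. *)
Lemma nu_frac t (u v : int) : u != 0 -> v != 0 ->
  nu t (u%:~R / v%:~R) = (logn t `|u|)%:Z - (logn t `|v|)%:Z.
Proof.
move=> u0 v0; set x : rat := _ / _.
have x0 : x != 0 by rewrite mulf_neq0 ?invr_eq0 ?intr_eq0.
have e : u * denq x = numq x * v.
  apply/eqP; rewrite -(eqr_int rat) !intrM; apply/eqP.
  have d0 : (denq x)%:~R != 0 :> rat by rewrite intr_eq0 denq_neq0.
  have v0' : v%:~R != 0 :> rat by rewrite intr_eq0.
  have e1 : (numq x)%:~R = x * (denq x)%:~R by rewrite -{2}(divq_num_den x) divfK.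
  by rewrite e1 mulrAC /x divfK.
have n0 : (0 < `|numq x|)%N by rewrite absz_gt0 numq_eq0.
have d0 : (0 < `|denq x|)%N by rewrite absz_gt0 denq_neq0.
have := congr1 (fun z : int => logn t `|z|) e.
rewrite /= !abszM !lognM ?absz_gt0 // /nu; lia.
Qed.

Lemma nuM t x y : x != 0 -> y != 0 -> nu t (x * y) = nu t x + nu t y.
Proof.
move=> x0 y0; rewrite -[x in LHS]divq_num_den -[y in LHS]divq_num_den mulrACA -invfM -!intrM.
rewrite nu_frac ?mulf_neq0 ?numq_eq0 ?denq_neq0 // !abszM !lognM ?absz_gt0 ?numq_eq0 ?denq_neq0 //.
by rewrite /nu; lia.
Qed.

Lemma nu_nat t n : nu t n%:R = (logn t n)%:Z.
Proof. by rewrite /nu -[n%:R]/(n%:Z%:~R) numq_int denq_int logn1 subr0. Qed.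

Lemma nuV t x : nu t x^-1 = - nu t x.
Proof.
have [->|x0] := eqVneq x 0; first by rewrite invr0 (nu_nat t 0) logn0.
have := nuM t x0 (invr_neq0 x0).
rewrite divff // (nu_nat t 1) logn1; lia.
Qed.

Lemma nuXz t x (k : int) : x != 0 -> nu t (x ^ k) = nu t x * k.
Proof.
move=> x0; have hN n : nu t (x ^+ n) = nu t x * n%:Z.
  elim: n => [|n IH]; first by rewrite expr0 (nu_nat t 1) logn1 mulr0.
  by rewrite exprS nuM ?expf_neq0 // IH; lia.
case: k => n; first exact: hN.
by rewrite NegzE -exprnN nuV hN; lia.
Qed.

End Valuation.

Section Data.
Variables (R : realType) (p : nat -> int) (D : nat -> {fset int}) (a b c : nat -> int).
Hypothesis hdiff : forall n, (1 <= n)%N -> forall x y : int,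
  x \in D n -> y \in D n -> `|x - y| <= `|p n| - 1.
Hypothesis hcard : forall n, (1 <= n)%N -> #|` D n| = 2%N \/ #|` D n| = 3%N.
Variable M : int.
Hypothesis hM : forall n, (1 <= n)%N -> forall x : int, x \in D n -> `|x| <= M.
Hypothesis hD2 : forall n, (1 <= n)%N -> #|` D n| = 2%N -> D n = [fset a n; b n]%fset.
Hypothesis hD3 : forall n, (1 <= n)%N -> #|` D n| = 3%N -> D n = [fset a n; b n; c n]%fset.

Let q n := qn D n.+1.
Let d n := dn D a n.+1.
Let Q n := pprod p n.
Let pp n := p n.+1.
Let a' n := a n.+1.
Let be n := ((b n.+1 - a n.+1) %/ (d n)%:Z)%Z.
Let ga n := ((c n.+1 - a n.+1) %/ (d n)%:Z)%Z.
Let digs := digits q d a' be ga.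

Lemma card_23 n : q n = 2%N \/ q n = 3%N.
Proof. exact: hcard. Qed.

Let raw n := [:: a n.+1, b n.+1 & if q n == 2%N then [::] else [:: c n.+1]].

(** The cardinality of [D n.+1] forces the listed digits to be distinct. *)
Lemma raw_perm n : perm_eq (D n.+1) (raw n).
Proof.
have sub : D n.+1 =i raw n.
  move=> x; case: (card_23 n) => h.
    by rewrite (hD2 _ h) // /raw h !inE.
  by rewrite (hD3 _ h) // /raw h !inE orbA.
apply: uniq_perm => //; apply: (leq_size_uniq (fset_uniq (D n.+1))).
  by move=> x; rewrite sub.
by rewrite /raw -[size (D n.+1)]/(q n); case: (card_23 n) => ->.
Qed.

Lemma dnE n : d n = gcdn `|b n.+1 - a n.+1|%N (if q n == 2%N then 0 else `|c n.+1 - a n.+1|)%N.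
Proof.
rewrite /d /dn (perm_big _ (raw_perm n)) /raw !big_cons subrr absz0 /= gcd0n.
by case: ifP => _; rewrite ?big_cons big_nil /= ?gcdn0.
Qed.

Lemma b_neq_a n : b n.+1 != a n.+1.
Proof.
have := fset_uniq (D n.+1); rewrite (perm_uniq (raw_perm n)) /= inE negb_or.
by case/andP => /andP[]; rewrite eq_sym.
Qed.

Lemma ab_in n : a n.+1 \in D n.+1 /\ b n.+1 \in D n.+1.
Proof. by rewrite !(perm_mem (raw_perm n)) /raw !inE !eqxx orbT. Qed.

Lemma dn_gt0 n : (0 < d n)%N.
Proof. by rewrite dnE gcdn_gt0 absz_gt0 subr_eq0 b_neq_a. Qed.

Lemma dn_bound n : (0 < d n <= `|(2 * M)%R|)%N.
Proof.
rewrite dn_gt0 /=; have [aD bD] := ab_in n.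
have h1 := hM (ltn0Sn n) aD; have h2 := hM (ltn0Sn n) bD.
have : (d n <= `|(b n.+1 - a n.+1)%R|)%N.
  by rewrite dvdn_leq ?absz_gt0 ?subr_eq0 ?b_neq_a // dnE dvdn_gcdl.
lia.
Qed.

Lemma digitsE n : digs n = raw n.
Proof.
rewrite /digs /digits /raw /a' /be /ga.
have db : ((d n)%:Z %| b n.+1 - a n.+1)%Z by rewrite dvdzE dnE dvdn_gcdl.
rewrite [_%:Z * _]mulrC divzK // addrC subrK; case: ifP => h //.
have dc : ((d n)%:Z %| c n.+1 - a n.+1)%Z by rewrite dvdzE dnE h dvdn_gcdr.
by rewrite [_%:Z * _]mulrC divzK // addrC subrK.
Qed.

Lemma digits_uniq n : uniq (digs n).
Proof. by rewrite digitsE -(perm_uniq (raw_perm n)) fset_uniq. Qed.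

Lemma mem_digits n : digs n =i D n.+1.
Proof. by move=> x; rewrite digitsE (perm_mem (raw_perm n)). Qed.

Lemma modulus_ge2 n : 2 <= `|pp n|.
Proof.
have [aD bD] := ab_in n; have := hdiff (ltn0Sn n) aD bD; have := b_neq_a n.
by rewrite /pp; lia.
Qed.

Lemma scaleS n : Q n.+1 = Q n * pp n.
Proof. by rewrite /Q /pprod big_nat_recr. Qed.

Lemma scale0 : Q 0 = 1. Proof. by rewrite /Q /pprod big_geq. Qed.

Lemma scale_neq0 n : Q n != 0.
Proof.
elim: n => [|n IH]; first by rewrite scale0.
by rewrite scaleS mulf_neq0 //; have := modulus_ge2 n; case: (pp n =P 0) => // ->.
Qed.

Lemma be_unit n : q n = 2%N -> be n = 1 \/ be n = -1.
Proof.
move=> h; have e : d n = `|b n.+1 - a n.+1|%N by rewrite dnE h gcdn0.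
have ba : b n.+1 - a n.+1 != 0 by rewrite subr_eq0 b_neq_a.
have : (b n.+1 - a n.+1 = be n * (d n)%:Z) by rewrite divzK // dvdzE e.
rewrite e; move: ba; move: (b n.+1 - a n.+1) (be n) => u v u0 uv; move: uv u0.
by nia.
Qed.

Lemma be_ga_coprime n : q n = 3%N -> coprimez (be n) (ga n).
Proof.
move=> h; have e : d n = gcdn `|b n.+1 - a n.+1| `|c n.+1 - a n.+1| by rewrite dnE h.
have d0 := dn_gt0 n.
have eb : b n.+1 - a n.+1 = be n * (d n)%:Z by rewrite divzK // dvdzE e dvdn_gcdl.
have ec : c n.+1 - a n.+1 = ga n * (d n)%:Z by rewrite divzK // dvdzE e dvdn_gcdr.
move: e; rewrite eb ec !abszM /= -muln_gcdl => /esym/eqP.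
by rewrite -[X in _ == X]mul1n eqn_pmul2r.
Qed.

Notation points := (@points R q d Q a' be ga).

(** The last factor is convolved last, so the list of indices is in reverse
    order. *)
Lemma moran_avg N : avg_measure (points (rev (iota 0 N))) (moran_conv R p D N).
Proof.
elim: N => [|N IH].
  by move=> B mB; rewrite /= avg1.
rewrite -addn1 iotaD add0n cats1 rev_rcons /= addn1 /=.
set A := [fset _ | x in _]%fset.
have pA : perm_eq A (factor R q d Q a' be ga N).
  apply: uniq_perm; [exact: fset_uniq|exact: (factor_uniq R scale_neq0 digits_uniq)|].
  move=> x; apply/imfsetP/mapP => /= -[y yD ->]; exists y; rewrite 1?mulrC //.
    by rewrite mem_digits.
  by rewrite -mem_digits.
have A0 : A != fset0.
  by rewrite -cardfs_gt0 (perm_size pA) factor_gt0 //; exact: card_23.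
move=> B mB; rewrite (avg_measure_conv _ A0 IH) //; last first.
  by apply: size_points_gt0 => //; exact: card_23.
by congr EFin; rewrite !avg_sumset; exact: avg_perm.
Qed.

Lemma moran_weak mu : is_moran_measure p D mu ->
  forall f : R -> R, continuous f -> (exists M : R, forall x, `|f x| <= M) ->
  (fun N => avg (points (iota 0 N)) f) @ \oo --> (\int[mu]_x f x : R).
Proof.
move=> hmu f cf bf; have := hmu f cf bf; apply: cvg_trans; apply: near_eq_cvg.
apply: nearW => N; rewrite (Rintegral_avg _ (moran_avg N)).
- by apply: avg_points_perm; rewrite perm_rev.
- by apply: size_points_gt0; exact: card_23.
- exact: continuous_measurable_fun.
Qed.

Lemma mem_residues2 m (u v z : int) :
  (z \in residues m [fset u; v]%fset) = (z == (u %% m)%Z) || (z == (v %% m)%Z).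
Proof.
apply/imfsetP/orP => /= [[x + ->]|[]/eqP ->].
- by rewrite !inE => /orP[/eqP -> | /eqP ->]; rewrite eqxx; [left|right].
- by exists u; rewrite // !inE eqxx.
- by exists v; rewrite // !inE eqxx orbT.
Qed.

Lemma residuesE (u v : int) :
  residues 3 [fset u; v]%fset = residues 3 [fset (-1); 1]%fset <->
  ~~ (3 %| u)%Z /\ (3 %| u + v)%Z.
Proof.
split => [/fsetP h|[h1 h2]].
  have := h 1; have := h 2; rewrite !mem_residues2 /=; lia.
by apply/fsetP => z; rewrite !mem_residues2; apply/idP/idP; lia.
Qed.

Lemma residues_resid n : (q n = 3%N ->
    residues 3 [fset be n; ga n]%fset = residues 3 [fset (-1); 1]%fset) <-> resid q be ga n.
Proof. by split => h /h /residuesE. Qed.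

Lemma card_prime n : prime (q n). Proof. by case: (card_23 n) => ->. Qed.

Lemma nu_ratio t n : nu t (moran_ratio p D a n.+1) = scale_val d Q t n - (logn t (q n))%:Z.
Proof.
have q0 : (0 < q n)%N by rewrite prime_gt0 // card_prime.
rewrite /moran_ratio -/(Q n.+1) -/(d n) -/(q n) -natrM.
rewrite -[(d n * q n)%:R]/((d n * q n)%:Z%:~R) nu_frac ?scale_neq0 //.
  by rewrite /= lognM ?dn_gt0 // /scale_val; lia.
by rewrite eqz_nat -lt0n muln_gt0 dn_gt0.
Qed.

Lemma kn_scale_val n : kn p D a n.+1 = scale_val d Q (q n) n - 1.
Proof. by rewrite /kn nu_ratio logn_prime ?card_prime // eqxx. Qed.

(** Dividing by a power of [q n] does not affect the valuation at another prime. *)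
Lemma nu_Ln m n : q m <> q n -> nu (q m) (Ln p D a n.+1) = scale_val d Q (q m) n.
Proof.
move=> mn; have q0 : (q n)%:R != 0 :> rat by rewrite pnatr_eq0 -lt0n prime_gt0 // card_prime.
have l0 : logn (q m) (q n) = 0%N.
  by rewrite logn_prime ?card_prime //; case: eqP mn.
have r0 : moran_ratio p D a n.+1 != 0.
  rewrite /moran_ratio mulf_neq0 ?invr_eq0 ?intr_eq0 ?scale_neq0 // mulf_neq0 //.
  by rewrite pnatr_eq0 -lt0n dn_gt0.
rewrite /Ln -/(q n) nuM ?invr_eq0 ?expfz_neq0 // nuV nuXz // nu_nat l0 nu_ratio l0.
lia.
Qed.

(** Since [k_n] is the valuation of [period n] at [q n] minus 1, (i) says that two
    indices of a class have different valuations, and the two alternatives of (ii)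
    are the two arrows. *)
Lemma arrow_conditions m n :
  (arrow q d Q m n \/ arrow q d Q n m) <->
  (q m = q n -> kn p D a m.+1 <> kn p D a n.+1) /\
  (q m <> q n -> nu (q m) (Ln p D a n.+1) <= kn p D a m.+1 \/
                 nu (q n) (Ln p D a m.+1) <= kn p D a n.+1).
Proof.
rewrite /arrow !kn_scale_val; have [e|e] := eqVneq (q m) (q n).
  rewrite -e; split => [h|[/(_ erefl) h _]]; last lia.
  by split => // _; lia.
have {}e : q m <> q n by apply/eqP.
rewrite !nu_Ln //; last by move=> /esym.
split => [h|[_ /(_ e) h]]; last lia.
by split => // _; lia.
Qed.

End Data.

Theorem theorem1p5 (R : realType) (p : nat -> int) (D : nat -> {fset int})
    (a b c : nat -> int) (mu : probability R R)
    (hdiff : forall n, (1 <= n)%N -> forall x y : int,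
       x \in D n -> y \in D n -> `|x - y| <= `|p n| - 1)
    (hcard : forall n, (1 <= n)%N -> #|` D n| = 2%N \/ #|` D n| = 3%N)
    (hbounded : exists M : int, forall n, (1 <= n)%N ->
       forall x : int, x \in D n -> `|x| <= M)
    (hD2 : forall n, (1 <= n)%N -> #|` D n| = 2%N ->
       D n = [fset a n; b n]%fset)
    (hD3 : forall n, (1 <= n)%N -> #|` D n| = 3%N ->
       D n = [fset a n; b n; c n]%fset)
    (hmu : is_moran_measure p D mu) :
  spectral mu <->
  (forall n, (1 <= n)%N -> qn D n = 3%N ->
     residues 3 [fset ((b n - a n) %/ (dn D a n)%:Z)%Z;
                      ((c n - a n) %/ (dn D a n)%:Z)%Z]%fset
     = residues 3 [fset (-1); 1]%fset) /\
  (forall m n, (1 <= m)%N -> (1 <= n)%N -> m <> n ->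
     (qn D m = qn D n -> kn p D a m <> kn p D a n) /\
     (qn D m <> qn D n ->
        nu (qn D m) (Ln p D a n) <= kn p D a m \/
        nu (qn D n) (Ln p D a m) <= kn p D a n)).
Proof.
have [M hM] := hbounded.
have hq := card_23 hcard; have hd := dn_bound hcard hM hD2 hD3.
have hQ0 := scale_neq0 hdiff hcard hD2 hD3.
have hbe := be_unit hcard hD2 hD3; have hga := be_ga_coprime hcard hD2 hD3.
have hp2 := modulus_ge2 hdiff hcard hD2 hD3.
have hmem := mem_digits hcard hD2 hD3.
have hud := digits_uniq hcard hD2 hD3.
have hw := moran_weak hdiff hcard hD2 hD3 hmu.
have hMb n x : x \in digits (fun n => qn D n.+1) (fun n => dn D a n.+1) (fun n => a n.+1)
    (fun n => ((b n.+1 - a n.+1) %/ (dn D a n.+1)%:Z)%Z)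
    (fun n => ((c n.+1 - a n.+1) %/ (dn D a n.+1)%:Z)%Z) n -> `|x| <= `|M|%N%:Z.
  by rewrite hmem => /(hM _ (ltn0Sn n)) h; lia.
split => [sp|[hres harr]].
  have [hres harr] := necessity hq hd hQ0 (scaleS p) hbe hga hMb hp2 (scale0 p) hud hw sp.
  split; first by case=> // n _; apply/(residues_resid D a b c); exact: hres.
  case=> // m [//|n] _ _ mn; apply/(arrow_conditions hdiff hcard hD2 hD3).
  by apply: harr => e; rewrite e in mn.
apply: (sufficiency hq hd hQ0 (scaleS p) hbe hga hMb _ hp2 (scale0 p) _ _ hw).
- by move=> n x y; rewrite !hmem; exact: hdiff.
- by move=> n; apply/(residues_resid D a b c); exact: hres.
- by move=> m n mn; apply/(arrow_conditions hdiff hcard hD2 hD3); apply: harr => // -[].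
Qed.
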